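(* We have the generating function $$\tilde D_{n+2}^{CFC}(q)=Q_{n+2}(q)+\frac{2^{n+2}+2(n+2)}{1-q^{2(n+1)}}\,q^{2(n+1)},$$ where $Q_{n+2}(q)$ is a polynomial in $q$ of degree $n+3$ such that $Q_4(q)=1+5q+14q^2+28q^3+33q^4+16q^5$, $Q_5(q)=1+6q+20q^2+46q^3+73q^4+72q^5+32q^6$, and for $n\ge 4$, $$Q_{n+2}(q)=(2q+1)Q_{n+1}(q)-q\,Q_n(q).$$ Moreover, the coefficients of $\tilde D_{n+2}^{CFC}(q)$ are ultimately periodic of exact period $2(n+1)$, and the periodicity starts at length $n+2$.
   Context: $\tilde D_{n+2}$ (with $n\ge 2$) is the affine Coxeter group with generators $t_1,t_2,s_1,\dots,s_{n-1},u_1,u_2$ whose Coxeter diagram has edges $t_1-s_1$, $t_2-s_1$, $s_i-s_{i+1}$ ($1\le i\le n-2$), $s_{n-1}-u_1$, $s_{n-1}-u_2$, all with $m=3$. For a Coxeter group $W$ with length $\ell$, an element is fully commutative (FC) if any two of its reduced expressions are related by a sequence of transpositions of adjacent commuting generators. A cyclic shift of a word $s_{i_1}\cdots s_{i_k}$ is any word $s_{i_j}\cdots s_{i_k}s_{i_1}\cdots s_{i_{j-1}}$. An element is cyclically fully commutative (CFC) if every cyclic shift of every one of its reduced expressions is a reduced expression of an FC element. $W^{CFC}$ is the set of CFC elements, and $W^{CFC}(q)=\sum_{w\in W^{CFC}}q^{\ell(w)}$ (a formal power series). A sequence $(a_k)_{k\ge0}$ is ultimately periodic of exact period $N$ with periodicity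 starting at length $L$ if $a_{k+N}=a_k$ for all $k\ge L$, $N$ is the least positive integer that is an eventual period, and $L$ is the least integer with this property.
   Formalization: The periodicity is proved to start at length n+4, not n+2: since Q_{n+2} has degree n+3 < 2(n+1), the coefficient of q^{n+3} is nonzero but that of q^{n+3+2(n+1)} is zero, so the stated start n+2 is false for every n ≥ 2. *)

(* Defs.v *)
From HB Require Import structures.
From mathcomp Require Import all_boot all_order all_algebra finmap.
From mathcomp Require Import boolp classical_sets functions cardinality.

Set Implicit Arguments.
Unset Strict Implicit.
Unset Printing Implicit Defensive.

Import GRing.Theory.

(** * Coxeter groups *)

(* m i j = 0 encodes m(i, j) = oo. *)
Record coxeter_matrix (I : finType) := CoxeterMatrix {
  coxeter_m :> I -> I -> nat;
  coxeter_mxx : forall i, coxeter_m i i = 1;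
  coxeter_msym : forall i j, coxeter_m i j = coxeter_m j i;
  coxeter_mneq : forall i j, i != j -> coxeter_m i j != 1
}.

Section CoxeterGroup.
Variables (I : finType) (M : coxeter_matrix I).
Implicit Types (r u v : seq I) (i j : I).

(* The congruence on words generated by (i j)^m(i,j) = 1. As m(i,i) = 1, the
   quotient monoid is already the Coxeter group. For m(i,j) = 0 the relation
   is void, as it should be. *)
Inductive coxeter_cong : seq I -> seq I -> Prop :=
| coxeter_cong_refl u : coxeter_cong u u
| coxeter_cong_sym u v : coxeter_cong u v -> coxeter_cong v u
| coxeter_cong_trans u v r :
    coxeter_cong u v -> coxeter_cong v r -> coxeter_cong u r
| coxeter_cong_rel u v i j :
    coxeter_cong (u ++ flatten (nseq (M i j) [:: i; j]) ++ v) (u ++ v).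

Definition coxeter_congb : rel (seq I) := fun u v => `[< coxeter_cong u v >].

Lemma coxeter_congb_refl : reflexive coxeter_congb.
Proof. by move=> u; apply/asboolP; apply: coxeter_cong_refl. Qed.

Lemma coxeter_congb_sym : symmetric coxeter_congb.
Proof.
by move=> u v; apply/asboolP/asboolP => /coxeter_cong_sym.
Qed.

Lemma coxeter_congb_trans : transitive coxeter_congb.
Proof.
move=> v u r /asboolP uv /asboolP vr; apply/asboolP.
exact: coxeter_cong_trans uv vr.
Qed.

Canonical coxeter_equiv := EquivRel coxeter_congb coxeter_congb_refl
  coxeter_congb_sym coxeter_congb_trans.

Definition coxeter_group := {eq_quot coxeter_equiv}%qT.

HB.instance Definition _ := Choice.on coxeter_group.
HB.instance Definition _ := EqQuotient.on coxeter_group.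

Definition cword u : coxeter_group := (\pi_coxeter_group u)%qT.
Definition cgen i : coxeter_group := cword [:: i].

Lemma cword_eqP u v : cword u = cword v <-> coxeter_cong u v.
Proof.
split=> [uv|uv]; first by apply/asboolP; apply/(eqmodP coxeter_equiv).
by apply/(eqmodP coxeter_equiv); apply/asboolP.
Qed.

Lemma cword_repr (x : coxeter_group) : cword (repr x) = x.
Proof. exact: reprK. Qed.

Lemma coxeter_cong_catl r u v :
  coxeter_cong u v -> coxeter_cong (r ++ u) (r ++ v).
Proof.
elim=> {u v} [u|u v _|u v w _ + _|u v i j].
- exact: coxeter_cong_refl.
- exact: coxeter_cong_sym.
- exact: coxeter_cong_trans.
- by rewrite !catA -(catA (r ++ u)); apply: coxeter_cong_rel.
Qed.

Lemma coxeter_cong_catr r u v :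
  coxeter_cong u v -> coxeter_cong (u ++ r) (v ++ r).
Proof.
elim=> {u v} [u|u v _|u v w _ + _|u v i j].
- exact: coxeter_cong_refl.
- exact: coxeter_cong_sym.
- exact: coxeter_cong_trans.
- by rewrite -!catA; apply: coxeter_cong_rel.
Qed.

Lemma coxeter_cong_rev u v : coxeter_cong u v -> coxeter_cong (rev u) (rev v).
Proof.
elim=> {u v} [u|u v _|u v w _ + _|u v i j].
- exact: coxeter_cong_refl.
- exact: coxeter_cong_sym.
- exact: coxeter_cong_trans.
- have -> : rev (u ++ flatten (nseq (M i j) [:: i; j]) ++ v)
          = rev v ++ flatten (nseq (M j i) [:: j; i]) ++ rev u.
    rewrite !rev_cat -catA (coxeter_msym M j i); congr (_ ++ (_ ++ _)).
    elim: (M i j) => // k IH.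
    have -> : nseq k.+1 [:: i; j] = rcons (nseq k [:: i; j]) [:: i; j].
      by elim: k {IH} => //= k ->.
    by rewrite flatten_rcons rev_cat IH.
  by rewrite rev_cat; apply: coxeter_cong_rel.
Qed.

Lemma coxeter_cong_revV u : coxeter_cong (rev u ++ u) [::].
Proof.
elim: u => [|i u IH]; first exact: coxeter_cong_refl.
rewrite rev_cons -cats1 -catA cat1s; apply: coxeter_cong_trans IH.
by have := coxeter_cong_rel (rev u) u i i; rewrite coxeter_mxx.
Qed.

Definition cmul (x y : coxeter_group) := cword (repr x ++ repr y).
Definition cinv (x : coxeter_group) := cword (rev (repr x)).

Lemma cmulE u v : cmul (cword u) (cword v) = cword (u ++ v).
Proof.
apply/cword_eqP; apply: (@coxeter_cong_trans _ (u ++ repr (cword v))).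
  by apply: coxeter_cong_catr; apply/cword_eqP; rewrite cword_repr.
by apply: coxeter_cong_catl; apply/cword_eqP; rewrite cword_repr.
Qed.

Lemma cinvE u : cinv (cword u) = cword (rev u).
Proof.
by apply/cword_eqP/coxeter_cong_rev/cword_eqP; rewrite cword_repr.
Qed.

Lemma cmulA : associative cmul.
Proof.
move=> x y z; rewrite -(cword_repr x) -(cword_repr y) -(cword_repr z).
by rewrite !cmulE catA.
Qed.

Lemma cmul1x : left_id (cword [::]) cmul.
Proof. by move=> x; rewrite -(cword_repr x) cmulE. Qed.

Lemma cmulx1 : right_id (cword [::]) cmul.
Proof. by move=> x; rewrite -(cword_repr x) cmulE cats0. Qed.

Lemma cmulVx : left_inverse (cword [::]) cinv cmul.
Proof.
move=> x; rewrite -(cword_repr x) cinvE cmulE.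
by apply/cword_eqP/coxeter_cong_revV.
Qed.

Lemma cmulxV : right_inverse (cword [::]) cinv cmul.
Proof.
move=> x; rewrite -(cword_repr x) cinvE cmulE.
by apply/cword_eqP; rewrite -{1}[repr x]revK; apply: coxeter_cong_revV.
Qed.

HB.instance Definition _ := isGroup.Build coxeter_group
  cmulA cmul1x cmulx1 cmulVx cmulxV.

Lemma cwordM u v : (cword u * cword v)%g = cword (u ++ v).
Proof. exact: cmulE. Qed.

Lemma cwordE u : cword u = (\prod_(i <- u) cgen i)%g.
Proof.
elim: u => [|i u IH]; first by rewrite big_nil.
by rewrite big_cons -IH cwordM.
Qed.

Lemma cgen_rel i j : ((cgen i * cgen j) ^+ M i j = 1)%g.
Proof.
have -> k : ((cgen i * cgen j) ^+ k)%g = cword (flatten (nseq k [:: i; j])).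
  elim: k => [|k IH]; first by rewrite expg0.
  by rewrite expgS IH /cgen !cwordM.
by apply/cword_eqP; have := coxeter_cong_rel [::] [::] i j; rewrite cats0.
Qed.

(** * Length, fully commutative and cyclically fully commutative elements *)

Implicit Types w : coxeter_group.

Lemma cword_tuple_ex w : exists k, [exists t : k.-tuple I, cword t == w].
Proof.
exists (size (repr w)); apply/existsP; exists (in_tuple (repr w)).
by rewrite /= cword_repr.
Qed.

Definition clength w : nat := ex_minn (cword_tuple_ex w).

Definition reduced r := size r == clength (cword r).

Definition reduced_expr w r := reduced r && (cword r == w).

Inductive comm_equiv : seq I -> seq I -> Prop :=
| comm_equiv_refl r : comm_equiv r r
| comm_equiv_step u v i j r : commute (cgen i) (cgen j) ->
    comm_equiv (u ++ [:: j; i] ++ v) r -> comm_equiv (u ++ [:: i; j] ++ v) r.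

Definition fully_commutative w : Prop :=
  forall r r', reduced_expr w r -> reduced_expr w r' -> comm_equiv r r'.

Definition cyclically_fully_commutative w : Prop :=
  forall r k, reduced_expr w r ->
    reduced (rot k r) /\ fully_commutative (cword (rot k r)).

Local Open Scope classical_set_scope.

Definition CFC_of_length (k : nat) : set coxeter_group :=
  [set w | cyclically_fully_commutative w /\ clength w = k].

Lemma CFC_of_length_finite k : finite_set (CFC_of_length k).
Proof.
have : finite_set [set cword (t : k.-tuple I) | t in [set: k.-tuple I]].
  exact: finite_image.
apply: sub_finite_set => w [_]; rewrite /clength.
case: ex_minnP => m /existsP[t /eqP tw] _ mk.
by move: t tw; rewrite mk => t tw; exists t.
Qed.

Definition CFC_count (k : nat) : nat := #|` fset_set (CFC_of_length k)|.

End CoxeterGroup.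

Local Open Scope ring_scope.

(** * Formal power series *)

(* A formal power series is its sequence of coefficients. *)
Section PowerSeries.
Variable R : unitRingType.
Implicit Types a b : nat -> R.

Definition ps_of_poly (p : {poly R}) : nat -> R := fun k => p`_k.

Definition ps_add a b : nat -> R := fun k => a k + b k.

Definition ps_mul a b : nat -> R := fun k => \sum_(i < k.+1) a i * b (k - i)%N.

Fixpoint ps_inv_prefix a (k : nat) : seq R :=
  if k is k'.+1 then
    let s := ps_inv_prefix a k' in
    rcons s ((a 0%N)^-1 *
      ((k' == 0%N)%:R - \sum_(i < k') a (k' - i)%N * s`_i))
  else [::].

(* Meaningful only if a 0 is invertible: see ps_mulV. *)
Definition ps_inv a : nat -> R := fun k => (ps_inv_prefix a k.+1)`_k.

Lemma size_ps_inv_prefix a k : size (ps_inv_prefix a k) = k.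
Proof. by elim: k => //= k IH; rewrite size_rcons IH. Qed.

Lemma ps_inv_prefixE a k i : (i < k)%N -> (ps_inv_prefix a k)`_i = ps_inv a i.
Proof.
elim: k => // k IH; rewrite ltnS leq_eqVlt => /predU1P[->//|ik].
by rewrite /= nth_rcons size_ps_inv_prefix ik IH.
Qed.

Lemma ps_mulV a : a 0%N \is a GRing.unit ->
  ps_mul a (ps_inv a) =1 ps_of_poly 1.
Proof.
move=> ua k; rewrite /ps_mul /ps_of_poly coef1 big_ord_recl subn0.
have -> : ps_inv a k = (a 0%N)^-1 *
    ((k == 0%N)%:R - \sum_(i < k) a (k - i)%N * ps_inv a i).
  rewrite {1}/ps_inv /= nth_rcons size_ps_inv_prefix ltnn eqxx.
  by under eq_bigr => i _ do rewrite ps_inv_prefixE//.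
rewrite mulrA divrr// mul1r -[RHS](subrK (\sum_(i < k) a (k - i)%N * ps_inv a i)).
congr (_ + _); rewrite [RHS](reindex_inj rev_ord_inj) /=.
apply: eq_bigr => i _; rewrite /bump add1n subKn ?ltn_ord//.
Qed.

End PowerSeries.

Definition CFC_series (I : finType) (M : coxeter_matrix I) : nat -> int :=
  fun k => (CFC_count M k)%:Z.

(** * Ultimately periodic sequences *)

Definition periodic_from (T : Type) (a : nat -> T) (N L : nat) : Prop :=
  forall k, (L <= k)%N -> a (k + N)%N = a k.

Definition ultimately_periodic (T : Type) (a : nat -> T) (N L : nat) : Prop :=
  [/\ (0 < N)%N,
      periodic_from a N L,
      forall N', (0 < N')%N -> (exists L', periodic_from a N' L') ->
        (N <= N')%N
    & forall L', periodic_from a N L' -> (L <= L')%N].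

(** * The Coxeter group of type affine D *)

Section SimplyLaced.
Variables (I : finType) (e : rel I).
Hypothesis e_sym : symmetric e.

Definition simply_laced_m (i j : I) : nat :=
  if i == j then 1%N else if e i j then 3 else 2.

Lemma simply_laced_mxx i : simply_laced_m i i = 1%N.
Proof. by rewrite /simply_laced_m eqxx. Qed.

Lemma simply_laced_msym i j : simply_laced_m i j = simply_laced_m j i.
Proof. by rewrite /simply_laced_m eq_sym e_sym. Qed.

Lemma simply_laced_mneq i j : i != j -> simply_laced_m i j != 1%N.
Proof. by rewrite /simply_laced_m => /negPf->; case: ifP. Qed.

Definition simply_laced : coxeter_matrix I :=
  CoxeterMatrix simply_laced_mxx simply_laced_msym simply_laced_mneq.

End SimplyLaced.

(* The vertices t_1, t_2 are inl (inl b), the s_{i+1} for i < n - 1 are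
   inl (inr i), and u_1, u_2 are inr b. *)
Definition affD_gen (n : nat) : finType := (bool + 'I_n.-1 + bool)%type.

Definition affD_arrow n (x y : affD_gen n) : bool :=
  match x, y with
  | inl (inl _), inl (inr i) => i == 0%N :> nat
  | inl (inr i), inl (inr j) => i.+1 == j :> nat
  | inl (inr i), inr _ => i.+1 == n.-1 :> nat
  | _, _ => false
  end.

Definition affD_edge n : rel (affD_gen n) :=
  fun x y => affD_arrow x y || affD_arrow y x.

Lemma affD_edge_sym n : symmetric (@affD_edge n).
Proof. by move=> x y; rewrite /affD_edge orbC. Qed.

(* Type affine D_{n+2}; only meaningful for 2 <= n. *)
Definition affD (n : nat) : coxeter_matrix (affD_gen n) :=
  simply_laced (@affD_edge_sym n).

(* Main.v *)
Require Import Defs.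
From mathcomp Require Import all_boot all_order all_algebra finmap.
From mathcomp Require Import boolp classical_sets cardinality.
From mathcomp Require Import zify ring.

(** A reduced word of a group element is studied up to transposition of adjacent
commuting letters, and all conditions are expressed by counting, for each
occurrence of a letter, the neighbours of that letter before it.

In a simply laced Coxeter group, commutations bring two successive occurrences
of a letter [i] together to a factor [ii] or [iji] exactly when they are
separated by fewer than two neighbours of [i]. A word without such a gap is
reduced, and all reduced words of its element are obtained from it by
commutations ([gap_ok_reduced_unique], an exchange argument based on the signs
of roots); conversely a reduced word of a fully commutative element has no such
gap. Around the circle, the elements that are cyclically fully commutative of
length [k] become the commutation classes of words of size [k] whose cyclic
gaps, for each letter that is repeated, contain at least two neighbours of the
letter ([CFC_count_representatives]).

The vertices of the affine diagram of type D are placed on the levels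
0, ..., n, with two leaves on each of the extreme levels and one vertex on each
inner level.

A word without repeated letters satisfies the condition on gaps. Its class is an
orientation of the forest induced on its letters, so these words contribute
the sum of 2 ^ e(S) q ^ |S| over the sets [S] of vertices, where e(S) is the
number of edges inside [S]. A transfer matrix along the diagram computes this
polynomial; its trace 1 + 2q and determinant q give the recurrence, and the set
of all vertices gives the leading term 2 ^ (n + 2) q ^ (n + 3).

If some letter is repeated, a maximum principle shows that all levels
have the same number 2k of letters, and then that every cyclic gap contains
exactly two neighbours ([cyc_ok_full]). Such a word is determined by its first
occurrences. Either the two left leaves are out of phase with respect to
level 1, and then consecutive levels alternate ([outphase_upper]) and the word
is the k-th power of one of the 2 ^ (n + 2) words [alternating]; or they are in
phase, and then the word runs back and forth between the two ends
([inphase_upper]) and is the k-th power of one of the 2 (n + 2) cuts of a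
circular [zigzag]. All these periods have length 2 (n + 1). Thus there are
2 ^ (n + 2) + 2 (n + 2) words with a repeated letter in each length that is a
positive multiple of 2 (n + 1), and none in other lengths. *)

Set Implicit Arguments.
Unset Strict Implicit.
Unset Printing Implicit Defensive.

Import Order.TTheory GRing.Theory Num.Theory.

(** * Interleavings of two letters *)

Section Prefix.
Variable I : eqType.
Implicit Types (i j x y : I) (r s A B : seq I).

(** Occurrences are counted from 0, and the value is meaningful only if [l] is
less than the number of occurrences of [i]. *)
Fixpoint pre i l r : seq I :=
  if r is x :: r' then
    if x == i then (if l is l'.+1 then x :: pre i l' r' else [::])
    else x :: pre i l r'
  else [::].

Lemma pre_cat i l r s : pre i l (r ++ s) =
  if l < count_mem i r then pre i l r else r ++ pre i (l - count_mem i r) s.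
Proof.
elim: r l => [|x r IH] l /=; first by rewrite subn0.
case: (x =P i) => [->|_] /=; last by rewrite IH add0n; case: ifP.
by case: l => [|l] //=; rewrite IH add1n ltnS; case: ifP => //; rewrite subSS.
Qed.

Lemma pre_occ i A B : pre i (count_mem i A) (A ++ i :: B) = A.
Proof. by rewrite pre_cat ltnn subnn /= eqxx cats0. Qed.

Lemma pre_split i l r : l < count_mem i r -> exists B, r = pre i l r ++ i :: B.
Proof.
elim: r l => [|x r IH] l //=; case: (x =P i) => [->|_] /=.
  case: l => [_|l]; first by exists r.
  by rewrite add1n ltnS => /IH[B rE]; exists B; rewrite /= -rE.
by rewrite add0n => /IH[B rE]; exists B; rewrite -rE.
Qed.

Lemma count_pre i l r : l < count_mem i r -> count_mem i (pre i l r) = l.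
Proof.
elim: r l => [|x r IH] l //=; case: (x =P i) => [->|/eqP/negPf ne] /=.
  by case: l => [//|l]; rewrite add1n ltnS => /IH /= ->; rewrite eqxx.
by rewrite add0n => /IH /= ->; rewrite ne.
Qed.

Lemma pre_filter i l r (p : pred I) : p i -> l < count_mem i r ->
  pre i l (filter p r) = filter p (pre i l r).
Proof.
move=> pi; elim: r l => [|x r IH] l //=; case: (x =P i) => [->|/eqP ne] /=.
  rewrite pi /= eqxx; case: l => [|l] //; rewrite add1n ltnS => /IH ->.
  by rewrite /= pi.
by rewrite add0n => /IH E; case: ifP => px; rewrite /= ?(negPf ne) E.
Qed.

Lemma count_mem_filter (p : pred I) j r :
  count_mem j (filter p r) = if p j then count_mem j r else 0.
Proof.
rewrite count_filter; case: ifP => pj.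
  by apply: eq_count => x /=; case: eqP => // ->; rewrite pj.
apply/eqP; rewrite -leqn0 leqNgt -has_count; apply/hasPn => x _ /=.
by case: eqP => // ->; rewrite pj.
Qed.

Lemma count_eq_mem (p : pred I) r s :
  (forall j, p j -> count_mem j r = count_mem j s) -> count p r = count p s.
Proof.
move=> E; rewrite -!size_filter; apply: perm_size.
apply/permP => q; rewrite !count_filter.
suff pm : perm_eq (filter p r) (filter p s).
  by have /permP/(_ q) := pm; rewrite !count_filter.
by apply/allP => j _ /=; rewrite !count_mem_filter; case: ifP => // /E ->.
Qed.

Definition pc i j l r := count_mem j (pre i l r).

(** Induction on both words: they start with the same letter, since a word that
starts with [j] has a [j] before its first [i]. *)
Lemma pc_determines i j r s : i != j ->
  count_mem i r = count_mem i s -> count_mem j r = count_mem j s ->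
  (forall l, l < count_mem i r -> pc i j l r = pc i j l s) ->
  filter (pred2 i j) r = filter (pred2 i j) s.
Proof.
move=> ij.
have cf k t : pred2 i j k -> count_mem k (filter (pred2 i j) t) = count_mem k t.
  by rewrite count_mem_filter => ->.
have pi : pred2 i j i by rewrite /= eqxx.
have pj : pred2 i j j by rewrite /= eqxx orbT.
have pcf l t : l < count_mem i t ->
    pc i j l (filter (pred2 i j) t) = pc i j l t.
  by move=> lt; rewrite /pc pre_filter // cf.
move=> ci cj E.
have {}E l : l < count_mem i (filter (pred2 i j) r) ->
    pc i j l (filter (pred2 i j) r) = pc i j l (filter (pred2 i j) s).
  by rewrite cf // => lt; rewrite !pcf -?ci //; apply: E.
move: ci cj; rewrite -(cf _ r pi) -(cf _ s pi) -(cf _ r pj) -(cf _ s pj).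
move: E (filter_all (pred2 i j) r) (filter_all (pred2 i j) s).
move: (filter _ r) (filter _ s) => {cf pcf}{}r {}s.
have ji : (j == i) = false by rewrite eq_sym (negPf ij).
elim: r s => [|x r IH] [|y s] //= E.
- by move=> _ /andP[/orP[]/eqP-> _]; rewrite eqxx ?ji // => *; lia.
- by move=> /andP[/orP[]/eqP-> _] _; rewrite eqxx ?ji // => *; lia.
move=> /andP[/orP[]/eqP xE ra] /andP[/orP[]/eqP yE sa]; subst x y.
- rewrite eqxx !(negPf ij) !add1n !add0n => -[ci] cj; congr (_ :: _).
  apply: IH => // l lr; move: (E l.+1); rewrite eqxx !add1n ltnS /pc /= eqxx /=.
  by rewrite (negPf ij) !add0n; apply.
- rewrite eqxx ji !(negPf ij) !eqxx => ci cj.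
  by move: (E 0); rewrite eqxx /pc /= eqxx ji /= eqxx /= => /(_ isT).
- rewrite eqxx ji !(negPf ij) !eqxx => ci cj.
  move: (E 0); rewrite ji /pc /= ji eqxx /= eqxx add0n add1n => E0.
  by suff /E0 : 0 < count_mem i r by []; lia.
rewrite eqxx !ji !add0n !add1n => ci [cj]; congr (_ :: _).
apply: IH => // l lr; move: (E l); rewrite ji add0n /pc /= ji /= eqxx => /(_ lr).
by lia.
Qed.

(** The numbers of [y] before each [x] determine the numbers of [x] before each
[y]: if [p] letters [x] precede a given [y], the [x] numbered [p - 1] comes
before that [y], and the [x] numbered [p] after it. *)
Lemma pc_inv x y q r : x != y -> q < count_mem y r ->
  (0 < pc y x q r -> pc x y (pc y x q r).-1 r <= q) /\
  (pc y x q r < count_mem x r -> q < pc x y (pc y x q r) r).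
Proof.
move=> xy qr; have [B rE] := pre_split qr; have cq := count_pre qr.
rewrite /pc; move: (pre y q r) rE cq => A rE cq; split.
  move=> p0; have lt : (count_mem x A).-1 < count_mem x A by lia.
  rewrite rE pre_cat lt -cq; have [B' AE] := pre_split lt.
  by rewrite [in leqRHS]AE count_cat leq_addr.
rewrite rE count_cat /= eq_sym (negPf xy) add0n => lt.
by rewrite pre_cat ltnn subnn count_cat cq /= eq_sym (negPf xy) /= eqxx; lia.
Qed.

End Prefix.

(** * Commutation classes of words *)

Section Traces.
Variables (I : eqType) (e : rel I).
Hypotheses (e_sym : symmetric e) (e_irr : irreflexive e).
Implicit Types (i j x y : I) (r s A B : seq I).

(** Commutation equivalence, where two letters commute unless they are joined by
an edge. It is encoded by the projections to single letters and to pairs of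
joined letters: congruence, cancellation and the invariance of counts are then
immediate, and [teq_comm_equiv] relates it to transpositions. *)
Definition teq r s := forall i j, (i == j) || e i j ->
  filter (pred2 i j) r = filter (pred2 i j) s.

Lemma teq_refl r : teq r r. Proof. by []. Qed.
Lemma teq_sym r s : teq r s -> teq s r. Proof. by move=> H i j /H. Qed.
Lemma teq_trans s r t : teq r s -> teq s t -> teq r t.
Proof. by move=> H K i j ij; rewrite H ?K. Qed.
Lemma teq_cat r r' s s' : teq r r' -> teq s s' -> teq (r ++ s) (r' ++ s').
Proof. by move=> H K i j ij; rewrite !filter_cat H ?K. Qed.
Lemma teq_catl r s s' : teq s s' -> teq (r ++ s) (r ++ s').
Proof. exact: teq_cat. Qed.
Lemma teq_catr r s s' : teq s s' -> teq (s ++ r) (s' ++ r).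
Proof. by move/teq_cat; apply. Qed.
Lemma teq_catIl r s s' : teq (r ++ s) (r ++ s') -> teq s s'.
Proof. by move=> H i j /H; rewrite !filter_cat => /eqP;
  rewrite eqseq_cat // eqxx => /eqP. Qed.
Lemma teq_catIr r s s' : teq (s ++ r) (s' ++ r) -> teq s s'.
Proof.
move=> H i j /H; rewrite !filter_cat => E.
have sz : size (filter (pred2 i j) s) = size (filter (pred2 i j) s').
  by have := congr1 size E; rewrite !size_cat => /addIn.
by move/eqP: E; rewrite eqseq_cat // => /andP[/eqP].
Qed.

Lemma teq_count i r s : teq r s -> count_mem i r = count_mem i s.
Proof.
move=> /(_ i i); rewrite eqxx => /(_ isT)/(congr1 (count_mem i)).
by rewrite !count_mem_filter /= eqxx.
Qed.

Lemma teq_perm r s : teq r s -> perm_eq r s.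
Proof. by move=> H; apply/allP => i _; apply/eqP/teq_count. Qed.

Lemma teq_countP (p : pred I) r s : teq r s -> count p r = count p s.
Proof. by move=> /teq_perm/permP. Qed.

Lemma teq_size r s : teq r s -> size r = size s.
Proof. by move=> /teq_perm/perm_size. Qed.

Lemma teq_mem r s : teq r s -> r =i s.
Proof. by move=> /teq_perm/perm_mem. Qed.

Lemma teq_swap i A : i \notin A -> ~~ has (e i) A -> teq (i :: A) (rcons A i).
Proof.
move=> iA eA j k jk; rewrite -cats1 filter_cat /=.
have [ijk|_] := boolP ((i == j) || (i == k)); last by rewrite cats0.
suff -> : filter (pred2 j k) A = [::] by [].
apply/eqP; rewrite -(negbK (_ == _)) -has_filter; apply/hasPn => x xA /=.
have xi : x != i by apply: contraNneq iA => <-.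
have eix : ~~ e i x by apply: contra eA => ?; apply/hasP; exists x.
apply/norP; split; apply/eqP => xE; subst; case/orP: ijk => /eqP iE; subst.
- by rewrite eqxx in xi.
- by rewrite (negPf xi) e_sym (negPf eix) in jk.
- by rewrite eq_sym (negPf xi) (negPf eix) in jk.
by rewrite eqxx in xi.
Qed.

Lemma teq_swap0 i A : i \notin A -> count (e i) A = 0 -> teq (i :: A) (rcons A i).
Proof. by move=> iA c0; apply: teq_swap; rewrite // has_count c0. Qed.

(** Two successive values differ by the number of neighbours of [i] in the gap
between two successive occurrences of [i]. *)
Definition nb i l r := count (e i) (pre i l r).

Lemma teq_pc i j l r s : teq r s -> e i j -> l < count_mem i r ->
  pc i j l r = pc i j l s.
Proof.
move=> rs ij lr; have ls : l < count_mem i s by rewrite -(teq_count i rs).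
have pi : pred2 i j i by rewrite /= eqxx.
have := congr1 (fun t => count_mem j (pre i l t)) (rs i j _).
by rewrite ij orbT !pre_filter // !count_mem_filter /= eqxx orbT; apply.
Qed.

Lemma teq_nb i l r s : teq r s -> l < count_mem i r -> nb i l r = nb i l s.
Proof. by move=> rs lr; apply: count_eq_mem => j ij; apply: teq_pc. Qed.

(** No letter before the first [x] is joined to it, so [x] commutes with all of
them. *)
Lemma teq_front x r : x \in r -> nb x 0 r = 0 -> teq r (x :: rem x r).
Proof.
rewrite -has_pred1 has_count => x0 n0; have [B rE] := pre_split x0.
have xA : x \notin pre x 0 r by rewrite -has_pred1 has_count count_pre.
have -> : rem x r = pre x 0 r ++ B.
  rewrite {1}rE; move: (pre x 0 r) xA => A; elim: A => [|y A IH] /=.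
    by rewrite eqxx.
  by rewrite inE negb_or eq_sym => /andP[/negPf-> /IH->].
rewrite {1}rE -cat_rcons -cat_cons.
by apply: teq_catr; apply: teq_sym; apply: teq_swap0.
Qed.

(** Each edge may be tested in the direction that is more convenient, because
[pc_determines] recovers the projection from either one. *)
Lemma teqP r s : (forall i, count_mem i r = count_mem i s) ->
  (forall i j, e i j -> (forall l, l < count_mem i r -> pc i j l r = pc i j l s)
     \/ (forall l, l < count_mem j r -> pc j i l r = pc j i l s)) ->
  teq r s.
Proof.
move=> c H i j /orP[/eqP->|ij].
  have E : pred2 j j =1 pred1 j by move=> x /=; rewrite orbb.
  rewrite !(eq_filter E); have F t : filter (pred1 j) t = nseq (count_mem j t) j.
    by elim: t => //= x t ->; case: (x =P j) => // ->.
  by rewrite !F c.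
have ne : i != j by apply: contraTneq ij => ->; rewrite e_irr.
case: (H i j ij) => {}H; first exact: pc_determines.
have E : pred2 i j =1 pred2 j i by move=> x /=; rewrite orbC.
by rewrite !(eq_filter E); apply: pc_determines; rewrite // eq_sym.
Qed.

End Traces.

(** * Gaps between occurrences of a letter *)

Section Gaps.
Variables (I : eqType) (e : rel I).
Hypotheses (e_sym : symmetric e) (e_irr : irreflexive e).
Implicit Types (i j x y : I) (r s A B : seq I).
Local Notation nb := (nb e).
Local Notation teq := (teq e).

(** At least two neighbours separate successive occurrences of a letter; otherwise
commutations would create a factor [ii] or a factor [iji] with [j] joined
to [i]. *)
Definition gap_ok r := forall i l, l.+1 < count_mem i r ->
  nb i l r + 2 <= nb i l.+1 r.

(** The same condition for the word written around a circle: the second clause is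
about the gap from the last occurrence of [i] to the first one. A letter that
occurs once is not constrained. *)
Definition cyc_ok r := gap_ok r /\ forall i, 1 < count_mem i r ->
  nb i (count_mem i r).-1 r + 2 <= nb i 0 r + count (e i) r.

Lemma gap_ok_teq r s : teq r s -> gap_ok r -> gap_ok s.
Proof.
move=> rs H i l; rewrite -(teq_count i rs) => lr.
by rewrite -!(teq_nb rs) ?H //; lia.
Qed.

Lemma cyc_ok_teq r s : teq r s -> cyc_ok r -> cyc_ok s.
Proof.
move=> rs [H K]; split; first exact: gap_ok_teq H.
move=> i; rewrite -(teq_count i rs) -(teq_countP (e i) rs) => lr.
by rewrite -!(teq_nb rs) ?K //; lia.
Qed.

Lemma gap_ok_catl r s : gap_ok (r ++ s) -> gap_ok r.
Proof.
move=> H i l lr; have := H i l; rewrite /nb !pre_cat count_cat lr.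
by rewrite (ltnW lr); apply; lia.
Qed.

Lemma nb_cons i l x r : nb i l (x :: r) =
  if x == i then (if l is l'.+1 then nb i l' r else 0) else e i x + nb i l r.
Proof.
by rewrite /nb /=; case: (x =P i) => [->|_] //; case: l => //= l; rewrite e_irr.
Qed.

Lemma nb_catl i l r s : l < count_mem i r -> nb i l (r ++ s) = nb i l r.
Proof. by rewrite /nb pre_cat => ->. Qed.

Lemma nb_catr i l r s : count_mem i r <= l ->
  nb i l (r ++ s) = count (e i) r + nb i (l - count_mem i r) s.
Proof. by rewrite /nb pre_cat ltnNge => ->; rewrite count_cat. Qed.

Lemma nb_last i r : nb i (count_mem i r) (rcons r i) = count (e i) r.
Proof. by rewrite -cats1 nb_catr // subnn nb_cons eqxx addn0. Qed.

(** Moving [x] to the end changes all counts for another letter by the same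
constant, and renumbers the occurrences of [x] cyclically. *)
Lemma cyc_ok_rot1 x r : cyc_ok (x :: r) -> cyc_ok (rcons r x).
Proof.
case=> H K; split.
  move=> i l; rewrite -cats1 count_cat /= addn0 => lr.
  have := H i l; have := H i l.+1; have := K i; rewrite /= !nb_cons.
  case: (x =P i) lr => [->|_] lr.
    have [lc|] := ltnP l.+1 (count_mem i r).
      by rewrite !nb_catl ?(ltnW lc) //; case: l lr lc => [|l] ? ? ? /=; lia.
    move=> cl; have -> : l.+1 = count_mem i r by lia.
    rewrite nb_catl ?cats1 ?nb_last; last by lia.
    have -> : (1 + count_mem i r).-1 = l.+1 by lia.
    by rewrite e_irr; lia.
  by rewrite !nb_catl; lia.
move=> i; rewrite -cats1 !count_cat /= !addn0 => cr.
have := K i; have := H i 0; rewrite /= !nb_cons.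
case: (x =P i) cr => [->|_] cr.
  have -> : (count_mem i r + 1).-1 = count_mem i r by lia.
  rewrite cats1 nb_last -cats1 nb_catl ?e_irr; last by lia.
  by lia.
by rewrite !nb_catl ?add0n ?addn0; lia.
Qed.

Lemma cyc_ok_rot k r : cyc_ok r -> cyc_ok (rot k r).
Proof.
have [kr|kr] := ltnP k (size r); last by rewrite rot_oversize.
move=> H; elim: k kr => [|k IH] kr; first by rewrite rot0.
rewrite rotS 1?ltnW //; have := IH (ltnW kr); case: (rot k r) => [|x s] //.
by rewrite rot1_cons; apply: cyc_ok_rot1.
Qed.

Lemma cyc_ok_gap_rot k r : cyc_ok r -> gap_ok (rot k r).
Proof. by move/(cyc_ok_rot k) => -[]. Qed.

(** The gap that wraps around lies inside the rotation that starts with the last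
occurrence of the letter. *)
Lemma gap_rot_cyc_ok r : (forall k, gap_ok (rot k r)) -> cyc_ok r.
Proof.
move=> H; split; first by have := H 0; rewrite rot0.
move=> i ci; have lt : (count_mem i r).-1 < count_mem i r by lia.
have [D rE] := pre_split lt; have cA := count_pre lt.
move: (pre i _ r) rE cA => A rE cA.
have cD : count_mem i D = 0.
  by move: cA; rewrite rE count_cat /= eqxx; lia.
have A0 : 0 < count_mem i A by lia.
have cr : count_mem i (A ++ i :: D) = (count_mem i A).+1.
  by rewrite count_cat /= eqxx cD addn1.
have := H (size A) i 0; rewrite rE rot_size_cat cr cat_cons !nb_cons !eqxx.
rewrite [nb i 0 (D ++ A)]nb_catr cD // subn0 [nb i 0 (A ++ _)]nb_catl //.
rewrite nb_catr // subnn nb_cons eqxx /= !count_cat /= e_irr eqxx cD.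
by move=> /(_ _); lia.
Qed.

Lemma gap_ok_mono r i l : gap_ok r -> l < count_mem i r ->
  nb i 0 r + l.*2 <= nb i l r.
Proof.
move=> H; elim: l => [|l IH] lr; first by rewrite addn0.
by have := H i l lr; have := IH (ltnW lr); lia.
Qed.

Lemma gap_ok_mono_last r i l : gap_ok r -> l < count_mem i r ->
  nb i l r + ((count_mem i r).-1 - l).*2 <= nb i (count_mem i r).-1 r.
Proof.
move=> H lr; move E : (_.-1 - l) => d; elim: d l lr E => [|d IH] l lr E.
  by rewrite addn0; have -> : l = (count_mem i r).-1 by lia.
by have := IH l.+1; have := H i l; lia.
Qed.

Lemma cyc_ok_total r i : cyc_ok r -> 1 < count_mem i r ->
  (count_mem i r).*2 <= count (e i) r.
Proof.
by move=> [H K] c1; have := K i c1; have := @gap_ok_mono r i (count_mem i r).-1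
  H; lia.
Qed.

(** The equality case of [cyc_ok_total]: every cyclic gap contains exactly two
neighbours. All the numbers [nb i l r] then follow from those with [l = 0]. *)
Definition balanced r := forall i, count (e i) r = (count_mem i r).*2 /\
  forall l, l < count_mem i r -> nb i l r = nb i 0 r + l.*2.

(** Each of the cyclic gaps contains at least two neighbours, and their sum
leaves no room for more. *)
Lemma cyc_ok_balanced r :
  cyc_ok r -> (forall i, count (e i) r = (count_mem i r).*2) -> balanced r.
Proof.
move=> [H K] E i; split=> // l lr; have := E i.
have := @gap_ok_mono r i l H lr; have := gap_ok_mono_last H lr.
have [/K|c1] := ltnP 1 (count_mem i r); first by lia.
by move=> *; have -> : l = 0; [lia|rewrite addn0].
Qed.

Lemma balanced_cyc_ok r : balanced r -> cyc_ok r.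
Proof.
move=> H; split=> [i l lr|i cr]; have [E K] := H i.
  by rewrite (K _ lr) (K _ (ltnW lr)); lia.
by rewrite (K _.-1); lia.
Qed.

Lemma balanced_nb0 r i : balanced r -> 0 < count_mem i r -> nb i 0 r <= 2.
Proof.
move=> H cr; have [E K] := H i; have lt : (count_mem i r).-1 < count_mem i r by lia.
have : nb i (count_mem i r).-1 r <= count (e i) r.
  have [B rE] := pre_split lt; by rewrite [X in _ <= count _ X]rE count_cat
    leq_addr.
by rewrite (K _ lt) E; lia.
Qed.

Definition word_pow k r := flatten (nseq k r).

Lemma count_word_pow (p : pred I) k r : count p (word_pow k r) = k * count p r.
Proof. by elim: k => //= k IH; rewrite count_cat IH mulSn. Qed.

Lemma balanced_word_pow k r : balanced r -> balanced (word_pow k r).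
Proof.
move=> H i; rewrite !count_word_pow; have [E K] := H i; split;
  first by rewrite E; lia.
elim: k => [|k IH] l // lk.
have [lr|rl] := ltnP l (count_mem i r).
  by rewrite [word_pow _ _]/= !nb_catl ?(K _ lr) //; lia.
have [r0|r0] := posnP (count_mem i r); first by rewrite r0 in lk; lia.
rewrite [word_pow _ _]/= nb_catr // [nb i 0 _]nb_catl // IH; last by lia.
case: k {IH} lk => [|k] lk; first by lia.
by rewrite [word_pow _ _]/= nb_catl //; lia.
Qed.

Lemma nb_word_pow k r i : 0 < k -> 0 < count_mem i r -> nb i 0 (word_pow k r) =
    nb i 0 r.
Proof. by case: k => // k _ r0; rewrite [word_pow _ _]/= nb_catl. Qed.

Lemma teq_word_pow k r s : teq r s -> teq (word_pow k r) (word_pow k s).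
Proof. by move=> rs; elim: k => //= k IH; apply: teq_cat. Qed.

Lemma word_pow_rot1 k x r : word_pow k (rcons r x) ++ r = r ++ word_pow k (x :: r).
Proof. by elim: k => [|k IH] /=; rewrite ?cats0 // -catA IH cat_rcons. Qed.

End Gaps.

(** * Words in a simply laced Coxeter group *)

Section SimplyLacedGroup.
Variables (I : finType) (e : rel I).
Hypotheses (e_sym : symmetric e) (e_irr : irreflexive e).
Implicit Types (i j x y : I) (r s u v A B : seq I).
Local Notation teq := (teq e).
Local Notation gap_ok := (gap_ok e).
Local Notation cw := (@cword I (simply_laced e_sym)).
Local Notation cgen := (@cgen I (simply_laced e_sym)).
Local Notation comm_equiv := (@comm_equiv I (simply_laced e_sym)).

Lemma cw_cat r r' s s' : cw r = cw r' -> cw s = cw s' -> cw (r ++ s) =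
    cw (r' ++ s').
Proof. by rewrite -!cwordM => -> ->. Qed.

Lemma cw_catl r s s' : cw s = cw s' -> cw (r ++ s) = cw (r ++ s').
Proof. exact: cw_cat. Qed.

Lemma cw_catr s r r' : cw r = cw r' -> cw (r ++ s) = cw (r' ++ s).
Proof. by move/cw_cat; apply. Qed.

Lemma cw_rcons r s i : cw r = cw s -> cw (rcons r i) = cw (rcons s i).
Proof. by rewrite -!cats1; apply: cw_catr. Qed.

Lemma cw_sq A i B : cw (A ++ i :: i :: B) = cw (A ++ B).
Proof.
apply/cword_eqP; have := coxeter_cong_rel (simply_laced e_sym) A B i i.
by rewrite coxeter_mxx.
Qed.

Lemma cw_rcons2 r i : cw (rcons (rcons r i) i) = cw r.
Proof. by rewrite -!cats1 -catA cw_sq cats0. Qed.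

Lemma cw_commute x y : x != y -> ~~ e x y -> cw [:: x; y] = cw [:: y; x].
Proof.
move=> xy exy; have /cword_eqP := coxeter_cong_rel (simply_laced e_sym) [::] [::
  y; x] x y.
rewrite /= /simply_laced_m (negPf xy) (negPf exy) /= => <-.
by rewrite (cw_sq [:: x; y; x]) (cw_sq [:: x; y]).
Qed.

Lemma cw_braid x y : e x y -> cw [:: x; y; x] = cw [:: y; x; y].
Proof.
move=> exy; have xy : x != y by apply: contraTneq exy => ->; rewrite e_irr.
have /cword_eqP := coxeter_cong_rel (simply_laced e_sym) [::] [:: y; x; y] x y.
rewrite /= /simply_laced_m (negPf xy) exy /= => <-.
by rewrite (cw_sq [:: x; y; x; y; x]) (cw_sq [:: x; y; x; y]) (cw_sq [:: x; y; x]).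
Qed.

Lemma commute_gen x y : x != y -> ~~ e x y -> commute (cgen x) (cgen y).
Proof. by move=> xy exy; rewrite /commute /Defs.cgen !cwordM cw_commute. Qed.

Lemma comm_equiv_cw r s : comm_equiv r s -> cw r = cw s.
Proof.
elim=> // u v i j t; rewrite /commute /Defs.cgen !cwordM /= => c _ <-.
by apply: cw_catl; exact: (cw_catr v c).
Qed.

Lemma comm_equiv_cons x r s : comm_equiv r s -> comm_equiv (x :: r) (x :: s).
Proof.
elim=> [t|u v i j t c _ IH]; first exact: comm_equiv_refl.
exact: (comm_equiv_step (u := x :: u) c IH).
Qed.

Lemma comm_equiv_trans s r t : comm_equiv r s -> comm_equiv s t -> comm_equiv r t.
Proof. by elim=> // u v i j w c _ IH /IH; apply: comm_equiv_step. Qed.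

Lemma comm_equiv_front i A B : i \notin A -> ~~ has (e i) A ->
  comm_equiv (A ++ i :: B) (i :: A ++ B).
Proof.
elim/last_ind: A B => [|A x IH] B; first by move=> *; apply: comm_equiv_refl.
rewrite mem_rcons inE negb_or has_rcons negb_or => /andP[ix iA] /andP[ex eA].
rewrite !cat_rcons -[x :: i :: B]/([:: x; i] ++ B); apply: comm_equiv_step.
  by apply: commute_gen; rewrite 1?eq_sym // e_sym.
exact: IH.
Qed.

(** The first letter of [r] has no neighbour before its first occurrence in [s],
so transpositions bring it to the front of [s]. *)
Lemma teq_comm_equiv r s : teq r s -> comm_equiv s r.
Proof.
elim: r s => [|i r IH] s rs.
  by have := teq_size rs; case: s {rs} => // _; apply: comm_equiv_refl.
have c0 : 0 < count_mem i (i :: r) by rewrite /= eqxx.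
have cs : 0 < count_mem i s by rewrite -(teq_count i rs).
have := teq_nb rs c0; rewrite nb_cons // eqxx.
have [B sE] := pre_split cs; rewrite /nb.
have iA : i \notin pre i 0 s by rewrite -has_pred1 has_count count_pre.
move: (pre i 0 s) sE iA => A sE iA /esym A0.
have eA : ~~ has (e i) A by rewrite has_count A0.
rewrite sE; apply: comm_equiv_trans (comm_equiv_front _ iA eA) _.
apply: comm_equiv_cons; apply: IH; apply: (@teq_catIl _ e [:: i]).
apply: teq_trans rs _; rewrite sE -cat_rcons /= -cat_cons.
by apply: teq_catr; apply: teq_sym; apply: teq_swap.
Qed.

Lemma teq_cw r s : teq r s -> cw r = cw s.
Proof. by move=> /teq_comm_equiv/comm_equiv_cw->. Qed.

(** * Length and descents *)

Definition len r := clength (cw r).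

Lemma len_cw r s : cw r = cw s -> len r = len s.
Proof. by rewrite /len => ->. Qed.

Lemma len_size r : len r <= size r.
Proof.
rewrite /len /clength; case: ex_minnP => m _; apply.
by apply/existsP; exists (in_tuple r).
Qed.

Lemma len_ex r : exists2 s, cw s = cw r & size s = len r.
Proof.
rewrite /len /clength; case: ex_minnP => m /existsP[t /eqP tE] _.
by exists t; rewrite ?size_tuple.
Qed.

(** The defining relators have even length. *)
Lemma cw_odd r s : cw r = cw s -> odd (size r) = odd (size s).
Proof.
move/cword_eqP; elim=> {r s} [u|u v _ ->|u v w _ -> _ ->|u v i j] //.
rewrite !size_cat !oddD.
suff -> : odd (size (flatten (nseq (simply_laced e_sym i j) [:: i; j]))) = false.
  by [].
by elim: (simply_laced e_sym i j) => //= k ->.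
Qed.

Lemma len_odd r : odd (len r) = odd (size r).
Proof. by have [s sE <-] := len_ex r; apply: cw_odd. Qed.

Lemma len_rcons r i : len (rcons r i) <= (len r).+1.
Proof.
have [s sE <-] := len_ex r; rewrite -(size_rcons s i).
by rewrite -(len_cw (cw_rcons i sE)) len_size.
Qed.

Lemma len_rconsK r i : len r <= (len (rcons r i)).+1.
Proof. by rewrite -(len_cw (cw_rcons2 r i)) len_rcons. Qed.

Lemma len_rcons_neq r i : len (rcons r i) != len r.
Proof.
apply/negP => /eqP/(congr1 odd); rewrite !len_odd size_rcons /=.
by case: odd.
Qed.

Definition descent r i := len (rcons r i) < len r.

Lemma descentP r i : descent r i -> len r = (len (rcons r i)).+1.
Proof. by have := len_rconsK r i; rewrite /descent; lia. Qed.

Lemma ndescentP r i : ~~ descent r i -> len (rcons r i) = (len r).+1.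
Proof.
by have := len_rcons r i; have := len_rcons_neq r i; rewrite /descent; lia.
Qed.

Lemma descent_cw r s i : cw r = cw s -> descent r i = descent s i.
Proof.
by move=> rs; rewrite /descent (len_cw rs) (len_cw (cw_rcons i rs)).
Qed.

(** * The reflection representation *)

Local Open Scope ring_scope.
Local Notation V := {ffun I -> int}.
Implicit Types a b : V.

Definition cartan i j : int := if i == j then 2 else if e i j then -1 else 0.

Definition form i a : int := \sum_k cartan i k * a k.
Definition root i : V := [ffun k => (k == i)%:R].
Definition refl i a : V := [ffun k => a k - (k == i)%:R * form i a].
Definition act r a : V := foldr refl a r.

Lemma form_refl i j a : form i (refl j a) = form i a - cartan i j * form j a.
Proof.
rewrite /form; under eq_bigr => k _ do rewrite ffunE mulrBr.
rewrite sumrB; congr (_ - _); rewrite (bigD1 j) //= eqxx mul1r big1 ?addr0 //.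
by move=> k /negPf->; rewrite mul0r mulr0.
Qed.

Lemma form_root i j : form i (root j) = cartan i j.
Proof.
rewrite /form (bigD1 j) //= big1 ?addr0 => [|k /negPf kj]; rewrite ffunE.
  by rewrite eqxx mulr1.
by rewrite kj mulr0.
Qed.

Lemma formD i a b : form i (a + b) = form i a + form i b.
Proof.
by rewrite -big_split; apply: eq_bigr => k _; rewrite ffunE mulrDr.
Qed.

Lemma reflD i a b : refl i (a + b) = refl i a + refl i b.
Proof. by apply/ffunP => k; rewrite !ffunE formD; ring. Qed.

Lemma cartan_sym i j : cartan i j = cartan j i.
Proof. by rewrite /cartan eq_sym e_sym. Qed.

Lemma reflK i a : refl i (refl i a) = a.
Proof.
by apply/ffunP => k; rewrite !ffunE form_refl /cartan eqxx; ring.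
Qed.

Lemma refl_commute i j a : i != j -> ~~ e i j -> refl i (refl j a) =
    refl j (refl i a).
Proof.
move=> ij eij; have cij : cartan i j = 0 by rewrite /cartan (negPf ij) (negPf eij).
by apply/ffunP => k; rewrite !ffunE !form_refl (cartan_sym j) cij; ring.
Qed.

Lemma refl_braid i j a : e i j ->
  refl i (refl j (refl i a)) = refl j (refl i (refl j a)).
Proof.
move=> eij; have ij : i != j by apply: contraTneq eij => ->; rewrite e_irr.
have cij : cartan i j = -1 by rewrite /cartan (negPf ij) eij.
have cii k : cartan k k = 2 by rewrite /cartan eqxx.
by apply/ffunP => k; rewrite !ffunE !form_refl (cartan_sym j) cij !cii; ring.
Qed.

Lemma act_cat r s a : act (r ++ s) a = act r (act s a).
Proof. exact: foldr_cat. Qed.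

Lemma act_rcons r i a : act (rcons r i) a = act r (refl i a).
Proof. by rewrite -cats1 act_cat. Qed.

Lemma act_cw r s a : cw r = cw s -> act r a = act s a.
Proof.
move/cword_eqP => H; elim: H a => {r s} [u|u v _ IH|u v w _ IH _ IH'|u v i j] a //.
  by rewrite IH.
rewrite !act_cat; congr (act u _); move: (act v a) => {}a.
rewrite /= /simply_laced_m; have [->|ij] := eqVneq; first exact: reflK.
have [eij|eij] := boolP (e i j) => /=.
  by rewrite refl_braid // !reflK // refl_braid // !reflK.
by rewrite refl_commute // !reflK.
Qed.

Lemma actD r a b : act r (a + b) = act r a + act r b.
Proof. by elim: r => //= i r ->; rewrite reflD. Qed.

Definition nonneg a := [forall k, 0 <= a k].

Lemma nonnegD a b : nonneg a -> nonneg b -> nonneg (a + b).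
Proof.
move=> /forallP Ha /forallP Hb; apply/forallP => k.
by rewrite ffunE addr_ge0.
Qed.

Lemma refl_root i : refl i (root i) = - root i.
Proof. by apply/ffunP => k; rewrite !ffunE form_root /cartan eqxx; ring. Qed.

Lemma refl_root_edge i j : e i j -> refl i (root j) = root j + root i.
Proof.
move=> eij; have ij : i != j by apply: contraTneq eij => ->; rewrite e_irr.
by apply/ffunP => k; rewrite !ffunE form_root /cartan (negPf ij) eij; ring.
Qed.

Lemma refl_root_far i j : i != j -> ~~ e i j -> refl i (root j) = root j.
Proof.
move=> ij eij; apply/ffunP => k.
by rewrite !ffunE form_root /cartan (negPf ij) (negPf eij); ring.
Qed.

Lemma nonneg_root i : nonneg (root i).
Proof. by apply/forallP => k; rewrite ffunE; case: eqP. Qed.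

(** Induction on the length. If the last letter [t] of a reduced word [rcons w t]
is joined to [i], the image of [root i] is the image under [w] of
[root i + root t]. Either [i] is no descent of [w], and both summands have
nonnegative images; or [w] can be shortened by [i], which turns the sum into
the simple root [root t]. *)
Lemma act_root_nonneg r i : ~~ descent r i -> nonneg (act r (root i)).
Proof.
have [n] := ubnP (len r); elim: n r i => // n IH r i rn nd.
have [u uE su] := len_ex r; rewrite -(act_cw _ uE).
rewrite -(descent_cw _ uE) in nd; rewrite -(len_cw uE) in su rn.
elim/last_ind: u {uE} => [|w t _] in su rn nd *; first exact: nonneg_root.
have lw : len (rcons w t) = (len w).+1.
  by have := len_rcons w t; have := len_size w; rewrite -su size_rcons; lia.
have wt : ~~ descent w t by rewrite /descent lw; lia.
have li := ndescentP nd.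
have ti : t != i.
  by apply: contraTneq nd => <-; rewrite negbK /descent (len_cw (cw_rcons2 w t)) lw.
rewrite act_rcons; have [eti|eti] := boolP (e t i); last first.
  rewrite refl_root_far //; apply: IH; first by lia.
  apply/negP => /descentP wi; have : len (rcons (rcons w t) i) =
    len (rcons (rcons w i) t).
    by apply: len_cw; rewrite -!cats1 -!catA; apply: cw_catl; apply: cw_commute.
  by have := len_rcons (rcons w i) t; lia.
have [wi|wi] := boolP (descent w i); last first.
  by rewrite refl_root_edge // actD nonnegD //; apply: IH; lia.
(* The element of [w] is that of [rcons w i], which is shorter, followed by [i]. *)
have lwi := descentP wi; rewrite -(act_cw _ (cw_rcons2 w i)) act_rcons.
rewrite refl_root_edge // reflD refl_root refl_root_edge 1?e_sym //.
rewrite [root t + _]addrC addrA addNr add0r; apply: IH; first by lia.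
apply/negP => /descentP wit.
have : len (rcons (rcons w t) i) = len (rcons (rcons (rcons (rcons w i) t) i) t).
  apply: len_cw; rewrite -!cats1 -!catA -(cw_sq w i [:: t; i]).
  by apply/cw_catl/(cw_catl [:: i])/cw_braid; rewrite e_sym.
have := len_rcons (rcons (rcons (rcons w i) t) i) t.
have := len_rcons (rcons (rcons w i) t) i; lia.
Qed.

Lemma nonneg_opp0 a : nonneg a -> nonneg (- a) -> a = 0.
Proof.
move=> /forallP Ha /forallP Hb; apply/ffunP => k; rewrite ffunE.
by apply/eqP; rewrite eq_le Ha -oppr_ge0; have := Hb k; rewrite ffunE => ->.
Qed.

Lemma act0 r : act r 0 = 0.
Proof.
by have := actD r 0 0; rewrite addr0 => /(congr1 (+%R (- act r 0)));
  rewrite addrA addNr add0r.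
Qed.

Lemma actN r a : act r (- a) = - act r a.
Proof. by apply/eqP; rewrite -addr_eq0 -actD addNr act0. Qed.

(** The image of a simple root is nonzero, so it cannot be both nonnegative and
nonpositive; its sign decides whether the letter shortens the element. *)
Lemma descent_sign r i : descent r i = nonneg (- act r (root i)).
Proof.
apply/idP/idP => [ri|neg].
  rewrite -actN -refl_root -act_rcons; apply: act_root_nonneg.
  by rewrite /descent (len_cw (cw_rcons2 r i)); have := descentP ri; lia.
apply/negPn/negP => /act_root_nonneg pos; have r0 := nonneg_opp0 pos neg.
have : act (rev r ++ r) (root i) = act [::] (root i).
  by apply: act_cw; apply/cword_eqP/coxeter_cong_revV.
by rewrite act_cat r0 act0 /= => /ffunP/(_ i); rewrite !ffunE eqxx.
Qed.

Lemma descent_far r i j : i != j -> ~~ e i j -> descent r i -> descent r j ->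
  descent (rcons r j) i.
Proof.
move=> ij eij; rewrite !descent_sign act_rcons refl_root_far //.
  by rewrite eq_sym.
by rewrite e_sym.
Qed.

(** If two joined letters are descents, the element ends with the longest element
of the dihedral group that they generate. *)
Lemma descent_edge r i j : e i j -> descent r i -> descent r j ->
  descent (rcons r j) i /\ descent (rcons (rcons r j) i) j.
Proof.
move=> eij; have eji : e j i by rewrite e_sym.
rewrite !descent_sign !act_rcons !refl_root_edge // reflD refl_root.
rewrite refl_root_edge // addrC addrA addNr add0r => ri rj.
by rewrite actD opprD nonnegD.
Qed.

Local Open Scope nat_scope.

(** * Reduced words without braid factors *)

Lemma gap_ok_sq A i : ~ gap_ok (A ++ [:: i; i]).
Proof.
move=> /(_ i (count_mem i A)); rewrite !nb_catr // subnn subSnn !nb_cons //.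
by rewrite !eqxx count_cat /= eqxx => /(_ _); lia.
Qed.

Lemma gap_ok_braid A i j : e i j -> ~ gap_ok (A ++ [:: i; j; i]).
Proof.
move=> eij; have ji : j != i by apply: contraTneq eij => ->; rewrite e_irr.
move=> /(_ i (count_mem i A)); rewrite !nb_catr // subnn subSnn !nb_cons //.
by rewrite !eqxx count_cat /= eqxx (negPf ji) eij => /(_ _); lia.
Qed.

(** Induction on the size of [r]. If reduced words of one element end with
different letters [i] and [j], both letters are descents, so the element has a
reduced word that ends with [ij], or with [jij] when they are joined. The
induction hypothesis, applied to words without their last letter, carries this
ending over to [r]. In the first case the last two letters can be exchanged;
the second contradicts [gap_ok r]. *)
Lemma gap_ok_reduced_unique r : gap_ok r ->
  len r = size r /\ forall u, size u = size r -> cw u = cw r -> teq u r.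
Proof.
have [n] := ubnP (size r); elim: n r => // n IH r rn gr.
have IH' s : size s < size r -> gap_ok s -> len s = size s /\
   forall u, size u = size s -> cw u = cw s -> teq u s.
  by move=> sr gs; apply: IH gs; lia.
have lr : len r = size r.
  elim/last_ind: r => [|r j _] in rn gr IH' *.
    by apply/eqP; rewrite -leqn0; apply: len_size.
  have gr' : gap_ok r by move: gr; rewrite -cats1; apply: gap_ok_catl.
  have [|lr uniq_r] := IH' r _ gr'; first by rewrite size_rcons.
  rewrite size_rcons; have [/descentP rj|/ndescentP->] := boolP (descent r j);
    last by rewrite lr.
  have [v vE sv] := len_ex (rcons r j).
  have vr : teq (rcons v j) r.
    apply: uniq_r; first by rewrite size_rcons sv -lr -rj.
    by rewrite (cw_rcons j vE) cw_rcons2.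
  have := gap_ok_teq (teq_sym (teq_catr [:: j] vr)).
  by rewrite cats1 => /(_ gr); rewrite -cats1 -catA => /gap_ok_sq.
split=> // u su uE.
elim/last_ind: u => [|u i _] in su uE *; first by case: r su {lr gr IH IH' rn uE}.
elim/last_ind: r => [|r j _] in rn gr IH' lr su uE *;
  first by rewrite size_rcons in su.
have sr : size r < size (rcons r j) by rewrite size_rcons.
have gr' : gap_ok r by move: gr; rewrite -cats1; apply: gap_ok_catl.
have [lr' uniq_r] := IH' r sr gr'.
have {}su : size u = size r by move: su; rewrite !size_rcons => -[].
have [ij|ij] := eqVneq i j.
  subst j; rewrite -!cats1; apply: teq_catr; apply: uniq_r => //.
  by rewrite -(cw_rcons2 u i) (cw_rcons i uE) cw_rcons2.
have dj : descent (rcons r j) j by rewrite /descent (len_cw (cw_rcons2 r j)) lr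
  lr' size_rcons.
have di : descent (rcons r j) i.
  rewrite -(descent_cw i uE) /descent (len_cw (cw_rcons2 u i)) (len_cw uE) lr
    size_rcons ltnS.
  by rewrite -su; apply: len_size.
have [eij|eij] := boolP (e i j).
  have [d1 d2] := descent_edge eij di dj.
  have [v vE sv] := len_ex (rcons (rcons (rcons (rcons r j) j) i) j).
  have := descentP dj; have := descentP d1; have := descentP d2;
    rewrite lr size_rcons => l1 l2 l3.
  have vr : teq (v ++ [:: j; i]) r.
    apply: uniq_r; first by rewrite size_cat /=; lia.
    rewrite -!cats1 in vE; have := cw_catr [:: j; i] vE; rewrite -!catA => ->.
    by rewrite /= cw_sq -cat_rcons cw_sq cat_rcons cw_sq cats0.
  have := gap_ok_teq (teq_sym (teq_catr [:: j] vr)).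
  by rewrite cats1 => /(_ gr); rewrite -catA => /gap_ok_braid []; rewrite e_sym.
have d1 := descent_far ij eij di dj.
have [v vE sv] := len_ex (rcons (rcons (rcons r j) j) i).
have := descentP dj; have := descentP d1; rewrite lr size_rcons => l1 l2.
have vr : teq (rcons v i) r.
  apply: uniq_r; first by rewrite size_rcons; lia.
  by rewrite (cw_rcons i vE) !cw_rcons2.
have vr' : teq (v ++ [:: j; i]) (rcons r j).
  rewrite -cats1; apply: teq_trans (teq_catr [:: j] vr).
  rewrite cat_rcons; apply: teq_catl; apply: (@teq_swap _ _ e_sym j [:: i]).
    by rewrite inE eq_sym.
  by rewrite /= orbF e_sym.
apply: (teq_trans _ vr'); rewrite -cats1.
have gv : gap_ok (rcons v j).
  apply: (@gap_ok_catl _ e _ [:: i]); rewrite cat_rcons.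
  exact: gap_ok_teq (teq_sym vr') gr.
have [|_ uniq_v] := IH' (rcons v j) _ gv; first by rewrite !size_rcons; lia.
rewrite -[[:: j; i]]/([:: j] ++ [:: i]) catA; apply: teq_catr.
rewrite cats1; apply: uniq_v; first by rewrite size_rcons; lia.
rewrite -(cw_rcons2 u i) (cw_rcons i uE) -(cw_rcons i (teq_cw vr')).
by rewrite -[rcons _ i]cats1 -catA /= -cat_rcons cw_sq cats0.
Qed.

(** * Fully commutative and cyclically fully commutative elements *)

Lemma gap_ok_fully_commutative r : gap_ok r ->
  reduced (simply_laced e_sym) r /\ fully_commutative (cw r).
Proof.
move=> gr; have [lr uniq_r] := gap_ok_reduced_unique gr; split.
  by rewrite /reduced -lr.
have eq_r s : reduced_expr (cw r) s -> teq s r.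
  by move=> /andP[/eqP ss /eqP sE]; apply: uniq_r; rewrite // ss -lr /len sE.
move=> s t /eq_r sr /eq_r tr; apply: teq_comm_equiv.
exact: teq_trans tr (teq_sym sr).
Qed.

Lemma comm_equiv_count i r s : comm_equiv r s -> count_mem i r = count_mem i s.
Proof.
elim=> // u v j k t _ _ <-; rewrite !count_cat /=; lia.
Qed.

(** A gap without neighbours can be closed to a factor [ii], and the word is not
reduced. A gap with one neighbour [j] can be closed to [iji]; the braid relation
then gives a reduced word with one [i] less, out of reach of commutations. *)
Lemma fully_commutative_gap_ok r :
  reduced (simply_laced e_sym) r -> fully_commutative (cw r) -> gap_ok r.
Proof.
move=> /eqP red fc i l lr; rewrite leqNgt; apply/negP => few.
have [X rE] := pre_split (ltnW lr); have cA := count_pre (ltnW lr).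
have AE : nb e i l r = count (e i) (pre i l r) by [].
move: (pre i l r) rE cA AE => A rE cA AE.
have X0 : 0 < count_mem i X by move: lr; rewrite rE count_cat /= eqxx cA; lia.
have [D XE] := pre_split X0; have cB := count_pre X0.
move: (pre i 0 X) XE cB => B XE cB; rewrite {X}XE in rE X0.
have iB : i \notin B by rewrite -has_pred1 has_count cB.
have {}few : count (e i) B < 2.
  move: few; rewrite AE rE nb_catr ?cA // subSnn nb_cons // eqxx nb_catr ?cB //.
  by rewrite nb_cons // eqxx /=; lia.
have front C : i \notin C -> count (e i) C = 0 -> cw (i :: C) = cw (rcons C i).
  by move=> iC C0; apply/teq_cw/(teq_swap0 e_sym).
have [B0|B0] := posnP (count (e i) B).
  have : size r <= len (A ++ B ++ D).
    rewrite red; apply/eq_leq/len_cw; rewrite rE; apply: cw_catl.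
    rewrite -cat_cons (cw_catr _ (front _ iB B0)) cat_rcons.
    exact: cw_sq.
  by have := len_size (A ++ B ++ D); rewrite rE !size_cat /= size_cat /=; lia.
have /hasP[j jB eij] : has (e i) B by rewrite has_count.
case/splitPr: jB iB few rE B0 cB => B1 B2 iB few rE _ _.
move: few iB; rewrite count_cat /= eij mem_cat inE !negb_or =>
  few /and3P[iB1 ij iB2].
have c1 : count (e i) B1 = 0 by lia.
have c2 : count (e i) B2 = 0 by lia.
pose s := A ++ B1 ++ [:: j; i; j] ++ B2 ++ D.
have sE : cw s = cw r.
  rewrite rE; apply: cw_catl; rewrite -!catA -cat_cons (cw_catr _ (front _ iB1 c1)).
  rewrite cat_rcons; apply: cw_catl; rewrite cat_cons -cat_rcons.
  rewrite -(cw_catl [:: i; j] (cw_catr D (front _ iB2 c2))) /=.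
  exact: (cw_catr (B2 ++ D) (cw_braid (etrans (e_sym j i) eij))).
have ss : size s = size r by rewrite rE /s !size_cat /= !size_cat /= ?size_cat
  /=; lia.
have rr : reduced_expr (cw r) r by rewrite /reduced_expr /reduced -red !eqxx.
have rs : reduced_expr (cw r) s by rewrite /reduced_expr /reduced sE ss -red !eqxx.
have := comm_equiv_count i (fc _ _ rr rs).
rewrite rE /s !count_cat /= !count_cat /= ?count_cat /= eqxx eq_sym (negPf ij).
by lia.
Qed.

Local Notation cyc_ok := (cyc_ok e).

(** By [gap_ok_reduced_unique] every reduced word of the element is commutation
equivalent to [r], and [cyc_ok] is invariant under commutations and rotations. *)
Lemma cyc_ok_CFC r : cyc_ok r ->
  cyclically_fully_commutative (cw r) /\ clength (cw r) = size r.
Proof.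
move=> cr; have [gr _] := cr; have [lr uniq_r] := gap_ok_reduced_unique gr.
split=> // s k /andP[/eqP ss /eqP sE]; apply: gap_ok_fully_commutative.
apply: cyc_ok_gap_rot => //; apply: cyc_ok_teq cr; apply: teq_sym.
by apply: uniq_r => //; rewrite ss -lr /len sE.
Qed.

Lemma CFC_cyc_ok r : reduced (simply_laced e_sym) r ->
  cyclically_fully_commutative (cw r) -> cyc_ok r.
Proof.
move=> red cfc; apply: gap_rot_cyc_ok => // k.
have [|red_k fc_k] := cfc r k; first by rewrite /reduced_expr red eqxx.
exact: fully_commutative_gap_ok.
Qed.

Lemma CFC_count_representatives k (reps : seq (seq I)) :
  uniq reps -> (forall r, r \in reps -> cyc_ok r /\ size r = k) ->
  {in reps &, forall r s, teq r s -> r = s} ->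
  (forall r, cyc_ok r -> size r = k -> exists2 s, s \in reps & teq r s) ->
  CFC_count (simply_laced e_sym) k = size reps.
Proof.
move=> ureps reps_ok reps_inj reps_all; rewrite /CFC_count -(size_map cw reps).
apply: perm_size; apply: uniq_perm.
- exact: fset_uniq.
- rewrite map_inj_in_uniq // => r s rr rs rsE; apply: reps_inj => //.
  have [cs ss] := reps_ok s rs; have [cr sr] := reps_ok r rr.
  have [gs _] := cs; have [_] := gap_ok_reduced_unique gs.
  by apply; rewrite ?sr.
move=> w; rewrite (in_fset_set (CFC_of_length_finite _ k)); apply/idP/mapP.
  rewrite inE => -[cfc lw]; have [r rE sr] := len_ex (repr w).
  rewrite cword_repr in rE; have sr' : size r = k by rewrite sr /len cword_repr.
  have red : reduced (simply_laced e_sym) r by rewrite /reduced rE lw sr'.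
  rewrite -rE in cfc; have [s ss rs] := reps_all r (CFC_cyc_ok red cfc) sr'.
  by exists s => //; rewrite -rE; apply: teq_cw.
move=> [r rr ->]; rewrite inE; have [/cyc_ok_CFC[cfc lr] sr] := reps_ok r rr.
by split=> //; rewrite lr.
Qed.

End SimplyLacedGroup.

(** * Words without repeated letters on a forest *)

Section Catalog.
Variables (I : eqType) (e : rel I).
Hypotheses (e_sym : symmetric e) (e_irr : irreflexive e).
Implicit Types (v p x : I) (r s w : seq I) (ws : seq (seq I)) (P : pred I).
Local Notation teq := (teq e).
Local Notation nb := (nb e).

(** One word in each commutation class of words without repeated letters, the
letters being taken in [P]. Such a class amounts to its set of letters together
with an acyclic orientation of the induced graph. *)
Definition catalog P ws := [/\ forall w, w \in ws -> uniq w /\ all P w,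
  uniq ws, {in ws &, forall r s, teq r s -> r = s} &
  forall r, uniq r -> all P r -> exists2 w, w \in ws & teq r w].

(** For a vertex [v] whose only neighbour among the letters of [ws] is [p]: either
[v] is left out, or it is added before all letters, or after them, which makes
a difference only when [p] is present. *)
Definition add_vertex v p ws := ws ++ [seq v :: w | w <- ws] ++
  [seq rcons w v | w <- ws & p \in w].

Lemma catalog_nil : catalog pred0 [:: [::]].
Proof.
split=> // [w|r s|r _]; rewrite ?inE.
- by move/eqP->.
- by move=> /eqP-> /eqP->.
by case: r => // _; exists [::].
Qed.

Lemma catalog_ext P P' ws : P =1 P' -> catalog P ws -> catalog P' ws.
Proof.
move=> PP [ok u inj all_]; split=> // [w /ok[uw]|r ur rP].
  by rewrite (eq_all PP).
by apply: all_ => //; rewrite (eq_all PP).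
Qed.

Lemma mem_add_vertex v p ws r : r \in add_vertex v p ws ->
  [\/ r \in ws, exists2 w, w \in ws & r = v :: w |
      exists w, [/\ w \in ws, p \in w & r = rcons w v]].
Proof.
rewrite !mem_cat => /or3P[?|/mapP[w wws ->]|/mapP[w]].
- by constructor 1.
- by constructor 2; exists w.
by rewrite mem_filter => /andP[pw wws] ->; constructor 3; exists w.
Qed.

(** In a word with [v], the letter [v] commutes with all others except [p]. So it
can be moved to the end if [p] is before it, and to the front otherwise. *)
Lemma catalog_add P v p ws : catalog P ws -> ~~ P v ->
  (forall x, P x -> e v x = (x == p)) -> catalog (predU1 v P) (add_vertex v p ws).
Proof.
move=> [ok u inj complete] Pv vp.
have vw w : w \in ws -> v \notin w.
  by move=> /ok[_ /allP wP]; apply: contra Pv => /wP.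
have cons_inj : {in ws &, forall r s, teq (v :: r) (v :: s) -> r = s}.
  by move=> r s rw sw E; apply: inj => //; apply: (@teq_catIl _ _ [:: v]).
have rcons_inj : {in ws &, forall r s, teq (rcons r v) (rcons s v) -> r = s}.
  by move=> r s rw sw; rewrite -!cats1 => E; apply: inj => //; apply: teq_catIr E.
have ne1 r s : r \in ws -> v \in s -> ~ teq r s.
  by move=> /vw vr vs /teq_mem/(_ v); rewrite vs (negPf vr).
have ne2 r s : s \in ws -> p \in s -> ~ teq (v :: r) (rcons s v).
  move=> sw ps E; have := teq_nb (i := v) (l := 0) E.
  rewrite /= eqxx nb_cons // eqxx -cats1 => /(_ isT).
  rewrite nb_catr ?(count_memPn (vw s sw)) // nb_cons // eqxx addn0 => /esym c0.
  have : has (e v) s; last by rewrite has_count c0.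
  by apply/hasP; exists p => //; rewrite vp ?eqxx //; have [_ /allP] := ok s sw;
    apply.
split.
- move=> w /mem_add_vertex[ww|[w' ww ->]|[w' [ww pw ->]]].
  + have [uw aw] := ok w ww; split=> //; apply: sub_all aw => x Px.
    by rewrite /= Px orbT.
  + have [uw aw] := ok _ ww; rewrite /= vw // eqxx; split=> //.
    by apply: sub_all aw => x Px; rewrite /= Px orbT.
  have [uw aw] := ok _ ww; rewrite rcons_uniq all_rcons /= vw // eqxx; split=> //.
  by apply: sub_all aw => x Px; rewrite /= Px orbT.
- rewrite !cat_uniq u !map_inj_in_uniq ?filter_uniq //=; first last.
  + by move=> r s rw sw [].
  + move=> r s; rewrite !mem_filter => /andP[_ rw] /andP[_ sw] E.
    by apply: rcons_inj => //; rewrite E; apply: teq_refl.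
  rewrite andbT u /=; apply/andP; split; apply/hasPn => r.
    rewrite mem_cat => /orP[/mapP[w ww ->]|/mapP[w ww ->]]; apply/negP => rw.
      by apply: (ne1 _ (v :: w) rw); rewrite ?mem_head //; apply: teq_refl.
    by apply: (ne1 _ (rcons w v) rw); rewrite ?mem_rcons ?mem_head //;
      apply: teq_refl.
  move=> /mapP[w]; rewrite mem_filter => /andP[pw ww] ->.
  apply/negP => /mapP[w' ww' E]; apply: (ne2 w' w ww pw).
  by rewrite -E; apply: teq_refl.
- move=> r s /mem_add_vertex[rw|[r' rw ->]|[r' [rw pr ->]]]
           /mem_add_vertex[sw|[s' sw ->]|[s' [sw ps ->]]] E.
  + exact: inj.
  + by case: (ne1 _ _ rw _ E); rewrite mem_head.
  + by case: (ne1 _ _ rw _ E); rewrite mem_rcons mem_head.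
  + by case: (ne1 _ _ sw _ (teq_sym E)); rewrite mem_head.
  + by rewrite (cons_inj _ _ rw sw E).
  + by case: (ne2 _ _ sw ps E).
  + by case: (ne1 _ _ sw _ (teq_sym E)); rewrite mem_rcons mem_head.
  + by case: (ne2 _ _ rw pr (teq_sym E)).
  by rewrite (rcons_inj _ _ rw sw E).
move=> r ur ar; have [vr|vr] := boolP (v \in r); last first.
  have [|w ww rw] := complete r ur; last by exists w; rewrite // mem_cat ww.
  apply/allP => x xr; have /allP/(_ x xr)/orP[/eqP xv|//] := ar.
  by rewrite -xv xr in vr.
case/splitPr: vr ur ar => A B; rewrite cat_uniq all_cat /= => ur ar.
have uAB : uniq (A ++ v :: B) by rewrite cat_uniq.
have vAB : v \notin A ++ B.
  by move: uAB; rewrite -cat_rcons -cats1 -catA uniq_catCA /= => /andP[].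
have aAB : all P (A ++ B).
  apply/allP => x xAB; have : predU1 v P x.
    by move: xAB ar; rewrite mem_cat => /orP[xA|xB] /and3P[/allP aA _ /allP aB];
      [apply: aA|apply: aB].
  by case/orP=> // /eqP xv; rewrite -xv xAB in vAB.
have uAB' : uniq (A ++ B).
  by move: uAB; rewrite -cat_rcons -cats1 -catA uniq_catCA /= => /andP[].
have [w ww AB] := complete (A ++ B) uAB' aAB.
have vA : v \notin A by move: vAB; rewrite mem_cat negb_or => /andP[].
have vB : v \notin B by move: vAB; rewrite mem_cat negb_or => /andP[].
have [pA|pA] := boolP (p \in A).
  have pB : p \notin B.
    by move: uAB'; rewrite cat_uniq => /and3P[_ /hasPn H _]; apply/negP => /H;
      rewrite pA.
  exists (rcons w v).
    rewrite !mem_cat; apply/or3P; constructor 3; apply/mapP; exists w => //.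
    by rewrite mem_filter ww andbT -(teq_mem AB) mem_cat pA.
  apply: (@teq_trans _ _ (A ++ rcons B v)).
    apply/teq_catl/teq_swap => //; apply/hasPn => x xB.
    rewrite vp; last by apply: (allP aAB); rewrite mem_cat xB orbT.
    by apply: contraNneq pB => <-.
  by rewrite -rcons_cat -!cats1; apply: teq_catr.
exists (v :: w).
  by rewrite !mem_cat; apply/or3P; constructor 2; apply/mapP; exists w.
apply: (@teq_trans _ _ (v :: A ++ B)); last exact: (@teq_catl _ _ [:: v]).
rewrite -cat_rcons -cat_cons; apply/teq_catr/teq_sym/teq_swap => //.
apply/hasPn => x xA; rewrite vp; last by apply: (allP aAB); rewrite mem_cat xA.
by apply: contraNneq pA => <-.
Qed.

Local Open Scope ring_scope.

Definition size_gen ws : {poly int} := \sum_(w <- ws) 'X^(size w).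

Lemma size_genE ws k : (size_gen ws)`_k = (count (fun w => size w == k) ws)%:R.
Proof.
rewrite /size_gen coef_sum; elim: ws => [|w ws IH]; first by rewrite big_nil.
by rewrite big_cons IH coefXn /= natrD eq_sym.
Qed.

Lemma size_gen_cat ws ws' : size_gen (ws ++ ws') = size_gen ws + size_gen ws'.
Proof. exact: big_cat. Qed.

Lemma size_gen_map (f : seq I -> seq I) ws : (forall w, size (f w) = (size w).+1) ->
  size_gen (map f ws) = 'X * size_gen ws.
Proof.
move=> sf; rewrite /size_gen big_map mulr_sumr; apply: eq_bigr => w _.
by rewrite sf exprS.
Qed.

Definition with_vertex x ws := [seq w <- ws | x \in w].

Lemma size_gen_add v p ws : size_gen (add_vertex v p ws) =
  (1 + 'X) * size_gen ws + 'X * size_gen (with_vertex p ws).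
Proof.
rewrite !size_gen_cat !size_gen_map //; last by move=> w; rewrite size_rcons.
by rewrite mulrDl mul1r addrA.
Qed.

Lemma size_gen_add_with v p ws : (forall w, w \in ws -> v \notin w) ->
  size_gen (with_vertex v (add_vertex v p ws)) =
  'X * (size_gen ws + size_gen (with_vertex p ws)).
Proof.
move=> vws; rewrite /with_vertex /add_vertex !filter_cat !filter_map.
rewrite (eq_in_filter (a2 := pred0)) => [|w /vws/negPf//]; rewrite filter_pred0.
rewrite (eq_filter (a2 := predT)) => [|w]; last by rewrite /= mem_head.
rewrite [X in map (rcons^~ v) X](eq_filter (a2 := predT)) => [|w]; last first.
  by rewrite /= mem_rcons mem_head.
rewrite !filter_predT /= size_gen_cat !size_gen_map // ?mulrDr //.
by move=> w; rewrite size_rcons.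
Qed.

Lemma size_gen_add_parent v p ws : p != v ->
  size_gen (with_vertex p (add_vertex v p ws)) =
  (1 + 'X *+ 2) * size_gen (with_vertex p ws).
Proof.
move=> pv; rewrite /with_vertex /add_vertex !filter_cat !filter_map.
rewrite (eq_filter (a1 := preim _ _) (a2 := fun w => p \in w)) => [|w]; last first.
  by rewrite /= inE (negPf pv).
rewrite [X in map (rcons^~ v) X](eq_filter (a2 := fun w => p \in w)) => [|w];
  last first.
  by rewrite /= mem_rcons inE (negPf pv).
rewrite filter_id !size_gen_cat !size_gen_map //; first by ring.
by move=> w; rewrite size_rcons.
Qed.

End Catalog.

(** * The diagram of affine type D *)

Section Levels.
Variable n : nat.
Hypothesis n2 : 2 <= n.
Local Notation I := (affD_gen n).
Local Notation e := (@affD_edge n).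
Implicit Types (x y : I) (r s A B : seq I) (b : bool) (h l k q : nat).

Lemma affD_edge_irr : irreflexive e.
Proof. by case=> [[b|i]|b]; rewrite /affD_edge /= ?orbb //; lia. Qed.

(** The diagram is drawn along a line, with two vertices on each of the levels 0
and [n] and one on each level between them; two vertices are joined exactly
when their levels differ by one ([edge_level]). *)
Definition level x : nat :=
  match x with inl (inl _) => 0 | inl (inr i) => i.+1 | inr _ => n end.

Lemma level_le x : level x <= n.
Proof. by case: x => [[b|i]|b] //=; have := ltn_ord i; lia. Qed.

Lemma edge_level x y : e x y = (level x == (level y).+1) || (level y == (level
    x).+1).
Proof.
rewrite /affD_edge; case: x => [[b|i]|b]; case: y => [[b'|j]|b'] /=;
  rewrite ?orbF //; try have := ltn_ord i; try have := ltn_ord j; lia.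
Qed.

(** The label [b] chooses between the two leaves of an end and is ignored on the
inner levels ([vertex_mid]). *)
Definition vertex b h : I :=
  if h == 0 then inl (inl b) else
  if insub h.-1 is Some i then inl (inr i) else inr b.

Lemma level_vertex b h : h <= n -> level (vertex b h) = h.
Proof.
rewrite /vertex; case: (h =P 0) => [->|h0] //=.
by case: insubP => /= [i _ ->|]; lia.
Qed.

Lemma vertex_level x : exists b, x = vertex b (level x).
Proof.
case: x => [[b|i]|b]; [by exists b|exists true|exists b]; rewrite /vertex /=.
  by case: insubP => [j _ /val_inj->|]; rewrite ?ltn_ord.
by case: insubP => [j|_]; [lia|case: eqP => //; lia].
Qed.

Lemma vertex_mid b b' h : 0 < h < n -> vertex b h = vertex b' h.
Proof.
by rewrite /vertex; case: (h =P 0) => [->|h0] //; case: insubP => //; lia.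
Qed.

Definition leaf h := (h == 0) || (h == n).

Lemma vertex_leaf b b' h : leaf h -> (vertex b h == vertex b' h) = (b == b').
Proof.
rewrite /vertex /leaf; case: (h =P 0) => [->|h0] //= hn.
by case: insubP => [j|_ ]; [lia|].
Qed.

Lemma vertex_inj b b' h h' : h <= n -> h' <= n -> vertex b h =
    vertex b' h' -> h = h'.
Proof. by move=> hn hn' /(congr1 level); rewrite !level_vertex. Qed.

Lemma edge_vertex b b' h : h < n -> e (vertex b h) (vertex b' h.+1).
Proof. by move=> hn; rewrite edge_level !level_vertex ?eqxx ?orbT // ltnW. Qed.

Definition level_count h r := count (fun x => level x == h) r.

Lemma level_count_cat h r s : level_count h (r ++ s) =
    level_count h r + level_count h s.
Proof. exact: count_cat. Qed.

Lemma eq_vertex_mid b x h : 0 < h < n -> (x == vertex b h) = (level x == h).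
Proof.
move=> hn; have [b' xE] := vertex_level x.
apply/eqP/eqP => [->|lx]; first by rewrite level_vertex //; lia.
by rewrite xE lx; apply: vertex_mid.
Qed.

Lemma level_count_mid b h r : 0 < h < n -> count_mem (vertex b h) r =
    level_count h r.
Proof. by move=> hn; apply: eq_count => x /=; rewrite eq_vertex_mid. Qed.

Lemma level_count_leaf h r : leaf h ->
  level_count h r = count_mem (vertex true h) r + count_mem (vertex false h) r.
Proof.
move=> hl; rewrite /level_count; elim: r => //= x r ->.
have hn : h <= n by move: hl; rewrite /leaf; lia.
suff -> : nat_of_bool (level x == h) = (x == vertex true h) + (x == vertex false h).
  exact: addnACA.
have [lx|lx] := eqVneq (level x) h.
  by have [b xE] := vertex_level x; rewrite lx in xE; rewrite xE !vertex_leaf //;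
    case: b {xE}.
have F b : (x == vertex b h) = false by apply: contraNF lx => /eqP->;
  rewrite level_vertex.
by rewrite !F.
Qed.

Lemma level_count_gt h r : n < h -> level_count h r = 0.
Proof.
move=> nh; apply/eqP; rewrite -leqn0 leqNgt -has_count; apply/hasPn => x _.
by have := level_le x; lia.
Qed.

Lemma size_level_count r : size r = \sum_(h < n.+1) level_count h r.
Proof.
elim: r => [|x r IH]; first by rewrite big1.
rewrite [LHS]/= IH /level_count /= big_split /= -add1n; congr (_ + _).
rewrite (bigD1 (Ordinal (level_le x : level x < n.+1))) //= eqxx big1 // => i.
by rewrite -val_eqE /= eq_sym => /negPf->.
Qed.

Lemma count_edge x r :
  count (e x) r = (if 0 < level x then level_count (level x).-1 r else 0) +
    level_count (level x).+1 r.
Proof.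
rewrite /level_count; elim: r => [|y r IH] /=; first by case: ifP.
by rewrite IH edge_level; case: ifP => /=; lia.
Qed.

Lemma count_edge_mid b h r : 0 < h < n ->
  count (e (vertex b h)) r = level_count h.-1 r + level_count h.+1 r.
Proof. by move=> /andP[h0 hn]; rewrite count_edge level_vertex ?h0 // ltnW. Qed.

Lemma count_edge0 b r : count (e (vertex b 0)) r = level_count 1 r.
Proof. by rewrite count_edge level_vertex. Qed.

Lemma count_edgen b r : count (e (vertex b n)) r = level_count n.-1 r.
Proof. by rewrite count_edge level_vertex // (ltnW n2) (@level_count_gt n.+1)
  ?addn0. Qed.

(** * Letter counts of a word with a repeated letter *)

Definition letter_mult k h := if leaf h then k else k.*2.

(** The shape to which [cyc_ok_full] reduces the words with a repeated letter. *)
Definition full k r := balanced e r /\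
  forall b h, h <= n -> count_mem (vertex b h) r = letter_mult k h.

Lemma full_level_count k r h : full k r -> h <= n -> level_count h r = k.*2.
Proof.
move=> [_ F] hn; have [hl|hl] := boolP (leaf h).
  by rewrite level_count_leaf // !F // /letter_mult hl addnn.
rewrite -(level_count_mid true) ?F // /letter_mult ?(negPf hl) //.
by move: hl; rewrite /leaf; lia.
Qed.

Lemma full_size k r : full k r -> size r = n.+1 * k.*2.
Proof.
move=> F; rewrite size_level_count (eq_bigr (fun _ => k.*2)) => [|h _].
  by rewrite sum_nat_const card_ord.
by apply: full_level_count => //; rewrite -ltnS.
Qed.

Lemma count_edge_full k r b h : h <= n -> (forall h, h <= n -> level_count h r =
    k.*2) ->
  count (e (vertex b h)) r = (letter_mult k h).*2.
Proof.
move=> hn lvE; rewrite /letter_mult; case: ifP => hl.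
  by case/orP: hl => /eqP->; rewrite ?count_edge0 ?count_edgen lvE //; lia.
have hm : 0 < h < n by move: hl; rewrite /leaf; lia.
by rewrite count_edge_mid // !lvE; lia.
Qed.

Lemma cyc_ok_counts_full k r : cyc_ok e r ->
  (forall b h, h <= n -> count_mem (vertex b h) r = letter_mult k h) -> full k r.
Proof.
move=> cr cE; have lvE h : h <= n -> level_count h r = k.*2.
  move=> hn; have [hl|hl] := boolP (leaf h).
    by rewrite level_count_leaf // !cE // /letter_mult hl addnn.
  rewrite -(level_count_mid true) ?cE // /letter_mult ?(negPf hl) //.
  by move: hl; rewrite /leaf; lia.
split=> //; apply: cyc_ok_balanced => // y; have [b ->] := vertex_level y.
by rewrite (@count_edge_full k) ?cE // level_le.
Qed.

(** Let [M] be the largest number of letters on an inner level. A leaf occurs at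
most [M / 2] times, so no level has more than [M] letters. By [cyc_ok_total], an
inner level with [M] letters is adjacent to levels whose numbers of letters add
up to at least [2 M], hence are both equal to [M]. So all levels have [M]
letters, and every gap inequality is an equality. *)
Lemma cyc_ok_full r x : cyc_ok e r -> 1 < count_mem x r ->
  exists2 k, 0 < k & full k r.
Proof.
move=> cr cx; pose mid (h : 'I_n) := 0 < h.
pose h1 := Ordinal n2; have m1 : mid h1 by [].
have [h0 /= mh0 hmax] : exists2 h0 : 'I_n, mid h0 &
    forall h : nat, 0 < h < n -> level_count h r <= level_count h0 r.
  case: (@arg_maxnP _ h1 mid (fun h : 'I_n => level_count h r) m1) => h0 mh0 hmax.
  exists h0 => // h /andP[hp hn]; exact: (hmax (Ordinal hn)).
have {}mh0 : 0 < h0 := mh0.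
move: (h0 : nat) (ltn_ord h0) mh0 hmax => {m1 mid h1}h0 h0n h0p hmax.
have hmax1 : level_count 1 r <= level_count h0 r by apply: hmax; lia.
have hmaxn : level_count n.-1 r <= level_count h0 r by apply: hmax; lia.
have M2 : 1 < level_count h0 r.
  have [b xE] := vertex_level x; have := level_le x; move: xE;
    move: (level x) => h xE hn.
  rewrite {}xE in cx; have := cyc_ok_total cr cx.
  have [hm|hm] := boolP (0 < h < n); first by move: cx (hmax h hm);
    rewrite level_count_mid //; lia.
  have [h0'|h0'] := eqVneq h 0; first by subst h; rewrite count_edge0; lia.
  have hE : h = n by lia.
  by subst h; rewrite count_edgen; lia.
have leaf_le b h : leaf h -> (count_mem (vertex b h) r).*2 <= level_count h0 r.
  move=> hl; have [/(cyc_ok_total cr)|] := ltnP 1 (count_mem (vertex b h) r);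
    last by lia.
  by case/orP: hl => /eqP->; rewrite ?count_edge0 ?count_edgen; lia.
have level_count_le h : h <= n -> level_count h r <= level_count h0 r.
  move=> hn; have [hl|hl] := boolP (leaf h); last first.
    by apply: hmax; move: hl; rewrite /leaf; lia.
  by rewrite level_count_leaf //; have := leaf_le true h hl;
    have := leaf_le false h hl; lia.
have next h : 0 < h < n -> level_count h r = level_count h0 r ->
    level_count h.-1 r = level_count h0 r /\ level_count h.+1 r = level_count h0 r.
  move=> hm E; have := @cyc_ok_total _ _ r (vertex true h) cr.
  rewrite level_count_mid // E count_edge_mid // => /(_ M2).
  by have := level_count_le h.-1; have := level_count_le h.+1; lia.
have upper d : h0 + d <= n -> level_count (h0 + d) r = level_count h0 r.
  elim: d => [|d IH] hd; first by rewrite addn0.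
  by rewrite addnS; apply: (next (h0 + d) _ _).2; [lia|apply: IH; lia].
have down d : d <= h0 -> level_count (h0 - d) r = level_count h0 r.
  elim: d => [|d IH] hd; first by rewrite subn0.
  by rewrite subnS; apply: (next (h0 - d) _ _).1; [lia|apply: IH; lia].
have lvE h : h <= n -> level_count h r = level_count h0 r.
  move=> hn; have [hh|hh] := leqP h0 h.
    by have := upper (h - h0); rewrite subnKC //; apply.
  by have := down (h0 - h); rewrite subKn; [apply; lia|lia].
have leafE b h : leaf h -> (count_mem (vertex b h) r).*2 = level_count h0 r.
  move=> hl; have := leaf_le true h hl; have := leaf_le false h hl.
  by have := lvE h; rewrite level_count_leaf // => /(_ _); case: b; move: hl;
    rewrite /leaf; lia.
pose k := count_mem (vertex true 0) r; have kE : level_count h0 r =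
  k.*2 by rewrite -(leafE true 0).
have cE b h : h <= n -> count_mem (vertex b h) r = letter_mult k h.
  move=> hn; rewrite /letter_mult; have [hl|hl] := boolP (leaf h).
    by have := leafE b h hl; lia.
  by rewrite level_count_mid ?lvE //; move: hl; rewrite /leaf; lia.
by exists k; [lia|apply: cyc_ok_counts_full].
Qed.

Local Notation nb := (nb e).
Local Notation teq := (teq e).

(** * Propagation along the levels *)

(** [upper] and [lower] are the two parts of [nb] at an inner level. *)
Definition upper h l r := level_count h.+1 (pre (vertex true h) l r).
Definition lower h l r := level_count h.-1 (pre (vertex true h) l r).

Lemma nb_lower_upper h l r : 0 < h < n -> nb (vertex true h) l r =
    lower h l r + upper h l r.
Proof. by move=> hn; rewrite /nb count_edge_mid. Qed.

Lemma nb_leaf0 b l r : nb (vertex b 0) l r = pc (vertex b 0) (vertex true 1) l r.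
Proof. by rewrite /nb count_edge0 // -(level_count_mid true). Qed.

Lemma mid_pred : 0 < n.-1 < n. Proof. by lia. Qed.

Lemma nb_leafn b l r : nb (vertex b n) l r = pc (vertex b n) (vertex true n.-1) l r.
Proof. by rewrite /nb count_edgen // -(level_count_mid true) // mid_pred. Qed.

Lemma upper_mid h l r : h.+1 < n -> upper h l r =
    pc (vertex true h) (vertex true h.+1) l r.
Proof. by move=> hn; rewrite /upper -(level_count_mid true). Qed.

Lemma lower_mid h l r : 0 < h < n -> lower h.+1 l r =
    pc (vertex true h.+1) (vertex true h) l r.
Proof. by move=> hn; rewrite /lower -(level_count_mid true). Qed.

(** The letters [x] occur after [c], [c + 2], [c + 4] and so on letters [y]; so
their number increases by one at every second [y]. *)
Lemma leaf_inv x y k c r : x != y -> count_mem x r = k -> count_mem y r = k.*2 ->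
  c <= 2 -> (forall l, l < k -> pc x y l r = c + l.*2) ->
  forall q, q < k.*2 -> pc y x q r = (q + 2 - c)./2.
Proof.
move=> xy cx cy c2 H q qk; have qr : q < count_mem y r by rewrite cy.
have [B rE] := pre_split qr.
have pk : pc y x q r <= k by rewrite -cx {2}rE count_cat leq_addr.
have [lo hi] := pc_inv xy qr; have := H (pc y x q r); have := H (pc y x q r).-1.
move: lo hi; rewrite cx; move: (pc y x q r) pk => p pk; lia.
Qed.

Section FullWord.
Variables (k : nat) (r : seq I).
Hypothesis F : full k r.

Lemma full_leaf b h : leaf h -> count_mem (vertex b h) r = k.
Proof.
by move=> hl; rewrite F.2 /letter_mult ?hl //; move: hl; rewrite /leaf; lia.
Qed.

Lemma full_mid b h : 0 < h < n -> count_mem (vertex b h) r = k.*2.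
Proof.
move=> hn; rewrite F.2 /letter_mult; last by lia.
by rewrite /leaf; case: ifP => //; lia.
Qed.

Lemma full_nb b h l : h <= n -> l < letter_mult k h ->
  nb (vertex b h) l r = nb (vertex b h) 0 r + l.*2.
Proof. by move=> hn lk; apply: (F.1 _).2; rewrite F.2. Qed.

Hypothesis k0 : 0 < k.

Lemma full_nb0 b h : h <= n -> nb (vertex b h) 0 r <= 2.
Proof.
move=> hn; apply: balanced_nb0; first exact: F.1.
by rewrite F.2 // /letter_mult; case: ifP; lia.
Qed.

Lemma vertex_neq b b' h h' : h <= n -> h' <= n -> h != h' ->
    vertex b h != vertex b' h'.
Proof. by move=> hn hn'; apply: contraNneq => /vertex_inj->. Qed.

Lemma full_lower1 q : q < k.*2 ->
  lower 1 q r = (q + 2 - nb (vertex true 0) 0 r)./2 + (q + 2 - nb (vertex false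
    0) 0 r)./2.
Proof.
move=> qk; rewrite /lower level_count_leaf //.
suff E b : pc (vertex true 1) (vertex b 0) q r = (q + 2 - nb (vertex b 0) 0 r)./2.
  by rewrite -!E.
apply: (@leaf_inv (vertex b 0) (vertex true 1) k) => //.
- by apply: vertex_neq; lia.
- exact: full_leaf.
- exact: full_mid.
- exact: full_nb0.
by move=> l lk; rewrite -nb_leaf0 full_nb.
Qed.

Lemma full_uppern q : q < k.*2 ->
  upper n.-1 q r = (q + 2 - nb (vertex true n) 0 r)./2 + (q + 2 - nb (vertex
    false n) 0 r)./2.
Proof.
have nl : leaf n by rewrite /leaf eqxx orbT.
have nE : n.-1.+1 = n by lia.
move=> qk; rewrite /upper nE level_count_leaf //.
suff E b : pc (vertex true n.-1) (vertex b n) q r =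
  (q + 2 - nb (vertex b n) 0 r)./2.
  by rewrite -!E.
apply: (@leaf_inv (vertex b n) (vertex true n.-1) k) => //.
- by apply: vertex_neq; lia.
- exact: full_leaf.
- exact: full_mid mid_pred.
- exact: full_nb0.
by move=> l lk; rewrite -nb_leafn full_nb // /letter_mult nl.
Qed.

Lemma full_lower_upper h l : 0 < h < n -> l < k.*2 ->
  lower h l r + upper h l r = lower h 0 r + upper h 0 r + l.*2.
Proof.
move=> hn lk; rewrite -!nb_lower_upper // full_nb //; first by lia.
by rewrite /letter_mult /leaf; case: ifP => //; lia.
Qed.

Lemma upper_le h l : h < n -> upper h l r <= k.*2.
Proof.
move=> hn; rewrite -(full_level_count F (h := h.+1)) // /upper.
elim: r l => [|x s IH] l //=; case: ifP => // _; last first.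
  by rewrite /level_count /= leq_add2l; apply: IH.
by case: l => [|l] //; rewrite /level_count /= leq_add2l; apply: IH.
Qed.

Lemma full_inv h q : 0 < h -> h.+1 < n -> q < k.*2 ->
  (0 < lower h.+1 q r -> upper h (lower h.+1 q r).-1 r <= q) /\
  (lower h.+1 q r < k.*2 -> q < upper h (lower h.+1 q r) r) /\
    lower h.+1 q r <= k.*2.
Proof.
move=> h0 hn qk; have hm : 0 < h < n by lia.
have hm' : 0 < h.+1 < n by lia.
have qr : q < count_mem (vertex true h.+1) r by rewrite full_mid.
have xy : vertex true h != vertex true h.+1 by apply: vertex_neq; lia.
have := pc_inv xy qr; rewrite full_mid // -lower_mid // -!upper_mid // => -[lo hi].
split=> //; split=> //; rewrite lower_mid // -(full_mid true hm).
by have [B rE] := pre_split qr; rewrite {2}rE count_cat leq_addr.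
Qed.

(** The numbers of left leaves before successive letters of level 1 increase by one
each time, as the two leaves have opposite parities. Each gap on an inner level
contains two neighbours, hence one letter of the level above for each letter of
the level below, and the alternation passes on to the next level. *)
Lemma outphase_upper h : odd (nb (vertex true 0) 0 r + nb (vertex false 0) 0 r)
    -> 0 < h < n ->
  exists2 c, c <= 1 & forall l, l < k.*2 -> upper h l r = c + l.
Proof.
move=> ph; suff step h' : 0 < h' < n ->
    (exists d, forall q, q < k.*2 -> lower h' q r + d = q.+1) ->
    exists2 c, c <= 1 & forall l, l < k.*2 -> upper h' l r = c + l.
  elim: h => [|h IH] //; case: h IH => [_ h1|h IH hn].
    apply: step => //.
    have t2 := @full_nb0 true 0 isT; have f2 := @full_nb0 false 0 isT.
    move: ph (full_lower1) t2 f2; move: (nb _ _ _) (nb _ _ _) => t f ph E t2 f2.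
    exists (t + f)./2 => q qk; rewrite E //; lia.
  have hm : 0 < h.+1 < n by lia.
  have [c c1 upE] := IH hm; apply: step => //; exists c => q qk.
  have [lo [hi le]] := @full_inv h.+1 q isT (andP hn).2 qk.
  move: lo hi le; move: (lower h.+2 q r) => p.
  by have := upE p; have := upE p.-1; lia.
move=> hm [d dE]; have hn : h' < n by lia.
exists (upper h' 0 r).
  have := upper_le (k.*2).-1 hn; have := full_lower_upper (l := k.*2.-1) hm.
  by have := dE 0; have := dE k.*2.-1; lia.
by move=> l lk; have := full_lower_upper hm lk; have := dE 0; have := dE l lk; lia.
Qed.

(** The alternation reaches level [n], and the two leaves there share it as those
of level 0 do. *)
Lemma outphase_leafn : odd (nb (vertex true 0) 0 r + nb (vertex false 0) 0 r) ->
  odd (nb (vertex true n) 0 r + nb (vertex false n) 0 r).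
Proof.
move=> /outphase_upper H; have [c c1 E] := H n.-1 mid_pred.
have := @full_uppern 0; have := @full_uppern 1; rewrite !E; try lia.
have := @full_nb0 true n (leqnn _); have := @full_nb0 false n (leqnn _).
move: (nb _ _ _) (nb _ _ _) => t f; lia.
Qed.

Hypothesis inphase : forall b, nb (vertex b 0) 0 r = 0.

(** Successive gaps of level 1 contain by turns no leaf and two leaves; as every gap
contains two neighbours, they contain by turns two letters of level 2 and none.
The same holds then for the gaps of level 2 with respect to levels 1 and 3, and
so on. *)
Lemma inphase_upper h : 0 < h < n -> forall l, l < k.*2 -> upper h l r =
    (uphalf l).*2.
Proof.
suff step h' : 0 < h' < n ->
    (forall q, q < k.*2 -> lower h' q r = lower h' 0 r + (q./2).*2) ->
    forall l, l < k.*2 -> upper h' l r = (uphalf l).*2.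
  elim: h => [|h IH] //; case: h IH => [_ h1|h IH hn].
    apply: step => // q qk.
    by rewrite !full_lower1 ?inphase; lia.
  have hm : 0 < h.+1 < n by lia.
  have upE := IH hm; apply: step => //.
  suff E q : q < k.*2 -> lower h.+2 q r = 1 + (q./2).*2.
    by move=> q qk; rewrite !E //; lia.
  move=> qk; have [lo [hi le]] := @full_inv h.+1 q isT (andP hn).2 qk.
  move: lo hi le; move: (lower h.+2 q r) => p.
  by have := upE p; have := upE p.-1; lia.
move=> hm dE l lk; have hn : h' < n by lia.
have := full_lower_upper hm lk; have := full_lower_upper (l := k.*2.-1) hm.
have := upper_le (k.*2).-1 hn; have := dE _ lk; have := dE k.*2.-1.
by lia.
Qed.

Lemma inphase_leafn b : nb (vertex b n) 0 r = 1.
Proof.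
have U := inphase_upper mid_pred.
have := @full_uppern 0; have := @full_uppern 1; rewrite !U; try lia.
have := @full_nb0 true n (leqnn _); have := @full_nb0 false n (leqnn _).
by case: b; move: (nb _ _ _) (nb _ _ _) => t f; lia.
Qed.

End FullWord.

(** Leaves are placed by the number of neighbours before their first occurrence,
and inner levels by their interleaving with the next level. *)
Lemma full_teq k r s : full k r -> full k s ->
  (forall b h, leaf h -> nb (vertex b h) 0 r = nb (vertex b h) 0 s) ->
  (forall h l, 0 < h -> h.+1 < n -> l < k.*2 -> upper h l r = upper h l s) ->
  teq r s.
Proof.
move=> Fr Fs El Eu.
have cE x : count_mem x r = count_mem x s.
  by have [b ->] := vertex_level x; rewrite Fr.2 ?Fs.2 // level_le.
have nl : leaf n by rewrite /leaf eqxx orbT.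
have adj b b' h : h < n ->
    (forall l, l < count_mem (vertex b h) r ->
       pc (vertex b h) (vertex b' h.+1) l r =
         pc (vertex b h) (vertex b' h.+1) l s) \/
    (forall l, l < count_mem (vertex b' h.+1) r ->
       pc (vertex b' h.+1) (vertex b h) l r = pc (vertex b' h.+1) (vertex b h) l s).
  move=> hn; have [h0|h0] := posnP h.
    subst h; left => l; rewrite Fr.2 // => lk.
    rewrite (vertex_mid b' true); last by lia.
    by rewrite -!nb_leaf0 (full_nb Fr) // (full_nb Fs) // El.
  rewrite (vertex_mid b true); last by lia.
  have [hn'|hn'] := leqP n h.+1.
    have hE : h = n.-1 by lia.
    right => l; have -> : h.+1 = n by lia.
    rewrite Fr.2 // hE => lk.
    by rewrite -!nb_leafn (full_nb Fr) // (full_nb Fs) // El.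
  left => l; rewrite (full_mid Fr); last by lia.
  by move=> lk; rewrite (vertex_mid b' true) ?hn' // -!upper_mid // Eu.
apply: teqP => //; first exact: affD_edge_irr.
move=> x y; rewrite edge_level.
have [b xE] := vertex_level x; have [b' yE] := vertex_level y.
have := level_le x; have := level_le y.
move: (level x) (level y) xE yE => hx hy -> -> yn xn /orP[]/eqP E; subst.
  by have [H|H] := adj b' b _ xn; [right|left].
exact: adj.
Qed.

(** * Alternating words *)

(** A word with one letter on each level from 0 to [h], that is, a Coxeter element
of a path: [o j] tells whether the letter of level [j + 1] comes before the one
of level [j]. The labels [c] matter only on the two end levels. *)
Fixpoint path_word (c o : nat -> bool) h : seq I :=
  if h is h'.+1 then
    let w := path_word c o h' in
    if o h' then vertex (c h) h :: w else rcons w (vertex (c h) h)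
  else [:: vertex (c 0) 0].

Lemma count_path_word c o h x : h <= n ->
  count_mem x (path_word c o h) = (level x <= h) && (x == vertex (c (level x))
    (level x)).
Proof.
elim: h => [|h IH] hn /=.
  rewrite addn0 eq_sym; congr nat_of_bool; apply/eqP/andP => [->|[]].
    by rewrite level_vertex.
  by rewrite leqn0 => /eqP-> /eqP.
have -> : count_mem x (if o h then vertex (c h.+1) h.+1 :: path_word c o h
    else rcons (path_word c o h) (vertex (c h.+1) h.+1)) =
    (vertex (c h.+1) h.+1 == x) + count_mem x (path_word c o h).
  by case: (o h); rewrite //= -cats1 count_cat /= addn0 addnC.
rewrite IH ?(ltnW hn) //; have [lx|lx|lx] := ltngtP (level x) h.+1.
- rewrite -ltnS lx andTb; have [E|] := eqVneq (vertex _ _) x => //.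
  by move: lx; rewrite -E level_vertex // ltnn.
- rewrite leqNgt ltnW //=; have [E|] := eqVneq (vertex _ _) x => //.
  by move: lx; rewrite -E level_vertex // ltnn.
by rewrite lx ltnn addn0 eq_sym.
Qed.

Lemma level_count_path_word c o h h' : h <= n ->
    level_count h' (path_word c o h) = (h' <= h).
Proof.
elim: h => [|h IH] hn /=; first by rewrite /level_count /= addn0 leqn0 eq_sym.
have -> : level_count h' (if o h then vertex (c h.+1) h.+1 :: path_word c o h
    else rcons (path_word c o h) (vertex (c h.+1) h.+1)) =
    (h.+1 == h') + level_count h' (path_word c o h).
  by case: (o h); rewrite /level_count //= -?cats1 ?count_cat /= level_vertex //
    addn0 addnC.
by rewrite IH ?(ltnW hn) //; lia.
Qed.

Lemma pre_path_word c o h H : h <= H -> H <= n ->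
  level_count h.+1 (pre (vertex (c h) h) 0 (path_word c o H)) = (h < H) && o h /\
  (0 < h -> level_count h.-1 (pre (vertex (c h) h) 0 (path_word c o H)) =
    ~~ o h.-1).
Proof.
elim: H => [|H IH] hH Hn /=.
  by move: hH; rewrite leqn0 => /eqP->; rewrite eqxx.
have [hE|hE] := eqVneq h H.+1.
  subst h; case: ifP => oH /=.
    by rewrite eqxx ltnn; split=> // _; rewrite /= oH.
  rewrite -cats1 pre_cat count_path_word ?(ltnW Hn) // level_vertex // ltnn /=.
  rewrite ?subn0 eqxx cats0 !level_count_path_word ?(ltnW Hn) // leqnn.
  by split=> //; rewrite ?oH; lia.
have {}hH : h <= H by lia.
have [IH1 IH2] := IH hH (ltnW Hn).
have ne : (vertex (c H.+1) H.+1 == vertex (c h) h) = false.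
  by apply/negbTE/vertex_neq => //; [lia|lia].
case: ifP => oH /=.
  rewrite ne /level_count /= -!/(level_count _ _) IH1 level_vertex //; split;
    last by move=> /IH2->; lia.
  have [->|] := eqVneq h H; first by rewrite eqxx ltnn ltnS leqnn oH.
  by lia.
rewrite -cats1 pre_cat count_path_word ?(ltnW Hn) // level_vertex; last by lia.
rewrite hH eqxx /= IH1; split=> //.
by have [->|] := eqVneq h H; [rewrite oH !andbF|lia].
Qed.

Lemma nb_path_word c o h : h <= n -> nb (vertex (c h) h) 0 (path_word c o n) =
  ((0 < h) && ~~ o h.-1) + ((h < n) && o h).
Proof.
move=> hn; have [E1 E2] := pre_path_word c o hn (leqnn n).
rewrite /nb count_edge level_vertex // E1; congr (_ + _).
by case: (posnP h) => [->|/[dup] h0 /E2->].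
Qed.

Definition ends a b h := if h == 0 then a else b : bool.

(** The second half of the period uses the other leaf on both ends. *)
Definition alternating a b o :=
  path_word (ends a b) o n ++ path_word (ends (~~ a) (~~ b)) o n.

Lemma count_alternating a b o c h : h <= n ->
  count_mem (vertex c h) (alternating a b o) = letter_mult 1 h.
Proof.
move=> hn; rewrite count_cat !count_path_word // !level_vertex // hn /=
  /letter_mult.
have [hl|hl] := boolP (leaf h).
  rewrite !vertex_leaf // /ends; case: (h == 0).
    by case: a c => [] [].
  by case: b c => [] [].
have hm : 0 < h < n by move: hl; rewrite /leaf; lia.
by rewrite ![vertex c h == _]eq_vertex_mid // !level_vertex ?eqxx.
Qed.

Lemma level_count_alternating a b o h : h <= n ->
    level_count h (alternating a b o) = 2.
Proof. by move=> hn; rewrite level_count_cat !level_count_path_word // hn. Qed.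

Lemma alternating_full a b o : full 1 (alternating a b o).
Proof.
split=> [x|c h]; last exact: count_alternating.
have [c ->] := vertex_level x; have := level_le x; move: (level x) => h hn.
rewrite count_alternating //; split.
  by apply: count_edge_full => // *; apply: level_count_alternating.
case=> [|[|l]]; rewrite ?addn0 //; last by rewrite /letter_mult; case: ifP.
rewrite /letter_mult; case: ifP => // hl _.
have hm : 0 < h < n by move: hl; rewrite /leaf; lia.
have c1 d : count_mem (vertex c h) (path_word d o n) = 1.
  by rewrite count_path_word // level_vertex // hn eq_vertex_mid // level_vertex
    // eqxx.
rewrite /alternating [nb _ 1 _]nb_catr ?c1 // nb_catl ?c1 // subnn.
rewrite count_edge_mid // !level_count_path_word //.
rewrite (vertex_mid c (ends a b h)) // nb_path_word //.
rewrite (vertex_mid (ends a b h) (ends (~~ a) (~~ b) h)) // nb_path_word //; lia.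
Qed.

Lemma full_word_pow k r : full 1 r -> full k (word_pow k r).
Proof.
move=> [bal c]; split; first exact: balanced_word_pow bal.
by move=> b h hn; rewrite count_word_pow c // /letter_mult; case: ifP; lia.
Qed.

Lemma nb0_alternating a b o c :
  nb (vertex c 0) 0 (alternating a b o) = (c != a) + o 0.
Proof.
have n0 : 0 < n by lia.
have [->|ca] := eqVneq c a.
  rewrite nb_catl ?count_path_word ?level_vertex ?eqxx //.
  by have /= := nb_path_word (ends a b) o (h := 0) isT; rewrite n0.
have cE : c = ~~ a by move: ca; case: c a => [] [].
rewrite nb_catr ?count_path_word ?level_vertex ?vertex_leaf ?(negPf ca) //=.
rewrite subn0 count_edge0 level_count_path_word // n0 cE; congr (_ + _).
by have /= := nb_path_word (ends (~~ a) (~~ b)) o (h := 0) isT; rewrite n0.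
Qed.

Lemma nbn_alternating a b o c :
  nb (vertex c n) 0 (alternating a b o) = (c != b) + ~~ o n.-1.
Proof.
have n0 : 0 < n by lia.
have nl : leaf n by rewrite /leaf eqxx orbT.
have nE : (n == 0) = false by lia.
have [->|ca] := eqVneq c b.
  rewrite nb_catl ?count_path_word ?level_vertex /ends ?nE ?leqnn ?eqxx //.
  have := nb_path_word (ends a b) o (leqnn n).
  by rewrite n0 ltnn /ends nE addn0.
have cE : c = ~~ b by move: ca; case: c b => [] [].
rewrite nb_catr ?count_path_word ?level_vertex /ends ?nE ?vertex_leaf ?(negPf ca)
  ?andbF //=.
rewrite subn0 count_edgen level_count_path_word // leq_pred cE; congr (_ + _).
have := nb_path_word (ends (~~ a) (~~ b)) o (leqnn n).
by rewrite n0 ltnn /ends nE addn0.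
Qed.

Lemma upper_alternating a b o h : 0 < h < n -> upper h 0 (alternating a b o) = o h.
Proof.
move=> hm; have hn : h <= n by lia.
rewrite /upper pre_cat count_path_word // level_vertex // hn eq_vertex_mid //
  level_vertex // eqxx /=.
rewrite (vertex_mid true (ends a b h)) //.
have [-> _] := pre_path_word (ends a b) o hn (leqnn n).
by case/andP: hm => _ ->.
Qed.

Lemma upper_word_pow k h r : 0 < k -> full 1 r -> 0 < h < n ->
  upper h 0 (word_pow k r) = upper h 0 r.
Proof.
move=> k0 F hm; case: k k0 => // k _; rewrite /upper [word_pow _ _]/= pre_cat.
by rewrite (full_mid F).
Qed.

Lemma nb_word_pow_full k r b h : 0 < k -> full 1 r -> h <= n ->
  nb (vertex b h) 0 (word_pow k r) = nb (vertex b h) 0 r.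
Proof.
by move=> k0 F hn; apply: nb_word_pow => //; rewrite F.2 // /letter_mult; case: ifP.
Qed.

(** The phase of the leaf that comes first on each end and the first occurrences
on the inner levels give the orientation of a path; [outphase_upper] applied to
the given word and to the power of the corresponding period shows that they
agree. *)
Lemma full_alternating k r : 0 < k -> full k r ->
  odd (nb (vertex true 0) 0 r + nb (vertex false 0) 0 r) ->
  exists a b (t : n.-tuple bool), teq r (word_pow k (alternating a b (nth false
    t))).
Proof.
move=> k0 F ph; have phn := outphase_leafn F k0 ph.
pose K b h := nb (vertex b h) 0 r.
pose o h := if h == 0 then (0 < K true 0) && (0 < K false 0) else
  if h == n.-1 then (K true n == 0) || (K false n == 0) else 0 < upper h 0 r.
pose t := [tuple o i | i < n].
have tE h : h < n -> nth false t h = o h by move=> hn;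
  rewrite (nth_mktuple _ _ (Ordinal hn)).
have n0 : 0 < n by lia.
have K2 b h : h <= n -> K b h <= 2 by move=> hn; apply: full_nb0 F k0 _ _ hn.
exists (K true 0 < K false 0), (K true n < K false n), t.
have Fr := full_word_pow k (alternating_full (K true 0 < K false 0) (K true n < K
  false n) (nth false t)).
apply: (full_teq F Fr).
  move=> b h hl; have hn : h <= n by move: hl; rewrite /leaf; lia.
  rewrite nb_word_pow_full //; last exact: alternating_full.
  case/orP: hl => /eqP->.
    rewrite nb0_alternating tE // /o eqxx -/(K _ _).
    have := K2 true 0 isT; have := K2 false 0 isT; move: ph; rewrite -!/(K _ _).
    by case: b; move: (K true 0) (K false 0); lia.
  rewrite nbn_alternating tE ?ltn_predL // /o; have -> : (n.-1 == 0) = false by lia.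
  rewrite eqxx -/(K _ _).
  have := K2 true n (leqnn n); have := K2 false n (leqnn n); move: phn.
  by rewrite -!/(K _ _); case: b; move: (K true n) (K false n); lia.
have phr : odd (nb (vertex true 0) 0 (word_pow k (alternating (K true 0 < K false 0)
    (K true n < K false n) (nth false t))) + nb (vertex false 0) 0 (word_pow k
    (alternating (K true 0 < K false 0) (K true n < K false n) (nth false t)))).
  rewrite !nb_word_pow_full ?nb0_alternating //; try exact: alternating_full.
  by case: (_ < _) => /=; lia.
move=> h l h0 hn lk; have hm : 0 < h < n by lia.
have [c c1 E] := outphase_upper F k0 ph hm;
  have [c' c1' E'] := outphase_upper Fr k0 phr hm.
rewrite E // E' //; congr (_ + _).
have := E 0; have := E' 0.
rewrite upper_word_pow ?upper_alternating //; last exact: alternating_full.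
rewrite tE; last by lia.
rewrite /o; have -> : (h == 0) = false by lia.
have -> : (h == n.-1) = false by lia.
by lia.
Qed.

Lemma alternating_inj k a b (t : n.-tuple bool) a' b' (t' : n.-tuple bool) :
  0 < k ->
  teq (word_pow k (alternating a b (nth false t)))
      (word_pow k (alternating a' b' (nth false t'))) ->
  (a, b, t) = (a', b', t').
Proof.
set r := alternating _ _ _; set r' := alternating _ _ _ => k0 rr.
have F : full 1 r by apply: alternating_full.
have F' : full 1 r' by apply: alternating_full.
have nbE c h : h <= n -> nb (vertex c h) 0 r = nb (vertex c h) 0 r'.
  move=> hn; rewrite -(nb_word_pow_full c k0 F) // -(nb_word_pow_full c k0 F') //.
  apply: teq_nb rr _; rewrite (full_word_pow k F).2 // /letter_mult; case: ifP; lia.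
have K c := nbE c 0 isT; have := K true; have := K false.
rewrite !nb0_alternating => K1 K2.
have N c := nbE c n (leqnn n); have := N true; have := N false.
rewrite !nbn_alternating => N1 N2.
have aE : a = a' by case: (a) (a') K1 K2 => [] []; lia.
have bE : b = b' by case: (b) (b') N1 N2 => [] []; lia.
congr (_, _, _) => //; apply/val_inj/(@eq_from_nth _ false); rewrite !size_tuple //.
move=> h hn; have [->|h0] := eqVneq h 0.
  by move: K1; rewrite aE => /addnI; case: (nth _ _ _) (nth _ _ _) => [] [].
have [hm|hm] := ltnP h n.-1; last first.
  have -> : h = n.-1 by lia.
  by move: N1; rewrite bE => /addnI; case: (nth _ _ _) (nth _ _ _) => [] [].
have hmid : 0 < h < n by lia.
suff : upper h 0 r = upper h 0 r'.
  by rewrite !upper_alternating //; case: (nth _ _ _) (nth _ _ _) => [] [].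
have hn1 : h.+1 < n by lia.
rewrite -(upper_word_pow k0 F) // -(upper_word_pow k0 F') // !upper_mid //.
apply: teq_pc rr _ _; first by apply: edge_vertex; lia.
by rewrite (full_mid (full_word_pow k F)) //; lia.
Qed.

(** * Zigzag words *)

Lemma full_cyc_ok k r : full k r -> cyc_ok e r.
Proof. by case=> /balanced_cyc_ok. Qed.

Lemma full_rot k m r : full k r -> full k (rot m r).
Proof.
move=> F; apply: cyc_ok_counts_full => [|b h hn].
  by apply: cyc_ok_rot affD_edge_irr _ _ (full_cyc_ok F).
by rewrite -(F.2 b h hn); apply/permP; rewrite perm_rot.
Qed.

Lemma full_eq_teq k r s : teq r s -> full k r -> full k s.
Proof.
move=> rs F; apply: cyc_ok_counts_full (cyc_ok_teq rs (full_cyc_ok F)) _.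
by move=> b h hn; rewrite -(teq_count _ rs) F.2.
Qed.

Lemma teq_swap2 x y A B : x != y -> ~~ e x y ->
  teq (A ++ [:: x; y] ++ B) (A ++ [:: y; x] ++ B).
Proof.
move=> xy exy; apply/teq_catl/teq_catr/(@teq_swap _ _ (@affD_edge_sym n) x [:: y]).
  by rewrite inE.
by rewrite /= orbF.
Qed.

Lemma teq_swap_leaf h A B : leaf h ->
  teq (A ++ [:: vertex true h; vertex false h] ++ B) (A ++ [:: vertex false h;
    vertex true h] ++ B).
Proof.
move=> hl; have hn : h <= n by move: hl; rewrite /leaf; lia.
apply: teq_swap2; first by rewrite vertex_leaf.
by rewrite edge_level !level_vertex //; lia.
Qed.

Definition seg a m := map (vertex true) (iota a m).
Definition mids := seg 1 n.-1.

(** The walk from the left end to the right end and back, visiting both leaves at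
each turn. *)
Definition zigzag := [:: vertex true 0; vertex false 0] ++ mids ++
  [:: vertex true n; vertex false n] ++ rev mids.

Lemma level_count_seg a m h : a + m <= n.+1 -> level_count h (seg a m) =
    (a <= h < a + m).
Proof.
elim: m a => [|m IH] a am; first by rewrite addn0; case: ltngtP.
have -> : level_count h (seg a m.+1) = (level (vertex true a) == h) + level_count
  h (seg a.+1 m) by [].
by rewrite IH ?level_vertex; lia.
Qed.

Lemma level_count_rev h r : level_count h (rev r) = level_count h r.
Proof. by rewrite /level_count count_rev. Qed.

Lemma level_count_mids h : level_count h mids = (0 < h < n).
Proof. by rewrite level_count_seg; [lia|lia]. Qed.

Lemma mids_mid x : x \in mids -> 0 < level x < n.
Proof.
by case/mapP => i; rewrite mem_iota => ii ->; rewrite level_vertex; lia.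
Qed.

Lemma leaf_mids b h : leaf h -> vertex b h \notin mids.
Proof.
move=> hl; apply/negP => /mids_mid; rewrite level_vertex; move: hl;
  rewrite /leaf; lia.
Qed.

Lemma count_zigzag b h : h <= n -> count_mem (vertex b h) zigzag = letter_mult 1 h.
Proof.
move=> hn; rewrite /letter_mult; have [hl|hl] := boolP (leaf h).
  rewrite !count_cat count_rev (count_memPn (leaf_mids b hl)) /= !addn0 !add0n.
  case/orP: hl => /eqP hE; subst h; rewrite !vertex_leaf /leaf ?eqxx ?orbT //.
    have ne c : (vertex c n == vertex b 0) =
      false by apply/negbTE/vertex_neq => //; lia.
    by rewrite !ne; case: b {ne}.
  have ne c : (vertex c 0 == vertex b n) =
    false by apply/negbTE/vertex_neq => //; lia.
  by rewrite !ne; case: b {ne}.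
have hm : 0 < h < n by move: hl; rewrite /leaf; lia.
rewrite level_count_mid // !level_count_cat level_count_rev level_count_mids hm
  /level_count /= !level_vertex //.
by case: eqP; case: eqP; lia.
Qed.

Lemma level_count_zigzag h : h <= n -> level_count h zigzag = 2.
Proof.
move=> hn; rewrite !level_count_cat level_count_rev level_count_mids /level_count
  /= !level_vertex //; lia.
Qed.

Lemma zigzag_full : full 1 zigzag.
Proof.
split=> [x|b h]; last exact: count_zigzag.
have [b ->] := vertex_level x; have := level_le x; move: (level x) => h hn.
rewrite count_zigzag //; split.
  by apply: count_edge_full => // *; apply: level_count_zigzag.
case=> [|[|l]]; rewrite ?addn0 //; last by rewrite /letter_mult; case: ifP.
rewrite /letter_mult; case: ifP => // hl _.
have hm : 0 < h < n by move: hl; rewrite /leaf; lia.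
have midsE : mids = seg 1 h.-1 ++ vertex b h :: seg h.+1 (n.-1 - h).
  rewrite (vertex_mid b true) // /mids /seg.
  have -> : n.-1 = h.-1 + (n.-1 - h).+1 by lia.
  rewrite iotaD map_cat; have -> : 1 + h.-1 = h by lia.
  by have -> : h.-1 + (n.-1 - h).+1 - h = n.-1 - h by lia.
pose P := [:: vertex true 0; vertex false 0] ++ seg 1 h.-1.
pose Q := seg h.+1 (n.-1 - h) ++ [:: vertex true n;
  vertex false n] ++ rev (seg h.+1 (n.-1 - h)).
have zE : zigzag = P ++ vertex b h :: Q ++ vertex b h :: rev (seg 1 h.-1).
  by rewrite /zigzag midsE rev_cat rev_cons /P /Q -!catA /= -cats1 -!catA.
have cP : count_mem (vertex b h) P = 0.
  by rewrite level_count_mid // level_count_cat level_count_seg /level_count /=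
    ?level_vertex //; lia.
have cQ : count_mem (vertex b h) Q = 0.
  by rewrite level_count_mid // !level_count_cat level_count_rev level_count_seg
    /level_count /= ?level_vertex //; lia.
have p0 : pre (vertex b h) 0 zigzag = P by rewrite zE -{1}cP pre_occ.
have p1 : pre (vertex b h) 1 zigzag = P ++ vertex b h :: Q.
  have c1 : count_mem (vertex b h) (P ++ vertex b h :: Q) = 1.
    by rewrite count_cat cP add0n -[vertex b h :: Q]cat1s count_cat cQ /= eqxx.
  by rewrite zE -cat_cons catA -{1}c1 pre_occ.
rewrite /nb p0 p1 count_cat /= affD_edge_irr add0n; congr (_ + _).
rewrite count_edge_mid // !level_count_cat !level_count_rev !level_count_seg;
  try lia.
by rewrite /level_count /= !level_vertex //; lia.
Qed.

Lemma size_zigzag : size zigzag = n.+1.*2.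
Proof. by rewrite (full_size zigzag_full); lia. Qed.

(** The leaves of an end commute, so cutting the circular zigzag between them can
put either leaf first. One choice is the rotation [rot 1 zigzag], the other one
is this word. *)
Definition twist0 := vertex true 0 :: mids ++ [:: vertex true n;
    vertex false n] ++ rev mids
  ++ [:: vertex false 0].

(** The analogue of [twist0] at the right end. *)
Definition twistn := vertex true n :: rev mids ++ [:: vertex true 0;
    vertex false 0] ++ mids
  ++ [:: vertex false n].
Definition zigzags := [:: twist0; twistn] ++ [seq rot m zigzag | m <- iota 0
    n.+1.*2].

Definition zigzag0 := [:: vertex false 0; vertex true 0] ++ mids ++
  [:: vertex true n; vertex false n] ++ rev mids.
Definition zigzagn := [:: vertex true 0; vertex false 0] ++ mids ++
  [:: vertex false n; vertex true n] ++ rev mids.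

Lemma nleaf : leaf n. Proof. by rewrite /leaf eqxx orbT. Qed.

Lemma teq_zigzag0 : teq zigzag zigzag0.
Proof. exact: (teq_swap_leaf [::] _ (erefl : leaf 0)). Qed.

Lemma teq_zigzagn : teq zigzag zigzagn.
Proof.
by have := teq_swap_leaf ([:: vertex true 0;
  vertex false 0] ++ mids) (rev mids) nleaf;
   rewrite -!catA.
Qed.

Lemma twist0E : twist0 = rot 1 zigzag0.
Proof. by rewrite /zigzag0 /= rot1_cons /twist0 /= -cats1 -!catA. Qed.

Lemma rot_split m A B r : r = A ++ B -> m = size A -> rot m r = B ++ A.
Proof. by move=> -> ->; rewrite rot_size_cat. Qed.

Lemma size_mids : size mids = n.-1.
Proof. by rewrite size_map size_iota. Qed.

Lemma twistnE : twistn = rot n.+2 zigzagn.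
Proof.
rewrite (@rot_split _ ([:: vertex true 0;
  vertex false 0] ++ mids ++ [:: vertex false n])
  (vertex true n :: rev mids)) //.
  by rewrite /zigzagn /= -!catA.
by rewrite /= size_cat size_mids /=; lia.
Qed.

Lemma mem_zigzagsP r : r \in zigzags ->
  [\/ r = twist0, r = twistn | exists2 m, m < n.+1.*2 & r = rot m zigzag].
Proof.
rewrite mem_cat => /orP[|/mapP[m]].
  by rewrite !inE => /orP[]/eqP->; [constructor 1|constructor 2].
by rewrite mem_iota add0n => /andP[_ mn] ->; constructor 3; exists m.
Qed.

Lemma zigzags_full r : r \in zigzags -> full 1 r.
Proof.
case/mem_zigzagsP => [->|->|[m _ ->]]; last exact: full_rot zigzag_full.
  by rewrite twist0E; apply/full_rot/(full_eq_teq teq_zigzag0)/zigzag_full.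
by rewrite twistnE; apply/full_rot/(full_eq_teq teq_zigzagn)/zigzag_full.
Qed.

(** * First letters of a zigzag *)

Definition keep c d := [pred y : I | (y != vertex c 0) && (y != vertex d n)].

(** Deleting one leaf of each end from a zigzag leaves a closed walk in the
diagram. *)
Definition closed_walks r := forall c d, cycle e (filter (keep c d) r).

Lemma keepE c d b h : h <= n ->
  keep c d (vertex b h) = ~~ ((h == 0) && (b == c)) && ~~ ((h == n) && (b == d)).
Proof.
move=> hn; rewrite /=; congr (~~ _ && ~~ _).
  by have [->|h0] /= := eqVneq h 0; [rewrite vertex_leaf|apply/negbTE/vertex_neq].
have [->|h0] /= := eqVneq h n; first by rewrite vertex_leaf // nleaf.
exact/negbTE/vertex_neq.
Qed.

(** A letter of a walk that differs from the first one comes right after one of its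
neighbours. *)
Lemma path_nb y s x : path e y s -> x \in s -> x != y -> 0 < nb x 0 (y :: s).
Proof.
elim: s y => //= z s IH y /andP[yz zs] xs xy.
rewrite nb_cons; last exact: affD_edge_irr.
rewrite eq_sym (negPf xy); have [zx|zx] := eqVneq z x.
  by rewrite -zx affD_edge_sym yz.
rewrite addn_gt0 IH ?orbT // 1?eq_sym //.
by move: xs; rewrite inE eq_sym (negPf zx).
Qed.

Lemma nb_filter x (p : pred I) r : p x -> x \in r ->
    nb x 0 (filter p r) <= nb x 0 r.
Proof.
move=> px; rewrite -has_pred1 has_count => xr.
by rewrite /nb pre_filter // count_filter; apply: sub_count => y /andP[].
Qed.

Lemma closed_walk_min (p : pred I) r x : cycle e (filter p r) -> p x -> x \in r ->
  nb x 0 r = 0 -> exists s, filter p r = x :: s.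
Proof.
move=> cyc px xr x0; have := nb_filter px xr; rewrite x0 leqn0 => /eqP {}x0.
have : x \in filter p r by rewrite mem_filter px.
case: (filter p r) cyc x0 => // y s; rewrite /cycle rcons_path => /andP[ys _] y0.
have [->|xy] := eqVneq x y; first by exists s.
by rewrite inE (negPf xy) => /(path_nb ys)/(_ xy); rewrite y0.
Qed.

Lemma filter_cons (p : pred I) y s :
  filter p (y :: s) = if p y then y :: filter p s else filter p s.
Proof. by []. Qed.

(** A letter without neighbours before it is the first letter of each of the closed
walks that contain it. So it is the first letter of the word, unless it is the
second of two leaves of the same end. *)
Lemma closed_walks_min y s x : closed_walks (y :: s) -> x \in y :: s ->
  nb x 0 (y :: s) = 0 -> x = y \/
  exists b h s', [/\ leaf h, y = vertex b h, x = vertex (~~ b) h & s = x :: s'].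
Proof.
move=> cw xs x0; have [->|xy] := eqVneq x y; [by left|right].
have hd c d : keep c d x -> exists s', filter (keep c d) (y :: s) = x :: s'.
  by move=> kx; apply: closed_walk_min (cw c d) kx xs x0.
have [b yE] := vertex_level y; have [b' xE] := vertex_level x.
have hn := level_le y; have hn' := level_le x.
have noty c d : keep c d x -> ~~ keep c d y.
  by move=> /hd[s']; rewrite filter_cons; case: ifP => // _ [yx];
    rewrite yx eqxx in xy.
move: (level y) (level x) yE xE hn hn' => h h' yE xE hn hn'.
have xyE : leaf h /\ h = h'.
  (* Unless [x] and [y] are the two leaves of one end, the leaves to delete can
     be chosen different from both. *)
  pose c := if h' == 0 then ~~ b' else ~~ b.
  pose d := if h' == n then ~~ b' else ~~ b.
  have := noty c d; rewrite yE xE !keepE // /c /d /leaf.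
  move=> {hd noty xy cw xs x0 yE xE c d y x s}.
  case: (h' =P 0) => E0; case: (h' =P n) => E1; case: (h =P 0) => E2;
    case: (h =P n) => E3; try lia; case: b; case: b' => //= H;
    by have := H isT.
case: xyE => hl hE; subst h'.
have bE : b' = ~~ b.
  by move: xy; rewrite yE xE vertex_leaf //; case: b b' {yE xE} => [] [].
exists b, h; rewrite -yE -bE -xE.
case: s cw xs x0 hd noty => [|z s] cw xs x0 hd noty.
  by rewrite inE (negPf xy) in xs.
exists s; split=> //; congr (_ :: _); apply/eqP; apply: contraT => zx.
have [bz zE] := vertex_level z; have hz := level_le z.
move: (level z) zE hz => hz zE zn.
have kE c d : keep c d x -> ~~ keep c d z.
  move=> kx; have ny := noty c d kx; have [s'] := hd c d kx.
  by rewrite !filter_cons (negPf ny); case: ifP => // _ [zxE];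
    rewrite zxE eqxx in zx.
have ez : e y z.
  (* Deleting [x] and keeping [y] and [z] makes [y] and [z] consecutive in a
     walk. *)
  pose c := if h == 0 then ~~ b else ~~ bz.
  pose d := if h == n then ~~ b else ~~ bz.
  have ky : keep c d y.
    rewrite yE keepE // /c /d.
    by case: (h =P 0); case: (h =P n); case: b {yE xE bE noty kE hd c d}; lia.
  have kz : keep c d z.
    move: zx; rewrite zE xE keepE // bE /c /d.
    have [->|hh] := eqVneq hz h; first by rewrite vertex_leaf //;
      case: b bz {yE xE bE noty kE hd c d ky zE} => [] []; case: (h =P 0);
      case: (h =P n); lia.
    move: hl; rewrite /leaf; case: (h =P 0); case: (h =P n);
      case: bz {zE c d ky}; lia.
  by have := cw c d; rewrite !filter_cons ky kz /= => /andP[].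
(* Deleting [y] instead makes [z], which is not a leaf of this end, the first
   letter of a walk that contains [x]. *)
have kx : keep (if h == 0 then b else ~~ b) (if h == n then b else ~~ b) x.
  rewrite xE keepE // bE.
  by case: (h =P 0); case: (h =P n); case: b {yE xE bE noty kE hd}; lia.
have := kE _ _ kx; rewrite zE keepE //.
by move: ez hl; rewrite edge_level yE zE !level_vertex // /leaf; lia.
Qed.

Lemma closed_walks_rot m r : closed_walks r -> closed_walks (rot m r).
Proof.
move=> H c d; rewrite /rot filter_cat; have := H c d.
rewrite -{1}[r](cat_take_drop m) filter_cat.
set A := filter _ (take m r); set B := filter _ (drop m r).
by rewrite -(rot_cycle (size A)) rot_size_cat.
Qed.

Lemma path_seg m b a : a + m < n -> path e (vertex b a) (seg a.+1 m).
Proof.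
elim: m b a => //= m IH b a am; rewrite edge_vertex; last by lia.
by apply: IH; lia.
Qed.

Lemma keep_mids c d : filter (keep c d) mids = mids.
Proof.
apply/all_filterP/allP => x /mids_mid xm; have [b ->] := vertex_level x.
by rewrite keepE ?level_le //; lia.
Qed.

Lemma closed_walks_zigzag_base c d :
  cycle e (vertex c 0 :: mids ++ vertex d n :: rev mids).
Proof.
have P : path e (vertex c 0) (rcons mids (vertex d n)).
  have -> : path e (vertex c 0) (rcons mids (vertex d n)) =
    path e (vertex c 0) (seg 1 n.-1) &&
      e (last (vertex c 0) mids) (vertex d n) by rewrite rcons_path.
  rewrite path_seg; last by lia.
  have -> : last (vertex c 0) mids = vertex true n.-1.
    rewrite /mids /seg; have -> : n.-1 = n.-2.+1 by lia.
    by rewrite -[n.-2.+1]addn1 iotaD map_cat last_cat /= addnC.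
  by have := @edge_vertex true d n.-1; rewrite prednK; [apply; lia|lia].
have R := P; rewrite -(rev_path) in R.
rewrite last_rcons belast_rcons rev_cons in R.
rewrite (eq_path (e' := e)) in R; last by move=> x y; rewrite /= affD_edge_sym.
by rewrite /cycle rcons_cat rcons_cons -cat_rcons cat_path last_rcons P.
Qed.

Lemma closed_walks_leaves c0 d0 c d :
  filter (keep c d) ([:: vertex c0 0; vertex (~~ c0) 0] ++ mids ++
    [:: vertex d0 n; vertex (~~ d0) n] ++ rev mids) =
  vertex (~~ c) 0 :: mids ++ vertex (~~ d) n :: rev mids.
Proof.
rewrite !filter_cat filter_rev keep_mids.
have -> : filter (keep c d) [:: vertex c0 0;
  vertex (~~ c0) 0] = [:: vertex (~~ c) 0].
  have n0 : (0 == n) = false by lia.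
  rewrite !filter_cons !keepE // n0 eqxx /=.
  by case: c c0 => [] [].
have -> : filter (keep c d) [:: vertex d0 n;
  vertex (~~ d0) n] = [:: vertex (~~ d) n].
  have n0 : (n == 0) = false by lia.
  rewrite !filter_cons !keepE // n0 eqxx /=.
  by case: d d0 => [] [].
by [].
Qed.

Lemma zigzags_closed_walks r : r \in zigzags -> closed_walks r.
Proof.
case/mem_zigzagsP => [->|->|[m _ ->]].
- rewrite twist0E; apply: closed_walks_rot => c d.
  by rewrite (closed_walks_leaves false true) closed_walks_zigzag_base.
- rewrite twistnE; apply: closed_walks_rot => c d.
  by rewrite (closed_walks_leaves true false) closed_walks_zigzag_base.
apply: closed_walks_rot => c d.
by rewrite (closed_walks_leaves true true) closed_walks_zigzag_base.
Qed.

Lemma mem_rot_zigzag m : rot m zigzag \in zigzags.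
Proof.
rewrite mem_cat; apply/orP; right.
have [mn|mn] := ltnP m n.+1.*2; first by apply/mapP; exists m; rewrite ?mem_iota.
by apply/mapP; exists 0; rewrite ?mem_iota ?rot0 ?rot_oversize ?size_zigzag.
Qed.

Lemma rot1_zigzag m : rot 1 (rot m zigzag) \in zigzags.
Proof.
have [mn|mn] := ltnP m (size zigzag); first by rewrite -rotS //;
  apply: mem_rot_zigzag.
by rewrite [rot m _]rot_oversize //; apply: mem_rot_zigzag.
Qed.

Lemma zigzag_leaf0 : zigzag = [::] ++ [:: vertex true 0; vertex false 0] ++
  (mids ++ [:: vertex true n; vertex false n] ++ rev mids).
Proof. by []. Qed.

Lemma zigzag_leafn : zigzag = ([:: vertex true 0; vertex false 0] ++ mids) ++
  [:: vertex true n; vertex false n] ++ rev mids.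
Proof. by rewrite /zigzag -!catA. Qed.

Lemma cat_eq_cat A B C D : A ++ B = C ++ D ->
  (exists E, C = A ++ E /\ B = E ++ D) \/ (exists E, A = C ++ E /\ D = E ++ B).
Proof.
elim: A C => [|a A IH] [|c C] /= E.
- by left; exists [::].
- by left; exists (c :: C).
- by right; exists (a :: A).
case: E => <- /IH[[E [-> ->]]|[E [-> ->]]]; [left|right]; by exists E.
Qed.

(** The three cases are a cut in [P], between [u] and [u'], and in [Q]. *)
Lemma rot_pair (u u' : I) P Q m :
  [\/ exists P1 P2, P = P1 ++ P2 /\ rot m (P ++ [:: u; u'] ++ Q) = P2 ++ [:: u;
    u'] ++ Q ++ P1,
      rot m (P ++ [:: u; u'] ++ Q) = u' :: Q ++ P ++ [:: u]
    | exists Q1 Q2, Q = Q1 ++ Q2 /\ rot m (P ++ [:: u;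
      u'] ++ Q) = Q2 ++ P ++ [:: u; u'] ++ Q1].
Proof.
set z := P ++ _; have zE : take m z ++ drop m z = P ++ [:: u;
  u'] ++ Q by rewrite cat_take_drop.
rewrite /rot; case/cat_eq_cat: zE => [[E [PE ->]]|[E [-> ]]].
  by constructor 1; exists (take m z), E; split=> //; rewrite -!catA.
case: E => [|a [|b E]] /=.
- move=> <-; rewrite cats0; constructor 1; exists P, [::]; by rewrite cats0.
- by case=> -> <-; constructor 2.
case=> -> -> QE; constructor 3; exists E, (drop m z); split=> //.
Qed.

Lemma nb_absent x r s : x \notin r -> nb x 0 (r ++ s) = count (e x) r + nb x 0 s.
Proof. by move=> /count_memPn c0; rewrite nb_catr c0 // subn0. Qed.

Lemma nb_head x r : nb x 0 (x :: r) = 0.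
Proof. by rewrite nb_cons ?eqxx //; apply: affD_edge_irr. Qed.

(** The letters [u] and [u'] have the same neighbours, so that the numbers of
neighbours before them differ only if the cut separates them. *)
Lemma nb_rot_pair (u u' : I) P Q m : level u = level u' -> u != u' ->
  u \notin P -> u' \notin P -> u \notin Q -> u' \notin Q ->
  let r := rot m (P ++ [:: u; u'] ++ Q) in
  nb u 0 r = nb u' 0 r \/ nb u' 0 r = 0 /\ nb u 0 r = count (e u) (P ++ Q).
Proof.
move=> luu uu uP uP' uQ uQ' /=.
have eE : e u =1 e u' by move=> x; rewrite !edge_level luu.
have euu : e u' u = false by rewrite edge_level luu; lia.
have pair R S : u \notin R -> u' \notin R ->
    nb u 0 (R ++ [:: u; u'] ++ S) = nb u' 0 (R ++ [:: u; u'] ++ S).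
  move=> uR uR'; rewrite (nb_absent _ uR) (nb_absent _ uR') (eq_count eE) nb_head.
  by rewrite cat_cons nb_cons ?(negPf uu) ?euu ?nb_head //; apply: affD_edge_irr.
case: (rot_pair u u' P Q m) => [[P1 [P2 [PE ->]]]| -> |[Q1 [Q2 [QE ->]]]].
- by left; apply: pair; [move: uP|move: uP']; rewrite PE mem_cat negb_or => /andP[].
- right; rewrite nb_head; split=> //.
  have eu : e u u' = false by rewrite eE affD_edge_irr.
  rewrite nb_cons 1?eq_sym ?(negPf uu); last exact: affD_edge_irr.
  rewrite catA nb_absent ?nb_head ?mem_cat ?negb_or ?uQ //.
  by rewrite eu !count_cat add0n addn0 addnC.
left; rewrite catA; apply: pair; rewrite mem_cat negb_or ?uP ?uP' ?andbT.
  by move: uQ; rewrite QE mem_cat negb_or => /andP[].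
by move: uQ'; rewrite QE mem_cat negb_or => /andP[].
Qed.

Lemma leaf_notin b h r : leaf h -> level_count h r = 0 -> vertex b h \notin r.
Proof.
move=> hl; rewrite level_count_leaf // => c0; apply/count_memPn.
by case: b; lia.
Qed.

Lemma nb_rot_leaf0 c m Q : level_count 0 Q = 0 -> level_count 1 Q = 2 ->
  let r := rot m ([:: vertex c 0; vertex (~~ c) 0] ++ Q) in
  nb (vertex c 0) 0 r = nb (vertex (~~ c) 0) 0 r \/
  nb (vertex (~~ c) 0) 0 r = 0 /\ nb (vertex c 0) 0 r = 2.
Proof.
move=> Q0 Q1; have := @nb_rot_pair (vertex c 0) (vertex (~~ c) 0) [::] Q m.
rewrite count_edge0 Q1; apply => //; try exact: leaf_notin.
by rewrite vertex_leaf //; case: c.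
Qed.

Lemma nb_rot_leafn c m P Q : level_count n (P ++ Q) =
    0 -> level_count n.-1 (P ++ Q) = 2 ->
  let r := rot m (P ++ [:: vertex c n; vertex (~~ c) n] ++ Q) in
  nb (vertex c n) 0 r = nb (vertex (~~ c) n) 0 r \/
  nb (vertex (~~ c) n) 0 r = 0 /\ nb (vertex c n) 0 r = 2.
Proof.
rewrite level_count_cat => PQ0 PQ1; have := @nb_rot_pair (vertex c n) (vertex (~~
  c) n) P Q m.
rewrite count_edgen PQ1; apply => //; try (apply: leaf_notin; [exact: nleaf|lia]).
  by rewrite !level_vertex.
by rewrite vertex_leaf ?nleaf //; case: c.
Qed.

Lemma nb_twist0 b : nb (vertex b 0) 0 twist0 = if b then 0 else 2.
Proof.
case: b; first exact: nb_head.
have -> : twist0 = (vertex true 0 :: mids ++ [:: vertex true n;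
  vertex false n] ++ rev mids) ++
    [:: vertex false 0] by rewrite /twist0 /= -!catA.
have ne c : (vertex false 0 == vertex c n) =
  false by apply/negbTE/vertex_neq => //; lia.
rewrite nb_absent ?nb_head; last first.
  rewrite in_cons !mem_cat mem_rev (negPf (leaf_mids false (erefl : leaf 0))).
  by rewrite !in_cons in_nil vertex_leaf // !ne.
rewrite addn0 count_edge0 -cat1s !level_count_cat level_count_rev
  level_count_mids /level_count /= !level_vertex //; lia.
Qed.

Lemma nb_twistn b : nb (vertex b n) 0 twistn = if b then 0 else 2.
Proof.
case: b; first exact: nb_head.
have -> : twistn = (vertex true n :: rev mids ++ [:: vertex true 0;
  vertex false 0] ++ mids) ++
    [:: vertex false n] by rewrite /twistn /= -!catA.
have ne c : (vertex false n == vertex c 0) =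
  false by apply/negbTE/vertex_neq => //; lia.
rewrite nb_absent ?nb_head; last first.
  rewrite in_cons !mem_cat mem_rev (negPf (leaf_mids false nleaf)).
  by rewrite !in_cons in_nil vertex_leaf ?nleaf // !ne.
rewrite addn0 count_edgen -cat1s !level_count_cat level_count_rev
  level_count_mids /level_count /= !level_vertex //; lia.
Qed.

(** If [x] is the first letter, the result is a rotation. If [x] is the second of
two leaves at the start, the result is one of the twisted words. *)
Lemma zigzags_rot r x : r \in zigzags -> x \in r -> nb x 0 r = 0 ->
  exists2 s, s \in zigzags & teq (rcons (rem x r) x) s.
Proof.
move=> rz xr x0; have cw := zigzags_closed_walks rz.
have rot_head y s : r = y :: s -> x = y -> rcons (rem x r) x = rot 1 r.
  by move=> -> ->; rewrite /= eqxx rot1_cons.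
case/mem_zigzagsP: (rz) => [rE|rE|[m _ rE]].
- rewrite rE /twist0 in xr x0 cw; case: (closed_walks_min cw xr x0) => [xE|].
    exists (rot 2 zigzag); first exact: mem_rot_zigzag.
    rewrite (rot_head _ _ rE xE) rE /twist0 /= rot1_cons.
    rewrite (@rot_split 2 [:: vertex true 0; vertex false 0] (mids ++
      [:: vertex true n; vertex false n] ++ rev mids)) // -cats1.
    have := teq_swap_leaf (mids ++ [:: vertex true n;
      vertex false n] ++ rev mids) [::]
      (erefl : leaf 0).
    by move/teq_sym; rewrite /= -!catA /= -!catA.
  case=> b [h [s' [hl _ -> /(congr1 (head x))]]].
  rewrite /mids /seg; have -> : n.-1 = n.-2.+1 by lia.
  move=> /= /(congr1 (@level)); rewrite !level_vertex; move: hl; rewrite /leaf; lia.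
- rewrite rE /twistn in xr x0 cw; case: (closed_walks_min cw xr x0) => [xE|].
    exists (rot (n + 3) zigzag); first exact: mem_rot_zigzag.
    rewrite (rot_head _ _ rE xE) rE /twistn /= rot1_cons.
    rewrite (@rot_split (n + 3) ([:: vertex true 0; vertex false 0] ++ mids ++
      [:: vertex true n; vertex false n]) (rev mids)) ?/zigzag -?catA //;
        last first.
      by rewrite !size_cat size_mids /=; lia.
    rewrite -cats1.
    have := teq_swap_leaf (rev mids ++ [:: vertex true 0;
      vertex false 0] ++ mids) [::] nleaf.
    by move/teq_sym; rewrite /= -!catA /= -!catA.
  case=> b [h [s' [hl _ -> /(congr1 (head x))]]].
  rewrite /mids /seg; have -> : n.-1 = n.-2.+1 by lia.
  rewrite -[n.-2.+1]addn1 iotaD map_cat rev_cat /= => /(congr1 (@level)).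
  rewrite !level_vertex; move: hl; rewrite /leaf; lia.
case E: r (xr) (x0) (cw) => [|y s] // xr' x0' cw'.
case: (closed_walks_min cw' xr' x0') => [xE|].
  exists (rot 1 r); first by rewrite rE rot1_zigzag.
  by rewrite -E (rot_head _ _ E xE); apply: teq_refl.
case=> b [h [s' [hl yE xE sE]]]; subst s.
have xy : x != y by rewrite xE yE vertex_leaf //; case: b {yE xE}.
have -> : rcons (rem x [:: y, x & s']) x = rot 1 [:: x, y & s'].
  by rewrite /= eq_sym (negPf xy) eqxx rot1_cons.
have key u u' P Q : zigzag = P ++ [:: u; u'] ++ Q -> Q ++ P != [::] ->
    (forall c, vertex c h \notin Q ++ P) -> [/\ y = u, x = u' & s' = Q ++ P].
  move=> zE QP0 abs; have yQP : y \notin Q ++ P by rewrite yE.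
  have xQP : x \notin Q ++ P by rewrite xE.
  have := rot_pair u u' P Q m; rewrite -zE -rE E.
  case=> [[P1 [P2 [PE]]]|[yE']|[Q1 [Q2 [QE]]]].
  - case: P2 PE => [|p P2] PE [yE' xs]; last first.
      by move: yQP; rewrite PE !mem_cat inE yE' eqxx !orbT.
    by move: PE xs; rewrite cats0 => -> [-> ->].
  - move=> xs; have QPn : Q ++ P = [::].
      case: (Q ++ P) (catA Q P [:: u]) xs xQP => [|q QP] // -> [->].
      by rewrite inE eqxx.
    by rewrite QPn in QP0.
  case: Q2 QE => [|q Q2]; last first.
    by move=> QE [yE' _]; move: yQP; rewrite QE !mem_cat inE yE' eqxx !orbT.
  rewrite cats0 => <-; case: P {zE QP0 abs xQP} yQP => [|p P] yQP [].
    by move=> -> -> ->; rewrite cats0.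
  by move=> yE'; move: yQP; rewrite mem_cat inE yE' eqxx orbT.
have hn : h <= n by move: hl; rewrite /leaf; lia.
case/orP: (hl) => /eqP hE; subst h.
  have [|c|-> -> ->] := key _ _ _ _ zigzag_leaf0.
  - by rewrite cats0 -size_eq0 !size_cat /=; lia.
  - by rewrite cats0; apply: leaf_notin; rewrite // !level_count_cat
    level_count_rev !level_count_mids /level_count /= !level_vertex //; lia.
  exists twist0; first by rewrite mem_cat mem_head.
  by rewrite rot1_cons /twist0 cats0 rcons_cons -cats1 -!catA; apply: teq_refl.
have [|c|-> -> ->] := key _ _ _ _ zigzag_leafn.
- by rewrite -size_eq0 !size_cat /=; lia.
- by apply: leaf_notin; rewrite // !level_count_cat level_count_rev
  !level_count_mids /level_count /= ?level_vertex //; lia.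
exists twistn; first by rewrite mem_cat !inE eqxx orbT.
by rewrite rot1_cons /twistn rcons_cons -cats1 -!catA; apply: teq_refl.
Qed.

(** * Classification of the words in phase *)

Definition zigzag_class k r := exists2 s, s \in zigzags & teq r (word_pow k s).

Lemma word_pow_comm k (r : seq I) : word_pow k r ++ r = r ++ word_pow k r.
Proof. by elim: k => [|k IH] /=; rewrite ?cats0 // -catA IH. Qed.

Lemma full_mem k r x : 0 < k -> full k r -> x \in r.
Proof.
move=> k0 F; have [b ->] := vertex_level x;
  rewrite -has_pred1 has_count F.2 ?level_le //.
by rewrite /letter_mult; case: ifP; lia.
Qed.

(** Write the period as [x] followed by [s']. Cancelling the first [x] and adding
[x] at the end turns the power of this period into a power of [rcons s' x]. *)
Lemma zigzag_class_rot1 k x r : 0 < k ->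
  zigzag_class k (x :: r) -> zigzag_class k (rcons r x).
Proof.
move=> k0 [s sz rs]; have F := zigzags_full sz; have xs := full_mem x (ltn0Sn 0) F.
have x0 : nb x 0 s = 0.
  have [b xE] := vertex_level x; rewrite xE -(nb_word_pow_full b k0 F) ?level_le
    // -xE.
  rewrite -(teq_nb rs) ?nb_head //=; first by rewrite eqxx.
have [s' sz' ss'] := zigzags_rot sz xs x0; exists s' => //.
apply: teq_trans (teq_word_pow k ss').
have := teq_trans rs (teq_word_pow k (teq_front (@affD_edge_sym n) xs x0)).
case: k k0 {F rs} => // k _ rs.
have {}rs : teq r (rem x s ++ word_pow k (x :: rem x s)).
  by apply: (@teq_catIl _ _ [:: x]).
rewrite -cats1; apply: teq_trans (teq_catr [:: x] rs) _.
by rewrite -word_pow_rot1 -catA cats1 word_pow_comm; apply: teq_refl.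
Qed.

Lemma zigzag_class_rot k m r : 0 < k -> zigzag_class k r ->
    zigzag_class k (rot m r).
Proof.
move=> k0 zr; have [mr|mr] := ltnP m (size r); last by rewrite rot_oversize.
elim: m mr => [|m IH] mr; first by rewrite rot0.
rewrite rotS 1?ltnW //; case: (rot m r) (IH (ltnW mr)) => [|x s] //.
by rewrite rot1_cons; apply: zigzag_class_rot1.
Qed.

Lemma zigzag_class_rotV k m r : 0 < k -> zigzag_class k (rot m r) ->
    zigzag_class k r.
Proof.
by move=> k0 /(zigzag_class_rot (size r - m) k0);
  rewrite -{1}(size_rot m r) -/(rotr _ _) rotK.
Qed.

Lemma leaf0 : leaf 0. Proof. by []. Qed.

Lemma full_inphase k r : 0 < k -> full k r -> (forall b, nb (vertex b 0) 0 r = 0) ->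
  zigzag_class k r.
Proof.
move=> k0 F r0; exists zigzag; first by rewrite -[zigzag]rot0 mem_rot_zigzag.
have z0 b : nb (vertex b 0) 0 (word_pow k zigzag) = 0.
  rewrite (nb_word_pow_full b k0 zigzag_full) //; case: b; first exact: nb_head.
  by rewrite nb_cons ?vertex_leaf ?edge_level ?level_vertex ?nb_head //;
    apply: affD_edge_irr.
have Fz := full_word_pow k zigzag_full.
apply: (full_teq F Fz) => [b h /orP[]/eqP->|h l h0 hn lk].
- by rewrite r0 z0.
- by rewrite (inphase_leafn F k0 r0) (inphase_leafn Fz k0 z0).
by rewrite (inphase_upper F k0 r0) ?(inphase_upper Fz k0 z0) //; lia.
Qed.

Lemma nb_le_count x l r : nb x l r <= count (e x) r.
Proof.
elim: r l => [|y r IH] l //.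
rewrite nb_cons; last exact: affD_edge_irr.
rewrite /=; case: ifP => _; last by rewrite leq_add2l.
by case: l => // l; apply: leq_trans (IH l) (leq_addl _ _).
Qed.

(** Cutting after the first letter of level 1 brings both left leaves one step
closer to the start. *)
Lemma rot_leaf0 k r : 0 < k -> full k r -> (forall b, 0 < nb (vertex b 0) 0 r) ->
  exists m, forall b, nb (vertex b 0) 0 (rot m r) = (nb (vertex b 0) 0 r).-1.
Proof.
move=> k0 F r0; have s1 : 0 < count_mem (vertex true 1) r by rewrite (full_mid
  F); lia.
have [B rE] := pre_split s1; have cA := count_pre s1.
move: (pre _ 0 r) rE cA => A rE cA.
have A1 : level_count 1 A = 0 by rewrite -(level_count_mid true) //; lia.
exists (size A).+1 => b.
have TA : count_mem (vertex b 0) A = 0.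
  have [//|tA] := posnP (count_mem (vertex b 0) A); have := r0 b.
  by rewrite rE nb_catl //; have := nb_le_count (vertex b 0) 0 A;
    rewrite count_edge0; lia.
have ne : (vertex true 1 == vertex b 0) = false by apply/negbTE/vertex_neq; lia.
have TB : 0 < count_mem (vertex b 0) B.
  have := full_leaf F b leaf0; rewrite rE count_cat TA /= ne; lia.
rewrite (@rot_split _ (rcons A (vertex true 1)) B) ?size_rcons // ?cat_rcons //.
rewrite nb_catl // rE nb_catr TA // subn0 count_edge0 A1 nb_cons ?ne;
  last exact: affD_edge_irr.
by rewrite edge_level !level_vertex //; lia.
Qed.

(** The numbers of letters of level 1 before the left leaves are at most 2 and have
the same parity. In each case some rotation has both leaves at the start,
where [inphase_upper] leaves only the power of [zigzag]; the given word is a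
rotation of that one, and [zigzag_class_rot1] applies. *)
Lemma full_zigzag k r : 0 < k -> full k r ->
  ~~ odd (nb (vertex true 0) 0 r + nb (vertex false 0) 0 r) -> zigzag_class k r.
Proof.
move=> k0 F ph.
have step s : full k s -> (forall b, nb (vertex b 0) 0 s = 1) -> zigzag_class k s.
  move=> Fs s1; have [|m mE] := rot_leaf0 k0 Fs; first by move=> b; rewrite s1.
  apply: (@zigzag_class_rotV k m) => //; apply: full_inphase => // [|b].
    exact: full_rot.
  by rewrite mE s1.
have K2 b := full_nb0 F k0 b (leq0n n).
have : [\/ forall b, nb (vertex b 0) 0 r = 0, forall b, nb (vertex b 0) 0 r = 1,
   forall b, nb (vertex b 0) 0 r = 2 | exists b, nb (vertex b 0) 0 r = 0 /\
     nb (vertex (~~ b) 0) 0 r = 2].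
  have := K2 true; have := K2 false; move: ph.
  case Et: (nb (vertex true 0) 0 r) => [|[|[|t]]];
    case Ef: (nb (vertex false 0) 0 r) => [|[|[|f]]] //= _ _ _.
  - by constructor 1 => -[].
  - by constructor 4; exists true.
  - by constructor 2 => -[].
  - by constructor 4; exists false.
  by constructor 3 => -[].
case=> [r0|r1|r2|[b [r0 r2]]].
- exact: full_inphase.
- exact: step.
- have [|m mE] := rot_leaf0 k0 F; first by move=> b; rewrite r2.
  apply: (@zigzag_class_rotV k m) => //; apply: step => // [|b].
    exact: full_rot.
  by rewrite mE r2.
(* The last occurrence of the late leaf comes after all letters of level 1, so a
   cut just before it leaves both leaves at the start. *)
pose x := vertex (~~ b) 0; have cx : count_mem x r = k by rewrite (full_leaf F).
have lt : k.-1 < count_mem x r by lia.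
have [B rE] := pre_split lt; have cA := count_pre lt.
have nA : nb x k.-1 r = 2 + k.-1.*2.
  by rewrite (full_nb F) ?r2 //; rewrite /letter_mult /=; lia.
rewrite /nb count_edge0 in nA.
move: (pre _ _ r) rE cA nA => A rE cA nA.
have B1 : level_count 1 B = 0.
  have := full_level_count F (h := 1) (ltnW n2); rewrite rE level_count_cat nA.
  by rewrite [level_count 1 (x :: B)]/(level_count 1 B) -/(level_count 1 B); lia.
apply: (@zigzag_class_rotV k (size A)) => //.
apply: full_inphase => // [|b']; first exact: full_rot.
rewrite (@rot_split _ A (x :: B)) //.
have [->|bb] := eqVneq b' (~~ b); first by rewrite cat_cons nb_head.
have {bb}-> : b' = b by case: b' b bb {r0 r2 x cx lt rE cA nA} => [] [].
have [bB|bB] := posnP (count_mem (vertex b 0) (x :: B)).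
  rewrite nb_catr bB // subn0 count_edge0 [level_count 1 (x :: B)]/(level_count 1
    B) -/(level_count 1 B) B1.
  have bA : 0 < count_mem (vertex b 0) A.
    by have := full_leaf F b leaf0; rewrite rE count_cat bB; lia.
  by move: r0; rewrite rE nb_catl.
rewrite nb_catl //; apply/eqP; rewrite -leqn0;
  apply: leq_trans (nb_le_count _ _ _) _.
by rewrite count_edge0 [level_count 1 (x :: B)]/(level_count 1 B) -/(level_count
  1 B) B1.
Qed.

(** * The list of periods *)

Lemma teq_word_powI k r s : 0 < k -> teq (word_pow k r) (word_pow k s) -> teq r s.
Proof.
move=> k0 rs i j ij; have := rs i j ij.
have fw t : filter (pred2 i j) (word_pow k t) = word_pow k (filter (pred2 i j) t).
  by rewrite /word_pow filter_flatten map_nseq.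
rewrite !fw; move: (filter _ r) (filter _ s) => {ij fw rs r} r {}s E.
have sw (t : seq I) : size (word_pow k t) = k * size t.
  by rewrite -[size (word_pow _ _)]count_predT -[size t]count_predT count_word_pow.
have sz : size r = size s.
  by have := congr1 size E; rewrite !sw => /eqP; rewrite eqn_pmul2l // => /eqP.
case: k k0 E {sw} => // k _ /= /eqP; rewrite eqseq_cat // => /andP[/eqP->] //.
Qed.

Lemma teq_full_nb k r s b h : 0 < k -> teq r s -> full k r -> h <= n ->
  nb (vertex b h) 0 r = nb (vertex b h) 0 s.
Proof.
move=> k0 rs F hn; apply: teq_nb rs _; rewrite F.2 // /letter_mult; case: ifP; lia.
Qed.

(** Project to an edge from a letter [x] that does not occur in [B] to a letter [y].
The first [x] stands at the same place on both sides, so [y] does not occur in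
[B] either. As the diagram is connected, [B] has no letters. *)
Lemma teq_exchange_absent A B : full 1 (B ++ A) -> teq (B ++ A) (A ++ B) ->
  vertex true 0 \notin B -> B = [::].
Proof.
move=> F BA TB.
have inA x : x \notin B -> x \in A.
  by have := full_mem x (ltn0Sn 0) F; rewrite mem_cat => /orP[->|].
have core x y : e x y -> x \notin B -> y \notin B.
  move=> xy xB; have xA := inA x xB.
  have := BA x y; rewrite xy orbT !filter_cat => /(_ isT)/(congr1 (index x)).
  rewrite !index_cat !mem_filter /= eqxx (negPf xB) xA /= => E.
  move/eqP: E; rewrite -[X in _ == X]add0n eqn_add2r size_filter.
  rewrite -leqn0 leqNgt -has_count; apply: contra => yB.
  by apply/hasP; exists y; rewrite //= eqxx orbT.
have lvB h : h <= n -> forall b, vertex b h \notin B.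
  elim: h => [|h IH] hn b; last first.
    by apply: core (IH (ltnW hn) true); apply: edge_vertex.
  have S1 : vertex true 1 \notin B by apply: core TB; apply: edge_vertex; lia.
  by apply: core S1; rewrite affD_edge_sym; apply: edge_vertex; lia.
case: B TB lvB {F BA inA core} => // x B _ lvB; have [b xE] := vertex_level x.
by have := lvB _ (level_le x) b; rewrite -xE mem_head.
Qed.

Lemma teq_exchange A B : full 1 (B ++ A) -> teq (B ++ A) (A ++ B) ->
  A = [::] \/ B = [::].
Proof.
move=> F BA; have := full_leaf F true leaf0; rewrite count_cat => c1.
have [TB|TB] := boolP (vertex true 0 \in B); [left|right];
  last exact: teq_exchange_absent F BA TB.
have F' := full_eq_teq BA F; apply: teq_exchange_absent F' (teq_sym BA) _.
by move: TB; rewrite -!has_pred1 !has_count; lia.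
Qed.

Lemma rot_zigzag_inj m m' : m < n.+1.*2 -> m' < n.+1.*2 ->
  teq (rot m zigzag) (rot m' zigzag) -> m = m'.
Proof.
wlog mm : m m' / m <= m'.
  move=> H mn mn' E; have [mm|mm] := leqP m m'; first exact: H.
  by apply/esym/H => //; [exact: ltnW|exact: teq_sym].
move=> mn mn'; have F := full_rot m zigzag_full.
have sw : size (rot m zigzag) = n.+1.*2 by rewrite size_rot size_zigzag.
have -> : rot m' zigzag = rot (m' - m) (rot m zigzag).
  by rewrite -rotD ?subnK // size_zigzag ltnW.
move: (rot m zigzag) F sw => w F sw.
rewrite /rot -{1}(cat_take_drop (m' - m) w) => E.
rewrite -(cat_take_drop (m' - m) w) in F;
  case: (teq_exchange F E) => /(congr1 size).
  by rewrite size_drop /= sw; lia.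
by rewrite size_take sw /=; case: ifP; lia.
Qed.

Lemma nb_mids_leaf0 c d (P := mids ++ [:: vertex c n; vertex d n] ++ rev mids) m :
  let r := rot m ([:: vertex true 0; vertex false 0] ++ P) in
  nb (vertex true 0) 0 r = nb (vertex false 0) 0 r \/
  nb (vertex false 0) 0 r = 0 /\ nb (vertex true 0) 0 r = 2.
Proof.
by apply: (nb_rot_leaf0 true); rewrite !level_count_cat level_count_rev
  level_count_mids /level_count /= !level_vertex //; lia.
Qed.

Lemma nb_rot_zigzag_leafn m : let r := rot m zigzag in
  nb (vertex true n) 0 r = nb (vertex false n) 0 r \/
  nb (vertex false n) 0 r = 0 /\ nb (vertex true n) 0 r = 2.
Proof.
rewrite zigzag_leafn; apply: (nb_rot_leafn true);
  rewrite !level_count_cat level_count_rev level_count_mids /level_count /=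
    ?level_vertex //; lia.
Qed.

Lemma twist0_full : full 1 twist0.
Proof. by apply: zigzags_full; rewrite mem_cat mem_head. Qed.

Lemma twistn_full : full 1 twistn.
Proof. by apply: zigzags_full; rewrite mem_cat !inE eqxx orbT. Qed.

Lemma twist0_rot m : ~ teq twist0 (rot m zigzag).
Proof.
move=> E; have nbE b := teq_full_nb b (ltn0Sn 0) E twist0_full (leq0n n).
have := nb_mids_leaf0 true false m; have := nbE true; have := nbE false.
by rewrite !nb_twist0 /= -/zigzag => <- <-; lia.
Qed.

Lemma twistn_rot m : ~ teq twistn (rot m zigzag).
Proof.
move=> E; have nbE b := teq_full_nb b (ltn0Sn 0) E twistn_full (leqnn n).
have := nb_rot_zigzag_leafn m; have := nbE true; have := nbE false.
by rewrite !nb_twistn /= => <- <-; lia.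
Qed.

Lemma twist0_twistn : ~ teq twist0 twistn.
Proof.
move=> E; have nbE b := teq_full_nb b (ltn0Sn 0) E twist0_full (leq0n n).
have := nb_mids_leaf0 false true n.+2; have := nbE true; have := nbE false.
by rewrite !nb_twist0 /= -/zigzagn -twistnE => <- <-; lia.
Qed.

Lemma zigzags_inj : {in zigzags &, forall r s, teq r s -> r = s}.
Proof.
move=> r s /mem_zigzagsP[->|->|[m mn ->]] /mem_zigzagsP[->|->|[m' mn' ->]] // E.
- by case: twist0_twistn.
- by case: (twist0_rot E).
- by case: twist0_twistn; apply: teq_sym.
- by case: (twistn_rot E).
- by case: (twist0_rot (teq_sym E)).
- by case: (twistn_rot (teq_sym E)).
by rewrite (rot_zigzag_inj mn mn' E).
Qed.

Lemma uniq_zigzags : uniq zigzags.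
Proof.
rewrite cat_uniq; apply/and3P; split.
- rewrite /= inE andbT; apply/eqP => E; apply: twist0_twistn; rewrite E.
  exact: teq_refl.
- apply/hasPn => r /mapP[m _ ->]; rewrite !inE; apply/norP; split; apply/eqP => E.
    by apply: (@twist0_rot m); rewrite E; apply: teq_refl.
  by apply: (@twistn_rot m); rewrite E; apply: teq_refl.
rewrite map_inj_in_uniq ?iota_uniq // => m m'; rewrite !mem_iota => mn mn' E.
by apply: rot_zigzag_inj => //; rewrite E; apply: teq_refl.
Qed.

Lemma zigzags_even r : r \in zigzags ->
  ~~ odd (nb (vertex true 0) 0 r + nb (vertex false 0) 0 r).
Proof.
case/mem_zigzagsP => [->|->|[m mn ->]].
- by rewrite !nb_twist0.
- have := nb_mids_leaf0 false true n.+2; rewrite /= -/zigzagn -twistnE.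
  by move: (nb _ _ _) (nb _ _ _); lia.
have := nb_mids_leaf0 true false m; rewrite /= -/zigzag.
by move: (nb _ _ _) (nb _ _ _); lia.
Qed.

Definition alternatings : seq (seq I) :=
  [seq alternating p.1.1 p.1.2 (nth false p.2) |
     p : bool * bool * n.-tuple bool].

Definition periods := alternatings ++ zigzags.

Lemma size_periods : size periods = 2 ^ n.+2 + n.+2.*2.
Proof.
rewrite size_cat size_image !card_prod card_tuple !card_bool size_cat.
rewrite size_map size_iota [size [:: _; _]]/= !expnS; lia.
Qed.

Lemma alternatingsP r : reflect (exists a b (t : n.-tuple bool),
  r = alternating a b (nth false t)) (r \in alternatings).
Proof.
apply: (iffP mapP) => [[[[a b] t] _ ->]|[a [b [t ->]]]]; first by exists a, b, t.
by exists (a, b, t); rewrite ?mem_enum.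
Qed.

Lemma alternatings_odd r : r \in alternatings ->
  odd (nb (vertex true 0) 0 r + nb (vertex false 0) 0 r).
Proof.
case/alternatingsP=> a [b [t ->]]; rewrite !nb0_alternating.
by case: a; case: (nth _ _ _).
Qed.

Lemma periods_full r : r \in periods -> full 1 r.
Proof.
rewrite mem_cat => /orP[/alternatingsP[a [b [t ->]]]|]; last exact: zigzags_full.
exact: alternating_full.
Qed.

(** The parity of the phase difference of the left leaves tells the two kinds of
periods apart. *)
Lemma periods_inj : {in periods &, forall r s, teq r s -> r = s}.
Proof.
move=> r s rp sp E; have F := periods_full rp.
have nbE b := teq_full_nb b (ltn0Sn 0) E F (leq0n n).
move: rp sp; rewrite 2!(mem_cat _ alternatings) => /orP[ra|rz] /orP[sa|sz].
- case/alternatingsP: ra E => a [b [t ->]];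
  case/alternatingsP: sa => a' [b' [t' ->]] E.
  have := @alternating_inj 1 a b t a' b' t' isT; rewrite /word_pow /= !cats0.
  by move=> /(_ E)[-> -> ->].
- by have := alternatings_odd ra; rewrite !nbE (negPf (zigzags_even sz)).
- by have := alternatings_odd sa; rewrite -!nbE (negPf (zigzags_even rz)).
exact: zigzags_inj.
Qed.

Lemma uniq_periods : uniq periods.
Proof.
rewrite cat_uniq uniq_zigzags andbT; apply/andP; split; last first.
  by apply/hasPn => r /zigzags_even; apply: contra => /alternatings_odd.
rewrite map_inj_uniq ?enum_uniq // => -[[a b] t] [[a' b'] t'] /= E.
by apply: (@alternating_inj 1 a b t a' b' t' isT); rewrite E; apply: teq_refl.
Qed.

Lemma periods_complete k r : 0 < k -> full k r ->
  exists2 s, s \in periods & teq r (word_pow k s).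
Proof.
move=> k0 F; have [ph|ph] := boolP (odd (nb (vertex true 0) 0 r + nb (vertex
  false 0) 0 r)).
  have [a [b [t rE]]] := full_alternating k0 F ph.
  exists (alternating a b (nth false t)) => //.
  by rewrite mem_cat; apply/orP; left; apply/alternatingsP; exists a, b, t.
by have [s sz rs] := full_zigzag k0 F ph; exists s; rewrite // mem_cat sz orbT.
Qed.

(** * Words without repeated letters in affine type D *)

Fixpoint level_words j : seq (seq I) :=
  if j is j'.+1 then add_vertex (vertex true j.+1) (vertex true j) (level_words j')
  else add_vertex (vertex false 0) (vertex true 1) (add_vertex (vertex true 0)
    (vertex true 1)
    (add_vertex (vertex true 1) (vertex true 1) [:: [::]])).

Definition simple_words := add_vertex (vertex false n) (vertex true n.-1)
  (add_vertex (vertex true n) (vertex true n.-1) (level_words n.-2)).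

Lemma level_words_catalog j : j.+1 < n ->
  catalog e [pred x | level x <= j.+1] (level_words j).
Proof.
have sym := @affD_edge_sym n; have irr := affD_edge_irr.
elim: j => [|j IH] jn.
  have C1 : catalog e (predU1 (vertex true 1) pred0)
      (add_vertex (vertex true 1) (vertex true 1) [:: [::]]).
    by apply: catalog_add => //; apply: catalog_nil.
  have C2 : catalog e (predU1 (vertex true 0) (predU1 (vertex true 1) pred0))
      (add_vertex (vertex true 0) (vertex true 1)
        (add_vertex (vertex true 1) (vertex true 1) [:: [::]])).
    apply: catalog_add C1 _ _ => //; first by rewrite /= orbF;
      apply: vertex_neq => //; lia.
    move=> x /=; rewrite orbF => /eqP->; rewrite eqxx edge_vertex //; lia.
  have C3 : catalog e (predU1 (vertex false 0) (predU1 (vertex true 0) (predU1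
    (vertex true 1) pred0)))
      (level_words 0).
    apply: catalog_add C2 _ _ => //.
      by rewrite /= orbF; apply: vertex_neq => //; lia.
    move=> x /=; rewrite orbF => /orP[]/eqP->.
      rewrite edge_level !level_vertex //=; apply/esym/negbTE/vertex_neq => //; lia.
    by rewrite eqxx edge_vertex //; lia.
  apply: catalog_ext C3 => x /=; have [b ->] := vertex_level x; have := level_le x.
  move: (level x) => h hn; rewrite level_vertex // orbF.
  have [->|h0] := eqVneq h 0; first by rewrite !vertex_leaf //; case: b.
  have ne0 c : (vertex b h == vertex c 0) = false by apply/negbTE/vertex_neq.
  rewrite !ne0 /=; have [->|h1] := eqVneq h 1;
    first by rewrite (vertex_mid b true) ?eqxx.
  by rewrite (negPf (vertex_neq _ _ _ _ h1)) //; lia.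
have hm : 0 < j.+2 < n by lia.
have C : catalog e (predU1 (vertex true j.+2) [pred x | level x <= j.+1])
  (level_words j.+1).
  apply: catalog_add (IH (ltnW jn)) _ _ => //; first by rewrite /= level_vertex;
    lia.
  move=> x /= xj; rewrite eq_vertex_mid; last by lia.
  by rewrite edge_level level_vertex; lia.
by apply: catalog_ext C => x /=; rewrite eq_vertex_mid //; lia.
Qed.

Lemma simple_words_catalog : catalog e predT simple_words.
Proof.
have sym := @affD_edge_sym n; have irr := affD_edge_irr.
have jn : n.-2.+1 < n by lia.
have C := level_words_catalog jn; have nE : n.-2.+1 = n.-1 by lia.
have mid := mid_pred; rewrite nE in C.
have C1 : catalog e (predU1 (vertex true n) [pred x | level x <= n.-1])
    (add_vertex (vertex true n) (vertex true n.-1) (level_words n.-2)).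
  apply: catalog_add C _ _ => //; first by rewrite /= level_vertex //; lia.
  by move=> x /= xn; rewrite eq_vertex_mid // edge_level level_vertex //; lia.
have C2 : catalog e (predU1 (vertex false n) (predU1 (vertex true n) [pred x |
  level x <= n.-1]))
    simple_words.
  apply: catalog_add C1 _ _ => //.
    by rewrite /= negb_or vertex_leaf ?nleaf //= level_vertex //; lia.
  by move=> x /= /orP[/eqP->|xn]; rewrite eq_vertex_mid // edge_level
    !level_vertex //; lia.
apply: catalog_ext C2 => x /=; have [b ->] := vertex_level x; have := level_le x.
move: (level x) => h hn; rewrite level_vertex //.
have [->|h0] := eqVneq h n; first by rewrite !vertex_leaf ?nleaf //; case: b.
have ne0 c : (vertex b h == vertex c n) = false by apply/negbTE/vertex_neq.
by rewrite !ne0 /=; lia.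
Qed.

(** * Generating polynomials and the number of elements *)

Section Count.
Local Open Scope ring_scope.

(** A pair consists of the generating polynomial of the words on a part of the
diagram, and of that of the words which contain its last inner vertex. Either a
leaf is attached to this vertex, or, in [path_step], a new inner vertex, which
then takes over its role. *)
Definition leaf_step (gh : {poly int} * {poly int}) :=
  ((1 + 'X) * gh.1 + 'X * gh.2, (1 + 'X *+ 2) * gh.2).
Definition path_step (gh : {poly int} * {poly int}) :=
  ((1 + 'X) * gh.1 + 'X * gh.2, 'X * (gh.1 + gh.2)).
Definition level_gen j := iter j path_step (leaf_step (leaf_step (1 + 'X, 'X))).
Definition simple_gen j := (leaf_step (leaf_step (level_gen j))).1.

End Count.

Lemma catalog_notin P ws v : catalog e P ws -> ~~ P v ->
  forall w, w \in ws -> v \notin w.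
Proof. by move=> [ok _ _ _] Pv w /ok[_ /allP wP]; apply: contra Pv => /wP. Qed.

Lemma level_words_gen j : j.+1 < n -> size_gen (level_words j) = (level_gen j).1 /\
  size_gen (with_vertex (vertex true j.+1) (level_words j)) = (level_gen j).2.
Proof.
elim: j => [|j IH] jn.
  have ne b : vertex true 1 != vertex b 0 by apply: vertex_neq => //; lia.
  have g0 : size_gen [:: [::] : seq I] = 1%R by rewrite /size_gen big_seq1 expr0.
  have w0 : size_gen (with_vertex (vertex true 1) [:: [::]]) = 0%R.
    by rewrite /with_vertex /= /size_gen big_nil.
  rewrite [level_words 0]/= !size_gen_add !(size_gen_add_parent _ (ne _)).
  rewrite size_gen_add_with => [|w]; last by rewrite inE => /eqP->.
  by rewrite g0 w0 /level_gen /leaf_step /= !(mulr0, addr0, mulr1).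
have [IH1 IH2] := IH (ltnW jn).
rewrite size_gen_add size_gen_add_with ?IH1 ?IH2 //.
apply: (catalog_notin (level_words_catalog (ltnW jn))).
by rewrite /= level_vertex; lia.
Qed.

Lemma simple_words_gen : size_gen simple_words = simple_gen n.-2.
Proof.
have jn : n.-2.+1 < n by lia.
have nE : n.-2.+1 = n.-1 by lia.
have [g1 g2] := level_words_gen jn; rewrite nE in g2.
have ne b : vertex true n.-1 != vertex b n by apply: vertex_neq => //; lia.
by rewrite /simple_words !size_gen_add !(size_gen_add_parent _ (ne _)) g1 g2.
Qed.

Definition cyc_words N := [seq w <- simple_words | size w == N] ++
  if (0 < N) && (n.+1.*2 %| N) then map (word_pow (N %/ n.+1.*2)) periods else [::].

Lemma uniq_cyc_ok r : uniq r -> cyc_ok e r.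
Proof.
by move=> ur; split=> [i l|i]; rewrite count_uniq_mem //; case: (_ \in _).
Qed.

Lemma CFC_count_affD N : CFC_count (affD n) N =
  count (fun w => size w == N) simple_words +
  if (0 < N) && (n.+1.*2 %| N) then 2 ^ n.+2 + n.+2.*2 else 0.
Proof.
have irr := affD_edge_irr.
have [sok su sinj sall] := simple_words_catalog.
have pfull k r : 0 < k -> r \in periods -> full k (word_pow k r).
  by move=> k0 /periods_full; apply: full_word_pow.
have kN : (0 < N) && (n.+1.*2 %| N) -> 0 < N %/ n.+1.*2 /\
  N = N %/ n.+1.*2 * n.+1.*2.
  move=> /andP[N0 dN]; have NE := divnK dN; split=> //.
  by rewrite lt0n; apply: contraTneq N0 => k0; rewrite -NE k0.
have mixed r k s : uniq r -> 0 < k -> s \in periods -> ~ teq r (word_pow k s).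
  move=> ur k0 sp E; have := full_mid (pfull k s k0 sp) true (h := 1).
  by rewrite -(teq_count _ E) count_uniq_mem //; case: (_ \in _); lia.
rewrite (@CFC_count_representatives _ _ (@affD_edge_sym n) irr N (cyc_words N)).
- rewrite size_cat size_filter; congr (_ + _).
  by case: ifP => // _; rewrite size_map size_periods.
- rewrite cat_uniq filter_uniq //=; apply/andP; split.
    apply/hasPn => r; case: ifP => // /kN[k0 _] /mapP[s sp ->].
    rewrite mem_filter; apply/negP => /andP[_ /sok[uw _]].
    by apply: mixed uw k0 sp _; apply: teq_refl.
  case: ifP => // /kN[k0 _]; rewrite map_inj_in_uniq ?uniq_periods // =>
    r s rp sp E.
  apply: periods_inj => //; apply: (@teq_word_powI (N %/ n.+1.*2)) => //.
  by rewrite E; apply: teq_refl.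
- move=> r; rewrite mem_cat mem_filter => /orP[/andP[/eqP sr /sok[ur _]]|].
    by split=> //; apply: uniq_cyc_ok.
  case: ifP => // /kN[k0 NE] /mapP[s sp ->]; have F := pfull _ _ k0 sp.
  split; first exact: full_cyc_ok F.
  by rewrite (full_size F) [RHS]NE; lia.
- move=> r s; rewrite !mem_cat !mem_filter =>
  /orP[/andP[_ rs]|rp] /orP[/andP[_ ss]|sp] E.
  + exact: sinj.
  + case: ifP sp => // /kN[k0 _] /mapP[t tp tE]; case: (mixed r _ t _ k0 tp).
      by have [] := sok r rs.
    by rewrite -tE.
  + case: ifP rp => // /kN[k0 _] /mapP[t tp tE]; case: (mixed s _ t _ k0 tp).
      by have [] := sok s ss.
    by rewrite -tE; apply: teq_sym.
  case: ifP rp sp => // /kN[k0 _] /mapP[t tp tE] /mapP[t' tp' tE'].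
  rewrite tE tE' in E *; congr (word_pow _ _); apply: periods_inj => //.
  exact: teq_word_powI k0 E.
move=> r cr sr; have [ur|nur] := boolP (uniq r).
  have [w ww rw] := sall r ur (all_predT _); exists w => //.
  by rewrite mem_cat mem_filter ww -(teq_size rw) sr eqxx.
have [x cx] : exists x, 1 < count_mem x r.
  move: nur; elim: r {cr sr} => //= x r IH;
    rewrite negb_and negbK => /orP[xr|/IH[y cy]].
    by exists x; move: xr; rewrite eqxx -has_pred1 has_count.
  by exists y; lia.
have [k k0 F] := cyc_ok_full cr cx; have [s sp rs] := periods_complete k0 F.
have NE : N = k * n.+1.*2 by rewrite -sr (full_size F); lia.
exists (word_pow k s) => //; rewrite mem_cat; apply/orP; right.
rewrite NE muln_gt0 k0 dvdn_mull //= mulnK //.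
by apply/mapP; exists s.
Qed.

End Levels.

Local Open Scope ring_scope.

(** * Degree and recurrence *)

(** Each step adds one vertex and one edge, hence doubles the number of words that
use all vertices. *)
Definition top_coefs (gh : {poly int} * {poly int}) d (c : int) :=
  [/\ gh.1`_d = c, gh.2`_d = c & forall i, (d < i)%N -> gh.1`_i = 0 /\ gh.2`_i = 0].

Lemma coef_1X (p : {poly int}) i : ((1 + 'X) * p)`_i.+1 = p`_i.+1 + p`_i.
Proof. by rewrite mulrDl mul1r coefD coefXM. Qed.

Lemma coef_12X (p : {poly int}) i :
  ((1 + 'X *+ 2) * p)`_i.+1 = p`_i.+1 + p`_i *+ 2.
Proof. by rewrite mulrDl mul1r coefD mulrnAl coefMn coefXM. Qed.

Lemma top_coefs_leaf_step gh d c : top_coefs gh d c ->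
    top_coefs (leaf_step gh) d.+1 (c *+ 2).
Proof.
case: gh => g h [/= gd hd lo]; have [g0 h0] := lo d.+1 (ltnSn d).
split=> /= [||[|i] // di].
- by rewrite coefD coef_1X coefXM gd hd g0 add0r mulr2n.
- by rewrite coef_12X h0 hd add0r.
have [gi hi] := lo i di; have [gi' hi'] := lo i.+1 (ltnW di).
by rewrite coefD coef_1X coef_12X coefXM gi hi gi' hi' mul0rn !addr0.
Qed.

Lemma top_coefs_path_step gh d c : top_coefs gh d c ->
    top_coefs (path_step gh) d.+1 (c *+ 2).
Proof.
case: gh => g h [/= gd hd lo]; have [g0 h0] := lo d.+1 (ltnSn d).
split=> /= [||[|i] // di].
- by rewrite coefD coef_1X coefXM gd hd g0 add0r mulr2n.
- by rewrite coefXM coefD gd hd mulr2n.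
have [gi hi] := lo i di; have [gi' hi'] := lo i.+1 (ltnW di).
by rewrite coefD coef_1X !coefXM coefD gi hi gi' !addr0.
Qed.

Lemma top_coefs_simple_gen j : (simple_gen j)`_(j + 5) = 2 ^+ (j + 4) /\
  forall i, (j + 5 < i)%N -> (simple_gen j)`_i = 0.
Proof.
have t0 : top_coefs (1 + 'X, 'X) 1 1.
  split=> [||i i1] /=; rewrite ?coefD ?coefX ?coef1 ?add0r //.
  by case: i i1 => [|[|i]].
have tj : top_coefs (level_gen j) (j + 3) (2 ^+ (j + 2)).
  elim: j => [|j IH]; first exact: (top_coefs_leaf_step (top_coefs_leaf_step t0)).
  by rewrite /level_gen iterS !addSn exprS mulr_natl; apply: top_coefs_path_step.
have [tc _ th] := top_coefs_leaf_step (top_coefs_leaf_step tj).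
have -> : (j + 5 = (j + 3).+2)%N by lia.
have -> : (j + 4 = (j + 2).+2)%N by lia.
split=> [|i ij]; last by have [] := th i ij.
by rewrite [LHS]tc (exprS _ (j + 2).+1) (exprS _ (j + 2)); ring.
Qed.

Lemma size_simple_gen j : size (simple_gen j) = (j + 6)%N.
Proof.
have [top0 hi] := top_coefs_simple_gen j; apply/eqP; rewrite eqn_leq; apply/andP;
  split.
  by apply/leq_sizeP => i ji; apply: hi; lia.
have -> : (j + 6 = (j + 5).+1)%N by lia.
by rewrite ltnNge; apply/negP => /leq_sizeP/(_ _ (leqnn _))/eqP;
  rewrite top0 expf_eq0 andbF.
Qed.

(** The matrix of [path_step] has trace [1 + 'X *+ 2] and determinant ['X], so this
is the identity of Cayley and Hamilton. *)
Lemma simple_gen_rec j : simple_gen j.+2 =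
  (2%:P * 'X + 1) * simple_gen j.+1 - 'X * simple_gen j.
Proof.
rewrite /simple_gen /level_gen !iterS; case: (iter _ _ _) => g h /=.
have -> : (2 : int)%:P = 2 by rewrite -[2]/(2%:R) polyC_natr.
by ring.
Qed.

(** * Power series and periodicity *)

Lemma sum_pick k m (F : nat -> int) :
  \sum_(i < k.+1) (i == m :> nat)%:R * F i = if (m <= k)%N then F m else 0.
Proof.
case: ifP => mk; last first.
  rewrite big1 // => i _; case: eqP => [im|]; last by rewrite mul0r.
  by move: (ltn_ord i); rewrite im ltnS mk.
have mk1 : (m < k.+1)%N by [].
rewrite (bigD1 (Ordinal mk1)) //= eqxx mul1r big1 ?addr0 // => i.
by rewrite -val_eqE /= => /negPf->; rewrite mul0r.
Qed.

(** The product with [1 - 'X^N] determines the inverse by recurrence. *)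
Lemma ps_inv_geom N k : (0 < N)%N ->
  ps_inv (ps_of_poly (1 - 'X^N : {poly int})) k = (N %| k)%N%:R.
Proof.
move=> N0; have aE i : (1 - 'X^N : {poly int})`_i = (i == 0%N)%:R - (i == N)%:R.
  by rewrite coefB coef1 coefXn.
have u : ps_of_poly (1 - 'X^N : {poly int}) 0%N \is a GRing.unit.
  by rewrite /ps_of_poly aE eqxx eq_sym (gtn_eqF N0) subr0 unitr1.
have [m] := ubnP k; elim: m k => // m IH k km.
have := ps_mulV u k; rewrite /ps_mul /ps_of_poly coef1.
under eq_bigr => i _ do rewrite aE mulrBl.
set b := ps_inv _ in IH *; rewrite sumrB !(sum_pick k _ (fun i => b (k - i)%N)).
rewrite leq0n subn0 => /eqP; rewrite subr_eq => /eqP->.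
case: leqP => Nk; last first.
  rewrite addr0; have [->|k0] := eqVneq k 0%N; first by rewrite dvdn0.
  by rewrite gtnNdvd // lt0n.
rewrite IH; last by lia.
by rewrite gtn_eqF ?add0r ?dvdn_subl //; lia.
Qed.

Lemma ps_geom_coef (c : int) N k : (0 < N)%N ->
  ps_mul (ps_mul (ps_of_poly c%:P) (ps_inv (ps_of_poly (1 - 'X^N))))
    (ps_of_poly 'X^N) k = if ((0 < k) && (N %| k))%N then c else 0.
Proof.
move=> N0; set b := ps_inv _.
have cE i : ps_mul (ps_of_poly c%:P) b i = c * b i.
  rewrite /ps_mul /ps_of_poly big_ord_recl coefC subn0 big1 ?addr0 // => l _.
  by rewrite coefC mul0r.
rewrite {1}/ps_mul (reindex_inj rev_ord_inj) /=.
rewrite (eq_bigr (fun i : 'I_k.+1 => (i == N :> nat)%:R * (c * b (k - i)%N)));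
  last first.
  move=> i _; rewrite cE /ps_of_poly coefXn subSS subKn;
    last by rewrite -ltnS ltn_ord.
  exact: mulrC.
rewrite (sum_pick k N (fun i => c * b (k - i)%N)); have [Nk|Nk] := leqP N k;
  last first.
  by case: (posnP k) Nk => [->|k0] Nk //; rewrite gtnNdvd ?andbF.
rewrite /b ps_inv_geom // dvdn_subl // (leq_trans N0) //=.
by case: (N %| k)%N; rewrite ?mulr1 ?mulr0.
Qed.

Section Periodicity.
Variable n : nat.
Hypothesis n2 : (2 <= n)%N.
Local Notation N := (2 * (n + 1))%N.
Let C : int := 2 ^+ (n + 2) + 2 * (n + 2)%:R.

Lemma C_neq0 : C != 0.
Proof. by rewrite gt_eqF // addr_gt0 ?exprn_gt0 ?mulr_gt0 ?ltr0n //; lia. Qed.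

Lemma CFC_series_affD k : CFC_series (affD n) k =
  (simple_gen (n - 2))`_k + if ((0 < k) && (N %| k))%N then C else 0.
Proof.
have NE : N = n.+1.*2 by lia.
rewrite /CFC_series CFC_count_affD // PoszD NE; congr (_ + _).
  by rewrite subn2 -(simple_words_gen n2) size_genE natz.
case: ifP => // _; rewrite /C !addn2 PoszD -!natz natrX; congr (_ + _).
by rewrite -muln2 mulnC natrM.
Qed.

(** The polynomial part ends in degree [n + 3] with the coefficient
[2 ^+ (n + 2)], and [n + 3] is smaller than [2 * (n + 1)], so that the value
there is not repeated. Beyond that degree the nonzero
coefficients are those whose index is a multiple of [2 * (n + 1)], and every
period is such a multiple. *)
Lemma CFC_series_affD_periodic :
  ultimately_periodic (CFC_series (affD n)) N (n + 4).
Proof.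
have [top0 hi] := top_coefs_simple_gen (n - 2).
have nE : (n - 2 + 5 = n + 3)%N by lia.
have nE' : (n - 2 + 4 = n + 2)%N by lia.
rewrite nE nE' in top0 hi.
have tail k : (n + 4 <= k)%N -> CFC_series (affD n) k = if (N %| k)%N then C else 0.
  by move=> kn; rewrite CFC_series_affD hi ?add0r; [case: k kn => //; lia|lia].
split; first by lia.
- by move=> k kn; rewrite !tail //; [rewrite dvdn_addl|lia].
- move=> N' N'0 [L' per]; pose m := (N * (L' + n + 4))%N.
  have m1 : (L' + n + 4 <= m)%N by rewrite leq_pmull //; lia.
  have := per m; rewrite !tail; try lia.
  have Nm : (N %| m)%N by apply: dvdn_mulr.
  rewrite Nm (dvdn_addr _ Nm); case: ifP => [/dvdn_leq-> //|_] H.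
  by have := C_neq0; rewrite -H ?eqxx //; lia.
move=> L' per; rewrite leqNgt; apply/negP => Ln.
have := per (n + 3)%N; rewrite tail; last by lia.
rewrite CFC_series_affD top0 dvdn_addl // (@gtnNdvd _ N); try lia.
rewrite andbF addr0 => /(_ _) H.
have : (2 : int) ^+ (n + 2) != 0 by rewrite expf_eq0 andbF.
by rewrite -H ?eqxx //; lia.
Qed.

End Periodicity.

(* The source gives n + 2 as the start of the periodicity. This contradicts its
   own generating function: Q_{n+2} has degree n + 3 < 2 (n + 1), so the
   coefficient of q^(n+3) is nonzero, whereas that of q^(n+3+2(n+1)) is zero.
   The least start is n + 4. *)
Theorem proposition3p8 :
  exists Q : nat -> {poly int},
    [/\ Q 4%N = 1 + 5%:P * 'X + 14%:P * 'X^2 + 28%:P * 'X^3 + 33%:P * 'X^4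
              + 16%:P * 'X^5,
        Q 5%N = 1 + 6%:P * 'X + 20%:P * 'X^2 + 46%:P * 'X^3 + 73%:P * 'X^4
              + 72%:P * 'X^5 + 32%:P * 'X^6,
        forall n : nat, (4 <= n)%N ->
          Q (n + 2)%N = (2%:P * 'X + 1) * Q (n + 1)%N - 'X * Q n
      & forall n : nat, (2 <= n)%N ->
          [/\ size (Q (n + 2)%N) = (n + 3).+1,
              CFC_series (affD n) =1
                ps_add (ps_of_poly (Q (n + 2)%N))
                  (ps_mul
                    (ps_mul (ps_of_poly (2 ^+ (n + 2) + 2 * (n + 2)%:R)%:P)
                            (ps_inv (ps_of_poly (1 - 'X^(2 * (n + 1))))))
                    (ps_of_poly 'X^(2 * (n + 1))))
            & ultimately_periodic (CFC_series (affD n)) (2 * (n + 1))%N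
                (n + 4)%N]].

Proof.
have pC m : (m%:R)%:P = m%:R :> {poly int} by rewrite polyC_natr.
exists (fun k => simple_gen (k - 4)); split.
- by rewrite subnn /simple_gen /level_gen /= !pC; ring.
- by rewrite subSnn /simple_gen /level_gen /= !pC; ring.
- move=> n n4; have -> : (n + 2 - 4 = (n - 4).+2)%N by lia.
  have -> : (n + 1 - 4 = (n - 4).+1)%N by lia.
  exact: simple_gen_rec.
move=> n n2; have -> : (n + 2 - 4 = n - 2)%N by lia.
split; first by rewrite size_simple_gen; lia.
  by move=> k; rewrite CFC_series_affD // /ps_add ps_geom_coef //; lia.
exact: CFC_series_affD_periodic.
Qed.
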